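(* Let $\eta\in(0,1)$, $\mu,\beta>0$, and let $S(\cdot)=Y_{\mu,\beta}(\cdot)$ be the Inverse Gaussian subordinator. (i) If $\nu\in(0,1)$, let $p_k^{\eta,\nu}(t)=P\big(N_1^{(\eta)}(S(\mathcal{L}^\nu(t)))=k\big)$ for integers $k\ge 0$. Then, for $t>0$, $$\frac{d_C^\nu}{dt^\nu}\frac{d_C^\nu}{dt^\nu}p_k^{\eta,\nu}(t)-2\frac{\mu}{\beta}\frac{d_C^\nu}{dt^\nu}p_k^{\eta,\nu}(t)=2\frac{\mu^2}{\beta}(1-B)^\eta p_k^{\eta,\nu}(t)\quad\text{for all integers }k\ge 0,$$ with the initial conditions $p_0^{\eta,\nu}(0)=1$ and $p_k^{\eta,\nu}(0)=0$ for all integers $k\ge 1$. (ii) If $\nu\in(1,\infty)$, let $\hat p_k^{\eta,\nu}(t)=P\big(N_1^{(\eta)}(S(\mathcal{A}^{1/\nu}(t)))=k\big)$ for integers $k\ge 0$. Then, for $t>0$, $$\frac{d_{RL}^\nu}{dt^\nu}\frac{d_{RL}^\nu}{dt^\nu}\hat p_k^{\eta,\nu}(t)+2\frac{\mu}{\beta}\frac{d_{RL}^\nu}{dt^\nu}\hat p_k^{\eta,\nu}(t)=2\frac{\mu^2}{\beta}(1-B)^\eta \hat p_k^{\eta,\nu}(t)\quad\text{for all integers }k\ge 0,$$ with the initial conditions $\hat p_0^{\eta,\nu}(0)=1$ and $\hat p_k^{\eta,\nu}(0)=0$ for all integers $k\ge 1$.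
   Context: Inverse Gaussian subordinator. $Y_{\mu,\beta}(\cdot)$ is the L\'evy process started at $0$ such that, for $t>0$, $Y_{\mu,\beta}(t)$ has density $$\frac{\mu t}{(2\pi\beta x^3)^{1/2}}\exp\left(-\frac{(x-\mu t)^2}{2\beta x}\right)1_{(0,\infty)}(x);$$ equivalently $\mathbb{E}[e^{-\theta Y_{\mu,\beta}(t)}]=\exp\left(-\frac{\mu}{\beta}t\left((1+2\beta\theta)^{1/2}-1\right)\right)$ for $\theta\ge 0$. Fractional derivatives. For $\nu\in(0,1)$, $\frac{d_C^\nu}{dt^\nu}$ is the Caputo derivative $$\frac{d_C^\nu}{dt^\nu}f(t)=\frac{1}{\Gamma(1-\nu)}\int_0^t (t-s)^{-\nu}f'(s)\,ds.$$ For $\nu\in(1,\infty)$, $\frac{d_{RL}^\nu}{dt^\nu}$ is the right-sided Riemann-Liouville derivative on $\mathbb{R}_+$ $$\frac{d_{RL}^\nu}{dt^\nu}f(t)=\frac{1}{\Gamma(m-\nu)}\left(-\frac{d}{dt}\right)^m\int_t^\infty\frac{f(s)}{(s-t)^{\nu-m+1}}\,ds,\qquad m=\lfloor\nu\rfloor+1.$$ Difference operator. $B$ is the backward shift in $k$, $Bf(k)=f(k-1)$, and $$(1-B)^\eta f(k)=\sum_{j=0}^\infty(-1)^j\binom{\eta}{j}f(k-j),\qquad \binom{\eta}{j}=\frac{\eta(\eta-1)\cdots(\eta-j+1)}{j!},\ \binom{\eta}{0}=1,$$ where probability mass functions are taken to be $0$ at negative integers (so the sum is finite); it acts on the index $k$.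 Stable subordinator and inverse. For $\alpha\in(0,1)$, $\mathcal{A}^\alpha(\cdot)$ is the stable subordinator: the L\'evy process started at $0$ with $\mathbb{E}[e^{-\theta\mathcal{A}^\alpha(t)}]=e^{-\theta^\alpha t}$ for $\theta\ge 0$. Its inverse is $\mathcal{L}^\alpha(t)=\inf\{z:\mathcal{A}^\alpha(z)>t\}$. Space-fractional Poisson process. $N_1^{(\eta)}(t)=N_1(\mathcal{A}^{\eta}(t))$, where $N_1(\cdot)$ is a Poisson process of intensity $1$ independent of the stable subordinator $\mathcal{A}^\eta(\cdot)$. The processes $N_1^{(\eta)}(\cdot)$, $S(\cdot)$ and the time change ($\mathcal{L}^\nu(\cdot)$ in (i), $\mathcal{A}^{1/\nu}(\cdot)$ in (ii)) are mutually independent. *)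

(* Defs.v *)
From HB Require Import structures.
From mathcomp Require Import all_boot all_order all_algebra.
From mathcomp Require Import all_classical all_reals all_analysis.
Set Implicit Arguments.
Unset Strict Implicit.
Unset Printing Implicit Defensive.
Import Order.TTheory GRing.Theory Num.Theory.
Import numFieldNormedType.Exports.
Local Open Scope classical_set_scope.
Local Open Scope ring_scope.

(** A process indexed by the nonnegative reals is a map [X : R -> T -> R];
    its values at negative times are never constrained nor used. *)

Section independence.
Context {R : realType} {d : measure_display} {T : measurableType d}.
Variable P : probability T R.

(** Every class to which this is applied is a sigma-algebra, so the product
    rule for subfamilies is obtained by taking some [E i] equal to [setT]. *)
Definition mutually_independent (n : nat) (F : 'I_n -> set_system T) : Prop :=
  forall E : 'I_n -> set T, (forall i, F i (E i)) ->
    (P (\bigcap_i E i) = \prod_(i < n) P (E i))%E.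

Definition rv_sigma (Y : T -> R) : set_system T :=
  preimage_set_system setT Y measurable.

Definition process_sigma (X : R -> T -> R) : set_system T :=
  <<s \bigcup_(t in [set t : R | 0 <= t]) rv_sigma (X t) >>.

Definition independent_processes (n : nat) (X : n.-tuple (R -> T -> R)) :=
  mutually_independent (fun i : 'I_n => process_sigma (tnth X i)).

End independence.

Section processes.
Context {R : realType} {d : measure_display} {T : measurableType d}.
Variable P : probability T R.

Record levy_process (X : R -> T -> R) : Prop := {
  levy_measurable : forall t, 0 <= t -> measurable_fun setT (X t);
  levy_start : forall w, X 0 w = 0;
  levy_independent : forall (n : nat) (t : nat -> R), 0 <= t 0%N ->
    {homo t : i j / (i <= j)%N >-> i <= j} ->
    mutually_independent P
      (fun i : 'I_n => rv_sigma (fun w => X (t i.+1) w - X (t i) w));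
  levy_stationary : forall s t, 0 <= s -> s <= t ->
    forall B : set R, measurable B ->
      P ((fun w => X t w - X s w) @^-1` B) = P (X (t - s) @^-1` B);
  levy_right_continuous : forall w t, 0 <= t -> X ^~ w @ t^'+ --> X t w;
  levy_left_limits : forall w t, 0 < t -> cvg (X ^~ w @ t^'-)
}.

Definition subordinator (X : R -> T -> R) : Prop :=
  levy_process X /\
  forall w s t, 0 <= s -> s <= t -> X s w <= X t w.

Definition poisson_process (lambda : R) (X : R -> T -> R) : Prop :=
  levy_process X /\
  forall t, 0 < t -> forall k : nat,
    P (X t @^-1` [set k%:R]) = (poisson_pmf (lambda * t) k)%:E.

Definition stable_subordinator (alpha : R) (X : R -> T -> R) : Prop :=
  subordinator X /\
  forall t theta, 0 <= t -> 0 <= theta ->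
    ('E_P[fun w => expR (- (theta * X t w))] =
     (expR (- (theta `^ alpha * t)))%:E)%E.

Definition inverse_gaussian_density (mu beta t x : R) : R :=
  if 0 < x then
    mu * t / Num.sqrt (2 * pi * beta * x ^+ 3) *
    expR (- ((x - mu * t) ^+ 2 / (2 * beta * x)))
  else 0.

Definition inverse_gaussian_subordinator (mu beta : R) (X : R -> T -> R) :
    Prop :=
  subordinator X /\
  forall t, 0 < t -> forall B : set R, measurable B ->
    (P (X t @^-1` B) =
     \int[lebesgue_measure]_(x in B) (inverse_gaussian_density mu beta t x)%:E)%E.

(** [inf] is [0] on an empty set; for a stable subordinator, whose paths are
    almost surely unbounded, this only matters on a null event. *)
Definition inverse_process (A : R -> T -> R) (t : R) (w : T) : R :=
  inf [set z | 0 <= z /\ t < A z w].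

Definition time_changed (X Y : R -> T -> R) (t : R) (w : T) : R :=
  X (Y t w) w.

Definition pmf_at (Z : R -> T -> R) (k : int) (t : R) : R :=
  if k is Posz n then fine (P (Z t @^-1` [set n%:R])) else 0.

End processes.

Section operators.
Context {R : realType}.
Local Notation leb := (@lebesgue_measure R).

Definition Gamma (z : R) : R :=
  \int[leb]_(x in `]0, +oo[) (x `^ (z - 1) * expR (- x)).

Definition caputo_integrand (nu : R) (f : R -> R) (t s : R) : R :=
  (t - s) `^ (- nu) * derive1 f s.

Definition caputo (nu : R) (f : R -> R) (t : R) : R :=
  (Gamma (1 - nu))^-1 * \int[leb]_(s in `]0, t[) caputo_integrand nu f t s.

(** Since derivatives and integrals are total functions in the library, this
    says that [caputo nu f t] is meaningful for every [t > 0]. *)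
Definition caputo_derivable (nu : R) (f : R -> R) : Prop :=
  forall t, 0 < t -> derivable f t 1 /\
    leb.-integrable `]0, t[ (EFin \o caputo_integrand nu f t).

Definition rl_order (nu : R) : nat := (Num.truncn nu).+1.

Definition rl_integrand (nu : R) (f : R -> R) (t s : R) : R :=
  f s / (s - t) `^ (nu - (rl_order nu)%:R + 1).

Definition rl_integral (nu : R) (f : R -> R) (t : R) : R :=
  \int[leb]_(s in `]t, +oo[) rl_integrand nu f t s.

Definition riemann_liouville (nu : R) (f : R -> R) (t : R) : R :=
  (Gamma ((rl_order nu)%:R - nu))^-1 *
  ((-1) ^+ rl_order nu * derive1n (rl_order nu) (rl_integral nu f) t).

(** The analogue of [caputo_derivable] for [riemann_liouville]. *)
Definition riemann_liouville_derivable (nu : R) (f : R -> R) : Prop :=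
  forall t, 0 < t ->
    leb.-integrable `]t, +oo[ (EFin \o rl_integrand nu f t) /\
    forall i, (i < rl_order nu)%N ->
      derivable (derive1n i (rl_integral nu f)) t 1.

Definition gbinom (eta : R) (j : nat) : R :=
  (\prod_(i < j) (eta - i%:R)) / (j`!)%:R.

Definition frac_difference (eta : R) (f : int -> R) (k : int) : R :=
  limn (series (fun j : nat => (-1) ^+ j * gbinom eta j * f (k - j%:Z))).

End operators.

(* Main.v *)
(* Put psi(u) = (mu / beta) (sqrt (1 + 2 beta (1 - u)^eta) - 1), so that
   psi^2 + 2 (mu / beta) psi = 2 (mu^2 / beta) (1 - u)^eta. Conditioning on the
   time changes one after the other, the probability generating function of
   the process at time t is E exp (- psi(u) tau_t), with tau the outer time
   change. Write psi(u) = c (1 - w(u))^(1 / rho) with w(u) = O(u), where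
   rho = 1 in (i) and rho = 1 / nu in (ii); the generating function is then
   a power series in w whose coefficients e_j(t) are explicit. On the e_j the
   fractional derivative, up to the sign -1 in (i), acts as
   c (1 - shift)^(1 / rho), where shift e_j = e_(j-1), that is, as
   multiplication of the generating function by psi. Applying it twice, the
   quadratic equation of psi becomes the claimed equation, read off on the
   coefficients of u^k. Only asymptotic expansions at u = 0+ are used, so that
   no convergence in u is needed.

   In (ii), E exp (- psi A_t) = exp (- psi^(1 / nu) t) and
   e_j(t) = e^(- g t) (g t)^j / j! with g = c^(1 / nu). In (i) the law of L_t is
   needed: Laplace uniqueness gives A_z ~ z^(1 / nu) A_1, hence
   L_t ~ (t / A_1)^nu, and the moments E A_1^(- nu n) = n! / Gamma(nu n + 1) give
   E exp (- x L_t) = sum_n (- x t^nu)^n / Gamma(nu n + 1). *)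

Require Import Defs.
From HB Require Import structures.
From mathcomp Require Import all_boot all_order all_algebra.
From mathcomp Require Import all_classical all_reals all_analysis.
From mathcomp Require Import measurable_realfun.
From mathcomp Require Import ring lra.
Import Order.TTheory GRing.Theory Num.Theory.
Import numFieldNormedType.Exports.
Set Implicit Arguments.
Unset Strict Implicit.
Unset Printing Implicit Defensive.
Local Open Scope classical_set_scope.
Local Open Scope ring_scope.

(** * Asymptotic expansions at 0+ *)

Section asymptotic_expansions.
Context {R : realType}.
Implicit Types (f g w : R -> R) (a b : nat -> R).

(** The obstacle is to differentiate in t inside a generating function: neither smoothness of the
    p_k nor an interchange of fractional derivatives with a series in u is given beforehand. It is
    avoided because w(u) = O(u): the coefficient of u^k in w^j vanishes for j > k, so each p_k is a
    finite combination, with coefficients free of t, of e_0, ..., e_k. Existence and values of its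
    fractional derivatives then follow by linearity from those of the explicit e_j. The exponent rho
    is the one for which the Laplace transform of the outer time change, taken at psi(u), depends on
    u through an affine function of w; the constant c is psi(0+), which makes w vanish at 0. The
    signs of the first-order terms differ because the Caputo derivative maps E exp(- psi L_t) to -
    psi times itself, while the right-sided Riemann-Liouville derivative maps exp(- psi^(1 / nu) t)
    to + psi times itself; the quadratic identity behind both equations is the same. *)

Definition expands_upto (n : nat) f a : Prop :=
  exists2 C, 0 <= C &
    \forall u \near 0^'+, `|f u - \sum_(k < n) a k * u ^+ k| <= C * u ^+ n.

Definition expands f a : Prop := forall n, expands_upto n f a.

(** The choice is legitimate because coefficients are unique, see [coefsP]; a function without an
    expansion gets the zero sequence. *)
Definition coefs f : nat -> R := xget (fun=> 0) [set a | expands f a].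

Definition expandable f : Prop := exists a, expands f a.

Definition conv a b (k : nat) : R := \sum_(i < k.+1) a i * b (k - i)%N.

Lemma near0_gt0 : \forall u \near (0 : R)^'+, 0 < u.
Proof. exact: nbhs_right_gt. Qed.

Lemma near0_lt1 : \forall u \near (0 : R)^'+, u < 1.
Proof. exact: nbhs_right_lt. Qed.

(** Removing the constant term and dividing by [u] lowers the order by one; the inductions for
    products and for uniqueness run through this equivalence. *)
Lemma expands_uptoS n f a :
  expands_upto n.+1 f a <->
  expands_upto n (fun u => (f u - a 0%N) / u) (fun k => a k.+1).
Proof.
have key u : 0 < u -> f u - \sum_(k < n.+1) a k * u ^+ k =
    ((f u - a 0%N) / u - \sum_(k < n) a k.+1 * u ^+ k) * u.
  move=> u0; rewrite big_ord_recl/= expr0 mulr1 mulrBl divfK ?gt_eqF//.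
  rewrite mulr_suml opprD addrA; congr (_ - _).
  by apply: eq_bigr => i _; rewrite exprSr mulrA.
split=> -[C C0 H]; exists C => //; near=> u.
- have u0 : 0 < u by near: u; exact: near0_gt0.
  rewrite -(ler_pM2r u0) -mulrA -exprSr -[X in _ * X <= _](gtr0_norm u0).
  rewrite -normrM -key//.
  by near: u.
- have u0 : 0 < u by near: u; exact: near0_gt0.
  rewrite key// normrM (gtr0_norm u0) exprSr mulrA ler_pM2r//.
  by near: u.
Unshelve. all: by end_near. Qed.

Lemma eq_expands_upto n f g a b : {near 0^'+, f =1 g} ->
  (forall k, (k < n)%N -> a k = b k) ->
  expands_upto n f a -> expands_upto n g b.
Proof.
move=> fg ab [C C0 H]; exists C => //; near=> u.
have <- : f u = g u by near: u.
under eq_bigr do rewrite -ab//.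
by near: u.
Unshelve. all: by end_near. Qed.

Lemma expands_uptoW n f a : expands_upto n.+1 f a -> expands_upto n f a.
Proof.
move=> [C C0 H]; exists (C + `|a n|); first by rewrite addr_ge0.
near=> u.
have u0 : 0 < u by near: u; exact: near0_gt0.
have u1 : u < 1 by near: u; exact: near0_lt1.
have : `|f u - \sum_(k < n.+1) a k * u ^+ k| <= C * u ^+ n.+1 by near: u.
rewrite big_ord_recr/= opprD addrA => h.
rewrite -(subrK (a n * u ^+ n) (f u - _)).
rewrite (le_trans (ler_normD _ _))// mulrDl lerD//.
  rewrite (le_trans h)// ler_wpM2l// exprS ler_piMl ?exprn_ge0// ltW//.
by rewrite normrM (gtr0_norm (exprn_gt0 _ u0)).
Unshelve. all: by end_near. Qed.

Lemma expands_uptoD n f g a b : expands_upto n f a -> expands_upto n g b ->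
  expands_upto n (f \+ g) (fun k => a k + b k).
Proof.
move=> [C C0 H] [D D0 K]; exists (C + D); first by rewrite addr_ge0.
near=> u => /=.
under eq_bigr do rewrite mulrDl.
rewrite big_split/= opprD addrACA mulrDl (le_trans (ler_normD _ _))// lerD//.
- by near: u.
- by near: u.
Unshelve. all: by end_near. Qed.

Lemma expands_uptoZ n c f a : expands_upto n f a ->
  expands_upto n (fun u => c * f u) (fun k => c * a k).
Proof.
move=> [C C0 H]; exists (`|c| * C); first by rewrite mulr_ge0.
near=> u => /=.
under eq_bigr do rewrite -mulrA.
rewrite -mulr_sumr -mulrBr normrM -mulrA ler_wpM2l//.
by near: u.
Unshelve. all: by end_near. Qed.

(** Induction on the order, from (f g - a_0 b_0) / u = ((f - a_0) / u) g + a_0 (g - b_0) / u, whose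
    right-hand side involves a product at the lower order. *)
Lemma expands_uptoM n f g a b : expands_upto n f a -> expands_upto n g b ->
  expands_upto n (f \* g) (conv a b).
Proof.
elim: n f g a b => [|n IH] f g a b.
  move=> [C C0 H] [D D0 K]; exists (C * D); first by rewrite mulr_ge0.
  near=> u => /=.
  have : `|f u - \sum_(k < 0) a k * u ^+ k| <= C * u ^+ 0 by near: u.
  have : `|g u - \sum_(k < 0) b k * u ^+ k| <= D * u ^+ 0 by near: u.
  rewrite !big_ord0 !subr0 !expr0 !mulr1 normrM => h1 h2.
  by rewrite ler_pM.
move=> fa gb.
have gbn := expands_uptoW gb.
move/expands_uptoS : fa => fa; move/expands_uptoS : gb => gb.
apply/expands_uptoS.
have := expands_uptoD (IH _ _ _ _ fa gbn) (expands_uptoZ (a 0%N) gb).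
apply: eq_expands_upto.
  near=> u => /=.
  have u0 : u != 0 by rewrite gt_eqF//; near: u; exact: near0_gt0.
  by rewrite /conv big_ord1 subnn; field.
move=> k _; rewrite /conv [in RHS]big_ord_recl/= subn0 addrC; congr (_ + _).
Unshelve. all: by end_near. Qed.

(** Both constant terms are the limit of [f] at 0+; the others follow by peeling off the common
    constant term. *)
Lemma expands_upto_uniq n f a b : expands_upto n f a -> expands_upto n f b ->
  forall k, (k < n)%N -> a k = b k.
Proof.
elim: n f a b => // n IH f a b fa fb.
have ab0 : a 0%N = b 0%N.
  have weak m c : expands_upto m.+1 f c -> expands_upto 1 f c.
    by elim: m => // m Hm /expands_uptoW.
  have /weak[C C0 H] := fa; have /weak[D D0 K] := fb.
  apply/eqP; rewrite eq_sym -subr_eq0 -normr_le0; apply/ler_addgt0Pr => e e0.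
  rewrite add0r.
  have CD : 0 < C + D + 1 by rewrite ltr_wpDl ?addr_ge0.
  near (0 : R)^'+ => u.
  have u0 : 0 < u by near: u; exact: near0_gt0.
  have : `|f u - \sum_(k < 1) a k * u ^+ k| <= C * u ^+ 1 by near: u.
  have : `|f u - \sum_(k < 1) b k * u ^+ k| <= D * u ^+ 1 by near: u.
  rewrite !big_ord1 !expr0 !mulr1 expr1 => h1 h2.
  have -> : b 0%N - a 0%N = (f u - a 0%N) - (f u - b 0%N) by ring.
  rewrite (le_trans (ler_normB _ _))// (le_trans (lerD h2 h1))//.
  rewrite -mulrDl.
  have : u < e / (C + D + 1).
    by near: u; apply: nbhs_right_lt; rewrite divr_gt0.
  rewrite ltr_pdivlMr// => /ltW; apply: le_trans.
  by rewrite mulrC ler_wpM2l ?lerDl// ltW.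
move/expands_uptoS : fa => fa; move/expands_uptoS : fb => fb.
case=> [//|k] kn; rewrite ab0 in fa.
exact: (IH _ (fun k => a k.+1) (fun k => b k.+1) fa fb k kn).
Unshelve. all: by end_near. Qed.

Lemma coefsP f a : expands f a -> coefs f = a.
Proof.
move=> fa; rewrite /coefs; case: xgetP => /=; last by move=> /(_ a).
move=> b _ fb; apply/funext => k.
exact: (expands_upto_uniq (fb k.+1) (fa k.+1)).
Qed.

Lemma expandableP f : expandable f -> expands f (coefs f).
Proof. by move=> -[a fa]; rewrite (coefsP fa). Qed.

Lemma eq_expands f g a : {near 0^'+, f =1 g} -> expands f a -> expands g a.
Proof. by move=> fg fa n; apply: eq_expands_upto (fa n). Qed.

Lemma eq_coefs f g : {near 0^'+, f =1 g} -> coefs f = coefs g.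
Proof.
move=> fg; rewrite /coefs; congr xget; apply/seteqP; split => a /=.
  exact: eq_expands.
apply: eq_expands; near=> u; apply/esym; near: u; exact: fg.
Unshelve. all: by end_near. Qed.

Lemma expandsD f g a b : expands f a -> expands g b ->
  expands (f \+ g) (fun k => a k + b k).
Proof. by move=> fa gb n; exact: expands_uptoD. Qed.

Lemma expandsZ c f a : expands f a -> expands (fun u => c * f u) (fun k => c * a k).
Proof. by move=> fa n; exact: expands_uptoZ. Qed.

Lemma expandsM f g a b : expands f a -> expands g b -> expands (f \* g) (conv a b).
Proof. by move=> fa gb n; exact: expands_uptoM. Qed.

Lemma expands_cst c : expands (fun=> c) (fun k => if k is 0%N then c else 0).
Proof.
case=> [|n].
  exists `|c| => //; near=> u; by rewrite big_ord0 subr0 mulr1.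
exists 0 => //; near=> u.
by rewrite big_ord_recl/= big1 ?addr0 ?mulr1 ?subrr ?normr0 ?mul0r// => i _; rewrite mul0r.
Unshelve. all: by end_near. Qed.

Lemma expands_sum n (F : nat -> R -> R) (a : nat -> nat -> R) :
  (forall i, expands (F i) (a i)) ->
  expands (fun u => \sum_(i < n) F i u) (fun k => \sum_(i < n) a i k).
Proof.
move=> Fa; elim: n => [|n IH] m.
  apply: eq_expands_upto (expands_cst 0 m).
    by apply: nearW => u; rewrite big_ord0.
  by move=> k _; rewrite big_ord0; case: k.
apply: eq_expands_upto (expands_uptoD (IH m) (Fa n m)).
  by apply: nearW => u; rewrite big_ord_recr.
by move=> k _; rewrite big_ord_recr.
Qed.

Lemma expandableM f g : expandable f -> expandable g -> expandable (f \* g).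
Proof. by move=> [a fa] [b gb]; exists (conv a b); exact: expandsM. Qed.

Lemma expandableX f n : expandable f -> expandable (fun u => f u ^+ n).
Proof.
move=> fe; elim: n => [|n IH].
  by under eq_fun do rewrite expr0; eexists; exact: expands_cst.
under eq_fun do rewrite exprS.
exact: expandableM.
Qed.

Lemma expandable_cst c : expandable (fun=> c).
Proof. by eexists; exact: expands_cst. Qed.

Lemma expandableZ c f : expandable f -> expandable (fun u => c * f u).
Proof. by move=> [a fa]; eexists; exact: expandsZ. Qed.

Lemma coefs_small f n : expandable f ->
  (exists C, \forall u \near 0^'+, `|f u| <= C * u ^+ n) ->
  forall k, (k < n)%N -> coefs f k = 0.
Proof.
move=> fe [C fC].
apply: (expands_upto_uniq (expandableP fe n)) => //.
exists `|C| => //; near=> u.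
rewrite big1 ?subr0; last by move=> i _; rewrite mul0r.
apply: (@le_trans _ _ (C * u ^+ n)); first by near: u.
have u0 : 0 < u by near: u; exact: near0_gt0.
by rewrite ler_wpM2r ?ler_norm// exprn_ge0// ltW.
Unshelve. all: by end_near. Qed.

(* The hypotheses say that [w] is positive and [O(u)]. *)
Lemma expands_comp f a w h : expands f a -> expandable w -> coefs w 0 = 0 ->
  (\forall u \near 0^'+, 0 < w u) -> expandable h ->
  expands (fun u => f (w u) * h u)
    (fun k => \sum_(l < k.+1) a l * coefs (fun u => w u ^+ l * h u) k).
Proof.
move=> fa we w0 wpos he.
have [C C0 wC] : exists2 C, 0 <= C & \forall u \near 0^'+, w u <= C * u.
  have [C C0 wC] := expandableP we 1; exists C => //.
  near=> u; have : `|w u - \sum_(k < 1) coefs w k * u ^+ k| <= C * u ^+ 1 by near: u.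
  rewrite big_ord1 w0 mul0r subr0 expr1; apply: le_trans; exact: ler_norm.
have wcvg : w u @[u --> 0^'+] --> 0^'+.
  have C1 : 0 < C + 1 by rewrite ltr_wpDl.
  move=> A [e /= e0 eA]; suff : \forall u \near (0 : R)^'+, A (w u) by [].
  near=> u.
  have wu : 0 < w u by near: u.
  apply: (eA (w u)) => //=; rewrite sub0r normrN gtr0_norm//.
  apply: (@le_lt_trans _ _ (C * u)); first by near: u.
  have : u < e / (C + 1) by near: u; apply: nbhs_right_lt; rewrite divr_gt0.
  rewrite ltr_pdivlMr// mulrC; apply: le_lt_trans.
  have u0 : 0 < u by near: u; exact: near0_gt0.
  by rewrite ler_wpM2r// ?lerDl// ltW.
have [D D0 hD] : exists2 D, 0 <= D & \forall u \near 0^'+, `|h u| <= D.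
  have [D D0 hD] := expandableP he 0; exists D => //; near=> u.
  have : `|h u - \sum_(k < 0) coefs h k * u ^+ k| <= D * u ^+ 0 by near: u.
  by rewrite big_ord0 subr0 mulr1.
have wle l : expandable (fun u => w u ^+ l * h u).
  by apply: expandableM => //; exact: expandableX.
move=> n.
(* Since w^l h = O(u^l), the sum over [l] is finite in each coefficient; this is where the bound
   [l < k.+1] of the statement comes from. *)
have small l k : (k < l)%N -> coefs (fun u => w u ^+ l * h u) k = 0.
  apply: coefs_small => //; exists (C ^+ l * D); near=> u.
  have wu : 0 < w u by near: u.
  rewrite normrM normrX (gtr0_norm wu).
  have hu : `|h u| <= D by near: u.
  have wCu : w u <= C * u by near: u.
  rewrite mulrAC ler_pM ?exprn_ge0 ?(ltW wu)// -exprMn.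
  by apply: lerXn2r => //; rewrite nnegrE ltW// (lt_le_trans wu wCu).
have e1 : expands (fun u => \sum_(l < n) a l * (w u ^+ l * h u))
    (fun k => \sum_(l < n) a l * coefs (fun u => w u ^+ l * h u) k).
  apply: (expands_sum n (F := fun l u => a l * (w u ^+ l * h u))
    (a := fun l k => a l * coefs (fun u => w u ^+ l * h u) k)) => i.
  by apply: expandsZ; exact: expandableP.
(* The order-[n] remainder of [f], evaluated at w(u), is O(w^n) = O(u^n). *)
have e2 : expands_upto n (fun u => f (w u) * h u - \sum_(l < n) a l * (w u ^+ l * h u))
    (fun=> 0).
  have [E E0 fE] := fa n; exists (E * C ^+ n * D).
    by rewrite !mulr_ge0 ?exprn_ge0.
  near=> u.
  rewrite [X in _ - X]big1 ?subr0; last by move=> i _; rewrite mul0r.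
  under eq_bigr do rewrite mulrA.
  rewrite -mulr_suml -mulrBl normrM.
  have hu : `|h u| <= D by near: u.
  have wCu : w u <= C * u by near: u.
  have wu : 0 < w u by near: u.
  rewrite mulrAC ler_pM//.
  apply: (@le_trans _ _ (E * w u ^+ n)).
    near: u; exact: (wcvg _ fE).
  rewrite -mulrA ler_wpM2l// -exprMn.
  by apply: lerXn2r => //; rewrite nnegrE ltW// (lt_le_trans wu wCu).
apply: eq_expands_upto (expands_uptoD (e1 n) e2).
  by near=> u => /=; rewrite addrC subrK.
move=> k kn; rewrite addr0.
rewrite (big_ord_widen n (fun l => a l * coefs (fun u => w u ^+ l * h u) k) kn).
rewrite [LHS](bigID (fun l : 'I_n => (l < k.+1)%N))/= [X in _ + X]big1 ?addr0//.
by move=> i; rewrite -leqNgt => ki; rewrite small ?mulr0.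
Unshelve. all: by end_near. Qed.

End asymptotic_expansions.

(** * Expansion of real powers of 1 - u *)

Section binomial_expansion.
Context {R : realType}.
Implicit Types (f g w : R -> R) (a b : nat -> R).

Lemma is_derive_monomial (c : R) n (x : R) :
  is_derive x (1 : R) (fun y => c * y ^+ n.+1) (c * n.+1%:R * x ^+ n).
Proof.
have -> : (fun y : R => c * y ^+ n.+1) = c \*: (id ^+ n.+1).
  by apply/funext => y; rewrite exprfctE.
have := is_deriveZ c (is_deriveX n.+1 (is_derive_id x (1 : R))).
by move=> h; apply: (is_derive_eq h); rewrite /= /GRing.scale/= mulr1 mulrA.
Qed.

(** Asymptotic expansions may be integrated, though in general not differentiated, term by term: the
    mean value theorem turns an O(u^n) bound on the derivative of the error [D] into an O(u^(n + 1))
    bound on [D]. *)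
Lemma expands_upto_integrate n (F f : R -> R) a :
  (forall u : R, u < 1 -> is_derive u (1 : R) F (f u)) -> expands_upto n f a ->
  expands_upto n.+1 F (fun k => if k is k'.+1 then a k' / k%:R else F 0).
Proof.
move=> dF [C C0 [e /= e0 H]]; exists C => //; near=> u.
have u0 : 0 < u by near: u; exact: near0_gt0.
have u1 : u < 1 by near: u; exact: near0_lt1.
have ue : u < e by near: u; exact: nbhs_right_lt.
pose D := F - (cst (F 0) + \sum_(k < n) (fun v : R => a k / k.+1%:R * v ^+ k.+1)).
pose d (v : R) := f v - \sum_(k < n) a k * v ^+ k.
have DD (v : R) : v < 1 -> is_derive v (1 : R) D (d v).
  move=> v1.
  have hs : is_derive v (1 : R)
      (\sum_(k < n) (fun v : R => a k / k.+1%:R * v ^+ k.+1)) (\sum_(k < n) a k * v ^+ k).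
    apply: is_derive_sum => k.
    have := is_derive_monomial (a k / k.+1%:R) k v.
    by move=> h; apply: (is_derive_eq h); rewrite divfK ?pnatr_eq0.
  have := is_deriveB (dF v v1) (is_deriveD (is_derive_cst (F 0) v (1 : R)) hs).
  by move=> h; apply: (is_derive_eq h); rewrite add0r.
have DE v : D v = F v - \sum_(k < n.+1) (if k : nat is k'.+1 then a k' / k%:R else F 0) * v ^+ k.
  rewrite /D fctE big_ord_recl/= expr0 mulr1; congr (_ - (_ + _)).
  by rewrite fct_sumE.
have [v||c cu] := @MVT R D d 0 u u0.
  by rewrite in_itv/= => /andP[_ vu]; apply: DD; exact: lt_trans vu u1.
apply: derivable_within_continuous => v; rewrite in_itv/= => /andP[_ vu].
  by apply: ex_derive; apply: DD; exact: le_lt_trans vu u1.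
have D0 : D 0 = 0.
  rewrite DE big_ord_recl/= expr0 mulr1 big1 ?addr0 ?subrr// => i _.
  by rewrite exprS mul0r mulr0.
rewrite D0 !subr0 -DE => ->.
move: cu; rewrite in_itv/= => /andP[c0 cu].
rewrite normrM (gtr0_norm u0) exprSr mulrA ler_pM2r//.
apply: (@le_trans _ _ (C * c ^+ n)).
  apply: H => //=; rewrite sub0r normrN gtr0_norm//; exact: lt_trans cu ue.
by rewrite ler_wpM2l// lerXn2r ?nnegrE// ltW.
Unshelve. all: by end_near. Qed.

(** The coefficient of u^j in (1 - u)^s; for s = eta these are also the weights of the fractional
    difference. *)
Definition binom_coef (s : R) (j : nat) : R := (-1) ^+ j * gbinom s j.

Lemma binom_coef0 s : binom_coef s 0 = 1.
Proof. by rewrite /binom_coef /gbinom big_ord0 expr0 divr1 mulr1. Qed.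

(** On coefficients, the identity d/du (1 - u)^s = - s (1 - u)^(s - 1). *)
Lemma binom_coefS s j :
  binom_coef s j.+1 = - s * binom_coef (s - 1) j / j.+1%:R.
Proof.
rewrite /binom_coef /gbinom big_ord_recl/= subr0 exprS factS natrM invfM.
under eq_bigr => i _.
  rewrite /bump/= natrD opprD addrA.
  over.
set p := \prod_(i < j) _.
ring.
Qed.

(** The derivative is of the same form with exponent s - 1, so the induction on the order treats all
    exponents at once and gains one order by integration; the base case is boundedness near 0. *)
Lemma expands_onem_powR s : expands (fun u => (1 - u) `^ s) (binom_coef s).
Proof.
have dF r (u : R) : u < 1 ->
    is_derive u (1 : R) (fun u => (1 - u) `^ r) (- r * (1 - u) `^ (r - 1)).
  move=> u1; have u10 : 0 < 1 - u by rewrite subr_gt0.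
  have h1 := is_deriveB (is_derive_cst (1 : R) u (1 : R)) (is_derive_id u (1 : R)).
  have h := @is_derive1_comp R (@powR R ^~ r) (cst 1 - id) u _ _ (is_derive1_powR r u10) h1.
  by apply: (is_derive_eq h); rewrite sub0r mulrN1 mulNr.
move=> n; elim: n s => [|n IH] s.
  exists 2 => //.
  have : {for 0, continuous (fun u : R => (1 - u) `^ s)}.
    apply: differentiable_continuous; apply/derivable1_diffP.
    by apply: ex_derive; exact: dF.
  move=> /cvg_at_right_filter/cvgr_dist_lt/(_ _ ltr01) h; near=> u.
  rewrite big_ord0 subr0 mulr1.
  have : `|(1 - 0) `^ s - (1 - u) `^ s| < 1 by near: u.
  rewrite subr0 powR1 => hu.
  rewrite -(subKr 1 ((1 - u) `^ s)) (le_trans (ler_normB _ _))// normr1.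
  by rewrite -[leRHS]/(1 + 1) lerD2l ltW.
have := expands_upto_integrate (dF s) (expands_uptoZ (- s) (IH (s - 1))).
apply: eq_expands_upto; first exact: nearW.
case=> [_|k _]; first by rewrite subr0 powR1 binom_coef0.
by rewrite binom_coefS.
Unshelve. all: by end_near. Qed.

End binomial_expansion.

(** Both sides run over the pairs (i, l) with i + l < n. *)
Lemma sum_antidiagonals (V : nmodType) (H : nat -> nat -> V) n :
  \sum_(j < n) \sum_(l < j.+1) H (j - l)%N l = \sum_(i < n) \sum_(l < n - i) H i l.
Proof.
elim: n => [|n IH]; first by rewrite !big_ord0.
rewrite big_ord_recr/= IH [in RHS]big_ord_recr/= subSnn big_ord1.
under [in RHS]eq_bigr => i _ do rewrite subSn ?(ltnW (ltn_ord i))// big_ord_recr/=.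
rewrite big_split/= -addrA; congr (_ + _).
rewrite (reindex_inj rev_ord_inj)/= big_ord_recr/= subnn subn0.
congr (_ + _); by apply: eq_bigr => i _; rewrite subSS subKn// ltnW.
Qed.

(** * Operators acting on generating functions composed with w *)

Section generator_expansion.
Context {R : realType}.
Variables (w : R -> R) (B : R -> R) (beta : nat -> R) (e : nat -> R -> R).
Hypotheses (we : expandable w) (w0 : coefs w 0 = 0).
Hypothesis wpos : \forall u \near 0^'+, 0 < w u.
Hypothesis Bbeta : expands B beta.

(** The coefficient of y^j in the product of B(y) with the generating function of the [e i t], where
    [beta] lists the coefficients of B. *)
Definition shifted_sum (j : nat) (t : R) := \sum_(l < j.+1) beta l * e (j - l)%N t.

Definition wcoef (f : R -> R) (j : nat) : nat -> R := coefs (fun u => w u ^+ j * f u).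

(** The coefficient of u^k in f(u) times the sum over j of e_j(t) w(u)^j; terms with j > k vanish by
    [wcoef_small]. *)
Definition wexpansion (f : R -> R) (k : nat) (t : R) : R :=
  \sum_(j < k.+1) wcoef f j k * e j t.

Lemma wcoef_small f j k : expandable f -> (k < j)%N -> wcoef f j k = 0.
Proof.
move=> fe kj; have fwe : expandable (fun u => w u ^+ j * f u).
  by apply: expandableM => //; exact: expandableX.
apply: (coefs_small fwe _ kj).
have [C C0 wC] := expandableP we 1.
have [D D0 fD] := expandableP fe 0.
exists (C ^+ j * D); near=> u.
have wu : 0 < w u by near: u.
have : `|w u - \sum_(k < 1) coefs w k * u ^+ k| <= C * u ^+ 1 by near: u.
rewrite big_ord1 w0 mul0r subr0 expr1 => wCu.
have : `|f u - \sum_(k < 0) coefs f k * u ^+ k| <= D * u ^+ 0 by near: u.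
rewrite big_ord0 subr0 mulr1 => hu.
rewrite normrM normrX mulrAC ler_pM ?exprn_ge0// -exprMn.
by apply: lerXn2r; rewrite ?nnegrE// (le_trans _ wCu).
Unshelve. all: by end_near. Qed.

(** Replacing each [e j] by its shifted sum multiplies the generating function by B(w): once B is
    expanded in powers of w, the factors w^l and w^i combine into w^(i + l), and both sides are one
    sum over antidiagonals. *)
Lemma wexpansion_shift f k t : expandable f ->
  \sum_(j < k.+1) wcoef f j k * shifted_sum j t =
  wexpansion (fun u => B (w u) * f u) k t.
Proof.
move=> fe.
have wfe j : expandable (fun u => w u ^+ j * f u).
  by apply: expandableM => //; exact: expandableX.
transitivity (\sum_(j < k.+1) \sum_(l < j.+1) wcoef f (j - l + l)%N k * (beta l * e (j - l)%N t)).
  apply: eq_bigr => j _; rewrite /shifted_sum mulr_sumr; apply: eq_bigr => l _.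
  by rewrite subnK// -ltnS.
rewrite (sum_antidiagonals (fun i l => wcoef f (i + l)%N k * (beta l * e i t))).
rewrite /wexpansion; apply: eq_bigr => i _.
have -> : wcoef (fun u => B (w u) * f u) i =
    coefs (fun u => B (w u) * (w u ^+ i * f u)).
  by apply: eq_coefs; apply: nearW => u; rewrite mulrCA.
rewrite (coefsP (expands_comp Bbeta we w0 wpos (wfe i))).
have wE l : coefs (fun u => w u ^+ l * (w u ^+ i * f u)) = wcoef f (i + l)%N.
  by apply: eq_coefs; apply: nearW => u; rewrite exprD mulrA [_ ^+ l * _]mulrC.
under [in RHS]eq_bigr do rewrite wE.
rewrite mulr_suml (big_ord_widen _ (fun l => wcoef f (i + l) k * (beta l * e i t)) (leq_subr i k.+1)).
rewrite [RHS](bigID (fun l : 'I_k.+1 => (l < k.+1 - i)%N))/= [X in _ = _ + X]big1 ?addr0.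
  by apply: eq_bigr => l _; rewrite mulrCA mulrA.
move=> l; rewrite -leqNgt leq_subLR => kil.
by rewrite wcoef_small ?mulr0 ?mul0r.
Qed.

Lemma expands_wexpansion (E : R -> R) t : expands E (fun j => e j t) ->
  expands (fun u => E (w u)) (fun k => wexpansion (fun=> 1) k t).
Proof.
move=> Ee n.
apply: eq_expands_upto (expands_comp Ee we w0 wpos (expandable_cst 1) n).
  by apply: nearW => u; rewrite mulr1.
by move=> k _; apply: eq_bigr => l _; rewrite mulrC.
Qed.

(** Read [rel f g] as: the fractional derivative of f exists and is g for t > 0, up to the sign used
    in (i). Keeping it abstract serves both operators; [rel_sum] records linearity together with the
    action on the [e j]. *)
Variable rel : (R -> R) -> (R -> R) -> Prop.
Hypothesis rel_sum : forall (N : nat) (a : nat -> R) (f g : R -> R),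
  (forall t : R, 0 < t -> f t = \sum_(j < N) a j * e j t) ->
  (forall t : R, 0 < t -> g t = \sum_(j < N) a j * shifted_sum j t) ->
  rel f g.

Lemma rel_wexpansion f k p : expandable f ->
  (forall t : R, 0 < t -> p t = wexpansion f k t) ->
  rel p (wexpansion (fun u => B (w u) * f u) k).
Proof.
move=> fe pE; apply: (@rel_sum k.+1 (fun j => wcoef f j k)) => // t t0.
by rewrite wexpansion_shift.
Qed.

(** [g1] and [g2] belong to the generating function multiplied by B(w) and by B(w)^2. The quadratic
    identity is multiplied by w^j and compared at u^k for each j separately, before the functions of
    t enter. *)
Lemma second_order_relation (b : R -> R) (bc : nat -> R) (x y : R) (p : nat -> R -> R) :
  (\forall u \near 0^'+, B (w u) ^+ 2 + x * B (w u) = y * b u) ->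
  expands b bc ->
  (forall k (t : R), 0 < t -> p k t = wexpansion (fun=> 1) k t) ->
  forall k, exists g1 g2, [/\ rel (p k) g1, rel g1 g2 &
    forall t : R, 0 < t -> g2 t + x * g1 t = y * \sum_(j < k.+1) bc j * p (k - j)%N t].
Proof.
move=> quad bbc pE k.
have Be : expandable (fun u => B (w u)).
  have := expands_comp Bbeta we w0 wpos (expandable_cst 1).
  move=> h; eexists; apply: eq_expands h; by apply: nearW => u; rewrite mulr1.
have Be1 : expandable (fun u => B (w u) * 1) by apply: expandableM => //; exact: expandable_cst.
have Be2 : expandable (fun u => B (w u) * (B (w u) * 1)) by exact: expandableM.
exists (wexpansion (fun u => B (w u) * 1) k).
exists (wexpansion (fun u => B (w u) * (B (w u) * 1)) k); split.
- by apply: rel_wexpansion => [|t t0]; [exact: expandable_cst|exact: pE].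
- exact: rel_wexpansion.
move=> t t0; rewrite /wexpansion [x * _]mulr_sumr -big_split/=.
have wXe j : expandable (fun u => w u ^+ j) by exact: expandableX.
have wX1e j : expandable (fun u => w u ^+ j * 1).
  by apply: expandableM => //; exact: expandable_cst.
have step j : wcoef (fun u => B (w u) * (B (w u) * 1)) j k +
    x * wcoef (fun u => B (w u) * 1) j k =
    y * \sum_(i < k.+1) bc i * wcoef (fun=> 1) j (k - i)%N.
  have h1 := expandsD (expandableP (expandableM (wXe j) Be2))
    (expandsZ x (expandableP (expandableM (wXe j) Be1))).
  have h2 := expandsZ y (expandsM bbc (expandableP (wX1e j))).
  have h : expands (fun u => y * (b u * (w u ^+ j * 1))) (fun k =>
      wcoef (fun u => B (w u) * (B (w u) * 1)) j k + x * wcoef (fun u => B (w u) * 1) j k).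
    apply: eq_expands h1; near=> u => /=.
    have hu : B (w u) ^+ 2 + x * B (w u) = y * b u by near: u.
    by rewrite [RHS]mulrA -hu; ring.
  exact: (expands_upto_uniq (h k.+1) (h2 k.+1)).
under eq_bigr do rewrite mulrA -mulrDl step -mulrA.
rewrite -mulr_sumr; congr (_ * _).
transitivity (\sum_(j < k.+1) \sum_(i < k.+1) bc i * wcoef (fun=> 1) j (k - i)%N * e j t).
  by apply: eq_bigr => j _; rewrite mulr_suml.
rewrite exchange_big/=; apply: eq_bigr => i _.
rewrite pE// /wexpansion mulr_sumr.
(* The terms with j > k - i vanish, so the sum over j may be extended to the range left by the
   exchange. *)
rewrite (big_ord_widen k.+1 (fun j => bc i * (wcoef (fun=> 1) j (k - i) * e j t))); last first.
  by rewrite ltnS leq_subr.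
rewrite [LHS](bigID (fun j : 'I_k.+1 => (j < (k - i).+1)%N))/= [X in _ + X = _]big1 ?addr0.
  by apply: eq_bigr => j _; rewrite mulrA.
move=> j; rewrite -leqNgt => kij.
by rewrite wcoef_small ?mulr0 ?mul0r//; exact: expandable_cst.
Unshelve. all: by end_near. Qed.

End generator_expansion.

(** * The Laplace exponent of the inverse Gaussian subordinator *)

Section inverse_gaussian_exponent.
Context {R : realType}.
Implicit Types (w : R -> R).

(** The bound by 1 keeps 1 - w positive, so that its real powers can be expanded and the map w -> 1
    - (1 - w)^s stays within the class. *)
Definition infinitesimal w := [/\ expandable w, coefs w 0 = 0 &
  \forall u \near 0^'+, 0 < w u < 1].

Lemma onem_powR_bounds (x s : R) : 0 < s -> 0 < x < 1 -> 0 < 1 - (1 - x) `^ s < 1.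
Proof.
move=> s0 /andP[x0 x1]; have x10 : 0 < 1 - x by rewrite subr_gt0.
rewrite subr_gt0 ltrBlDr ltrDl powR_gt0// andbT.
have e : (1 : R) `^ s = 1 by rewrite powR1.
by rewrite -[ltRHS]e gt0_ltr_powR// ?nnegrE ?ltW// ltrBlDr ltrDl.
Qed.

Lemma infinitesimal_id : infinitesimal id.
Proof.
have e : expands (id : R -> R) (fun k => if k == 1%N then 1 else 0).
  case=> [|[|n]].
  - exists 1 => //; near=> u.
    have u0 : 0 < u by near: u; exact: near0_gt0.
    by rewrite big_ord0 subr0 mulr1 gtr0_norm// ltW//; near: u; exact: near0_lt1.
  - exists 1 => //; near=> u.
    have u0 : 0 < u by near: u; exact: near0_gt0.
    by rewrite big_ord1 mul0r subr0 mul1r gtr0_norm.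
  - exists 0 => //; near=> u.
    rewrite mul0r big_ord_recl big_ord_recl big1/=; last by move=> i _; rewrite mul0r.
    by rewrite mul0r mul1r add0r addr0 subrr normr0.
split; [by eexists; exact: e|by rewrite (coefsP e)|].
by near=> u; apply/andP; split; near: u; [exact: near0_gt0|exact: near0_lt1].
Unshelve. all: by end_near. Qed.

Lemma infinitesimal_onem_powR s w : 0 < s -> infinitesimal w ->
  infinitesimal (fun u => 1 - (1 - w u) `^ s).
Proof.
move=> s0 [we w0 w01].
have wp : \forall u \near 0^'+, 0 < w u.
  by near=> u; have /andP[] : 0 < w u < 1 by near: u.
have h := expands_comp (expands_onem_powR s) we w0 wp (expandable_cst 1).
have h1 := expandsD (expands_cst 1) (expandsZ (-1) h).
move: h1; set a := (X in expands _ X) => h1.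
have {}h1 : expands (fun u => 1 - (1 - w u) `^ s) a.
  by apply: eq_expands h1; apply: nearW => u /=; rewrite mulr1 mulN1r.
split.
- by exists a.
- rewrite (coefsP h1) /a big_ord1 binom_coef0 mul1r.
  rewrite (_ : coefs _ = coefs (fun=> 1 : R)); last first.
    by apply: eq_coefs; apply: nearW => u; rewrite expr0 mulr1.
  by rewrite (coefsP (expands_cst 1)) mulr1 subrr.
- near=> u; apply: onem_powR_bounds => //; near: u; exact: w01.
Unshelve. all: by end_near. Qed.

Lemma infinitesimalZ k w : 0 < k -> (\forall u \near 0^'+, k * w u < 1) ->
  infinitesimal w -> infinitesimal (fun u => k * w u).
Proof.
move=> k0 kw [we w0 w01]; split.
- exact: expandableZ.
- by rewrite (coefsP (expandsZ k (expandableP we))) w0 mulr0.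
- near=> u; have /andP[wu0 _] : 0 < w u < 1 by near: u.
  by rewrite mulr_gt0//=; near: u.
Unshelve. all: by end_near. Qed.

Variables (eta m beta rho : R).
Hypotheses (eta0 : 0 < eta) (m0 : 0 < m) (beta0 : 0 < beta) (rho0 : 0 < rho).

(** For m = mu / beta, the Laplace exponent of [S]. *)
Definition ig_exponent (theta : R) : R := m * (Num.sqrt (1 + 2 * beta * theta) - 1).

(** The solution w of psi = c (1 - w)^(1 / rho), with c = [ig_exponent 1] the value of psi at u =
    0. *)
Definition ig_infinitesimal (u : R) : R :=
  1 - (ig_exponent ((1 - u) `^ eta) / ig_exponent 1) `^ rho.

Lemma ig_exponent_gt0 theta : 0 < theta -> 0 < ig_exponent theta.
Proof.
move=> t0; rewrite /ig_exponent mulr_gt0// subr_gt0.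
rewrite -[ltLHS]sqrtr1 ltr_sqrt; first by rewrite ltrDl !mulr_gt0.
by rewrite ltr_wpDr// !mulr_ge0// ltW.
Qed.

(** Completing the square: (psi + m)^2 = m^2 (1 + 2 beta theta). For m = mu / beta the factor 2 m^2
    beta is 2 mu^2 / beta. *)
Lemma ig_exponent_quadratic theta : 0 <= theta ->
  ig_exponent theta ^+ 2 + 2 * m * ig_exponent theta = 2 * m ^+ 2 * beta * theta.
Proof.
move=> t0; have h : Num.sqrt (1 + 2 * beta * theta) ^+ 2 = 1 + 2 * beta * theta.
  by rewrite sqr_sqrtr// addr_ge0// !mulr_ge0// ltW.
rewrite /ig_exponent; move: h; set q := Num.sqrt _ => h.
have -> : 2 * m ^+ 2 * beta * theta = m ^+ 2 * (1 + 2 * beta * theta - 1) by ring.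
by rewrite -h; ring.
Qed.

Lemma ig_infinitesimalK u : u < 1 ->
  ig_exponent 1 * (1 - ig_infinitesimal u) `^ rho^-1 = ig_exponent ((1 - u) `^ eta).
Proof.
move=> u1; have p0 := ig_exponent_gt0 (powR_gt0 eta (_ : 0 < 1 - u)).
have {}p0 : 0 < ig_exponent ((1 - u) `^ eta) by apply: p0; rewrite subr_gt0.
have c0 := ig_exponent_gt0 ltr01.
rewrite /ig_infinitesimal subKr -powRrM mulfV ?gt_eqF// powRr1 ?divr_ge0 ?ltW//.
by rewrite mulrC divfK ?gt_eqF.
Qed.

(** The function is assembled from maps v -> 1 - (1 - v)^s, with exponents eta, 1 / 2 and rho in
    turn, and from two scalings in between. *)
Lemma infinitesimal_ig : infinitesimal ig_infinitesimal.
Proof.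
have c0 := ig_exponent_gt0 ltr01.
have h1 := infinitesimal_onem_powR eta0 infinitesimal_id.
(* From 1 + 2 beta (1 - v) = (1 + 2 beta) (1 - k v), where v = 1 - (1 - u)^eta. *)
pose k := 2 * beta / (1 + 2 * beta).
have b0 : 0 < 1 + 2 * beta by rewrite ltr_wpDr// !mulr_ge0// ltW.
have k0 : 0 < k by rewrite divr_gt0// mulr_gt0.
have k1 : k < 1 by rewrite ltr_pdivrMr// mul1r ltrDr.
have h2 : infinitesimal (fun u => k * (1 - (1 - u) `^ eta)).
  apply: infinitesimalZ => //; case: h1 => _ _ h; near=> u.
  have /andP[a1 a2] : 0 < 1 - (1 - u) `^ eta < 1 by near: u.
  by rewrite mulr_ilt1// ltW.
have half0 : 0 < 2^-1 :> R by rewrite invr_gt0.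
have h3 := infinitesimal_onem_powR half0 h2.
pose s := Num.sqrt (1 + 2 * beta).
have s1 : 1 < s by rewrite -[ltLHS]sqrtr1 ltr_sqrt// ltrDl mulr_gt0.
pose y u := s / (s - 1) * (1 - (1 - k * (1 - (1 - u) `^ eta)) `^ 2^-1).
have yE u : u < 1 -> 1 - y u = ig_exponent ((1 - u) `^ eta) / ig_exponent 1.
  move=> u1; have q0 : 0 < (1 - u) `^ eta by rewrite powR_gt0// subr_gt0.
  have e : 1 - k * (1 - (1 - u) `^ eta) =
      (1 + 2 * beta * (1 - u) `^ eta) / (1 + 2 * beta).
    by rewrite /k; field; rewrite gt_eqF.
  rewrite /y e powR12_sqrt; last first.
    by rewrite divr_ge0 ?ltW// ltr_wpDr// !mulr_ge0// ltW.
  rewrite sqrtrM ?sqrtrV ?ltW//; last by rewrite ltr_wpDr// !mulr_ge0// ltW.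
  rewrite /ig_exponent mulr1 -/s; field.
  by rewrite (gt_eqF m0) !gt_eqF// ?subr_gt0// (lt_trans ltr01).
have h4 : infinitesimal y.
  apply: infinitesimalZ => //; first by rewrite divr_gt0 ?subr_gt0// (lt_trans ltr01).
  (* The factor s / (s - 1) exceeds 1, so y < 1 does not follow from the bound on the function being
     scaled; it comes from psi > 0 through 1 - y = psi / c. *)
  near=> u; have u1 : u < 1 by near: u; exact: near0_lt1.
  rewrite -subr_gt0 -/(y u) yE// divr_gt0//.
  by apply: ig_exponent_gt0; rewrite powR_gt0// subr_gt0.
have [a1 a2 a3] := infinitesimal_onem_powR rho0 h4.
have E : {near 0^'+, (fun u => 1 - (1 - y u) `^ rho) =1 ig_infinitesimal}.
  near=> u; have u1 : u < 1 by near: u; exact: near0_lt1.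
  by rewrite yE.
split.
- by have [a ha] := a1; exists a; apply: eq_expands E ha.
- by rewrite -(eq_coefs E).
- near=> u; have <- : 1 - (1 - y u) `^ rho = ig_infinitesimal u by near: u; exact: E.
  by near: u.
Unshelve. all: by end_near. Qed.

End inverse_gaussian_exponent.

(** * Independent time changes *)

Section upper_grid.
Context {R : realType}.

(** The least multiple of 1 / (n + 1) strictly above [x]. Right-continuity of paths concerns times
    strictly to the right, and the grid makes a random time countably valued. *)
Definition upper_grid (n : nat) (x : R) : R := (Num.truncn (n.+1%:R * x)).+1%:R / n.+1%:R.

Lemma upper_grid_gt n x : 0 <= x -> x < upper_grid n x.
Proof.
move=> x0; rewrite ltr_pdivlMr ?ltr0n// mulrC.
by have /andP[] := truncn_itv (mulr_ge0 (ler0n R n.+1) x0).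
Qed.

Lemma upper_grid_le n x : 0 <= x -> upper_grid n x <= x + n.+1%:R^-1.
Proof.
move=> x0; rewrite ler_pdivrMr ?ltr0n// mulrDl mulVf ?pnatr_eq0//.
rewrite -natr1 lerD2r [leRHS]mulrC.
by have /andP[] := truncn_itv (mulr_ge0 (ler0n R n.+1) x0).
Qed.

Lemma cvg_upper_grid x : 0 <= x -> upper_grid n x @[n --> \oo] --> x.
Proof.
move=> x0; apply: (@squeeze_cvgr _ _ _ _ (cst x) (fun n => x + n.+1%:R^-1)).
- by apply: nearW => n; rewrite /= ltW ?upper_grid_gt//= upper_grid_le.
- exact: cvg_cst.
- rewrite -[X in _ --> X]addr0; apply: cvgD; first exact: cvg_cst.
  exact: cvg_harmonic.
Qed.

Lemma cvg_right_upper_grid (f : R -> R) x : 0 <= x ->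
  f y @[y --> x^'+] --> f x -> f (upper_grid n x) @[n --> \oo] --> f x.
Proof.
move=> x0 /cvg_at_rightP; apply; split=> [n|]; first exact: upper_grid_gt.
exact: cvg_upper_grid.
Qed.

End upper_grid.

Section time_change.
Context {R : realType} {d : measure_display} {T : measurableType d}.
Variable P : probability T R.
Variables (X : R -> T -> R) (tau : T -> R).
Hypothesis mX : forall t : R, 0 <= t -> measurable_fun setT (X t).
Hypothesis rcX : forall w (t : R), 0 <= t -> X ^~ w @ t^'+ --> X t w.
Hypothesis mtau : measurable_fun setT tau.
Hypothesis tau0 : forall w, 0 <= tau w.

Definition grid_cell (n i : nat) : set R :=
  `[i%:R / n.+1%:R, i.+1%:R / n.+1%:R[.

Let cell n i : set T := tau @^-1` grid_cell n i.

Let mcell n i : measurable (cell n i).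
Proof. by rewrite /cell -[_ @^-1` _]setTI; apply: mtau => //; exact: measurable_itv. Qed.

Let cellP n i w : cell n i w <-> Num.truncn (n.+1%:R * tau w) = i.
Proof.
have h := mulr_ge0 (ler0n R n.+1) (tau0 w).
rewrite /cell/grid_cell/= in_itv/= ler_pdivrMr ?ltr0n// ltr_pdivlMr ?ltr0n//.
rewrite ![_ * n.+1%:R]mulrC; split=> [h2|<-]; first exact/truncn_def.
exact: truncn_itv.
Qed.

Let cell_upper_grid n i w : cell n i w -> upper_grid n (tau w) = i.+1%:R / n.+1%:R.
Proof. by move=> /cellP; rewrite /upper_grid => ->. Qed.

Let bigcup_cell n : \bigcup_i cell n i = setT.
Proof.
by rewrite -subTset => w _; exists (Num.truncn (n.+1%:R * tau w)) => //; apply/cellP.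
Qed.

Let triv_cell n : trivIset setT (cell n).
Proof.
apply/trivIsetP => i j _ _ /eqP ij; rewrite -subset0 => w [/cellP h1 /cellP h2].
by apply: ij; rewrite -h1 -h2.
Qed.

Let grid_point_ge0 n i : (0 : R) <= i.+1%:R / n.+1%:R.
Proof. by rewrite divr_ge0. Qed.

Let measurable_grid n : measurable_fun setT (fun w => X (upper_grid n (tau w)) w).
Proof.
move=> _ B mB; rewrite setTI.
rewrite [X in measurable X](_ : _ =
    \bigcup_i (cell n i `&` (X (i.+1%:R / n.+1%:R) @^-1` B))).
  apply: bigcup_measurable => i _; apply: measurableI => //.
  by rewrite -[_ @^-1` _]setTI; apply: mX.
apply/seteqP; split=> w /= => [Bw|[i _ [cw]]]; last by rewrite (cell_upper_grid cw).
exists (Num.truncn (n.+1%:R * tau w)) => //; split => //; exact/cellP.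
Qed.

Lemma cvg_time_grid w : X (upper_grid n (tau w)) w @[n --> \oo] --> X (tau w) w.
Proof. by apply: (@cvg_right_upper_grid _ (X ^~ w)) => //; exact: rcX. Qed.

Lemma measurable_time_change : measurable_fun setT (fun w => X (tau w) w).
Proof.
apply: (@measurable_fun_cvg _ _ _ _
  (fun n w => X (upper_grid n (tau w)) w)) => // w _.
exact: cvg_time_grid.
Qed.

(** A substitute for conditioning on [tau]. The last hypothesis gives the mean of g(X_t) on every
    event where [tau] lies in [I]. On a cell of the grid the rounded time is constant, so summing
    over cells proves the formula for rounded times; dominated convergence, with bound 1, removes
    the rounding. The event [C] lets the lemma be used inside another conditioning. *)
Lemma integral_time_change (C : set T) (g G : R -> R) : measurable C ->
  continuous g -> (forall x, 0 <= g x <= 1) ->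
  continuous G -> (forall t : R, 0 <= t -> 0 <= G t <= 1) ->
  (forall (t : R) (I : set R), 0 <= t -> measurable I ->
    (\int[P]_(w in tau @^-1` I `&` C) (g (X t w))%:E =
     (G t)%:E * P (tau @^-1` I `&` C))%E) ->
  (\int[P]_(w in C) (g (X (tau w) w))%:E = \int[P]_(w in C) (G (tau w))%:E)%E.
Proof.
move=> mC cg g01 cG G01 H.
have mg : measurable_fun setT g by exact: continuous_measurable_fun.
have mG : measurable_fun setT G by exact: continuous_measurable_fun.
have mgrid n : measurable_fun setT (fun w => upper_grid n (tau w)).
  move=> _ B mB; rewrite setTI.
  rewrite [X in measurable X](_ : _ =
    \bigcup_i (cell n i `&` [set w | B (i.+1%:R / n.+1%:R)])).
    apply: bigcup_measurable => i _; apply: measurableI => //.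
    have [Bi|Bi] := pselect (B (i.+1%:R / n.+1%:R)).
      rewrite (_ : [set _ | _] = setT)//; by apply/seteqP; split.
    rewrite (_ : [set _ | _] = set0)//; by apply/seteqP; split.
  apply/seteqP; split=> w /= => [Bw|[i _ [cw]]]; last by rewrite (cell_upper_grid cw).
  exists (Num.truncn (n.+1%:R * tau w)) => //; split => //; exact/cellP.
have split_cells (f : T -> R) n : measurable_fun setT f -> (forall w, 0 <= f w) ->
    (\int[P]_(w in C) (f w)%:E =
     \sum_(i <oo) \int[P]_(w in cell n i `&` C) (f w)%:E)%E.
  move=> mf f0.
  have DE : C = \bigcup_i (cell n i `&` C) by rewrite -setI_bigcupl bigcup_cell setTI.
  rewrite [in LHS]DE ge0_integral_bigcup//.
  - by move=> i; apply: measurableI.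
  - by apply/measurable_EFinP; exact: measurable_funTS.
  - by move=> w _; rewrite lee_fin.
  - apply/trivIsetP => i j _ _ ij; rewrite setIACA setIid.
    by have /trivIsetP tc := @triv_cell n; rewrite tc// set0I.
have gd n w : 0 <= upper_grid n (tau w).
  by rewrite ltW// (le_lt_trans (tau0 w))// upper_grid_gt.
have gX n : (\int[P]_(w in C) (g (X (upper_grid n (tau w)) w))%:E =
    \int[P]_(w in C) (G (upper_grid n (tau w)))%:E)%E.
  rewrite (split_cells _ n); last 2 first.
  - exact: measurableT_comp.
  - by move=> w; have /andP[] := g01 (X (upper_grid n (tau w)) w).
  rewrite (split_cells _ n); last 2 first.
  - exact: measurableT_comp.
  - by move=> w; have /andP[] := G01 _ (gd n w).
  apply: eq_eseriesr => i _.
  transitivity (\int[P]_(w in cell n i `&` C) (g (X (i.+1%:R / n.+1%:R) w))%:E)%E.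
    by apply: eq_integral => w; rewrite inE => -[cw _]; rewrite (cell_upper_grid cw).
  rewrite H//; last exact: measurable_itv.
  transitivity (\int[P]_(w in cell n i `&` C) (G (i.+1%:R / n.+1%:R))%:E)%E.
    by rewrite integral_cst//; exact: measurableI.
  by apply: eq_integral => w; rewrite inE => -[cw _]; rewrite (cell_upper_grid cw).
have lim (F : nat -> T -> R) (f : T -> R) :
    (forall n, measurable_fun setT (F n)) ->
    (forall n w, 0 <= F n w <= 1) -> (forall w, F n w @[n --> \oo] --> f w) ->
    (\int[P]_(w in C) (F n w)%:E @[n --> \oo] --> \int[P]_(w in C) (f w)%:E)%E.
  move=> mF F01 Ff.
  have mf : measurable_fun setT f.
    by apply: (@measurable_fun_cvg _ _ _ _ F) => // w _; exact: Ff.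
  have [] // := @dominated_convergence _ _ _ P C mC (fun n w => (F n w)%:E)
    (fun w => (f w)%:E) (cst 1%E).
  - by move=> n; apply/measurable_EFinP; exact: measurable_funTS.
  - by apply/measurable_EFinP; exact: measurable_funTS.
  - by apply: aeW => w _; apply: cvg_EFin; [exact: nearW|exact: Ff].
  - exact: finite_measure_integrable_cst.
  - apply: aeW => w n _; rewrite /= lee_fin.
    by have /andP[F0 F1] := F01 n w; rewrite ger0_norm.
have l1 : (\int[P]_(w in C) (g (X (upper_grid n (tau w)) w))%:E @[n --> \oo] -->
    \int[P]_(w in C) (g (X (tau w) w))%:E)%E.
  apply: lim => [n||w] //; first exact: measurableT_comp.
  by apply: continuous_cvg; [exact: cg|exact: cvg_time_grid].
have l2 : (\int[P]_(w in C) (G (upper_grid n (tau w)))%:E @[n --> \oo] -->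
    \int[P]_(w in C) (G (tau w))%:E)%E.
  apply: lim => [n|n w|w].
  - exact: measurableT_comp.
  - exact: G01.
  - by apply: continuous_cvg; [exact: cG|exact: cvg_upper_grid].
move: l1; under eq_fun do rewrite gX; move=> l1.
exact: (cvg_unique _ l1 l2).
Qed.

End time_change.

(** * Integrals under independence and against densities *)

Section integrals.
Context {R : realType} {d : measure_display} {T : measurableType d}.

Lemma integral_mrestr (mu : {measure set T -> \bar R}) (E : set T) (mE : measurable E)
    (f : T -> \bar R) : measurable_fun setT f -> (forall x, 0 <= f x)%E ->
  (\int[mrestr mu mE]_x f x = \int[mu]_(x in E) f x)%E.
Proof.
move=> mf f0; rewrite -(setUv E) ge0_integral_setU//.
- rewrite [X in (_ + X)%E](_ : _ = 0%E) ?adde0.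
    apply: eq_measure_integral => A mA AE.
    by rewrite /= /mrestr setIidl.
  rewrite (@eq_measure_integral _ _ _ _ mzero) ?integral_measure_zero// => A mA AE.
  by rewrite /= /mrestr /mzero (disjoints_subset A E).2// measure0.
- exact: measurableC.
- by rewrite setUv.
- by apply/disj_setPS; rewrite setICr.
Qed.

(** Independence says that the law of [Y] under P restricted to [E] is P(E) times its law under
    P. *)
Lemma integral_indep (P : probability T R) (Y : T -> R) (E : set T) (g : R -> R) :
  measurable_fun setT Y -> measurable E ->
  (forall B, measurable B -> P (Y @^-1` B `&` E) = P (Y @^-1` B) * P E)%E ->
  measurable_fun setT g -> (forall x, 0 <= g x) ->
  (\int[P]_(w in E) (g (Y w))%:E = P E * \int[P]_w (g (Y w))%:E)%E.
Proof.
move=> mY mE ind mg g0.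
have mgE : measurable_fun setT (EFin \o g) by exact/measurable_EFinP.
rewrite -(integral_mrestr P mE); last 2 first.
- by apply/measurable_EFinP; exact: measurableT_comp.
- by move=> w; rewrite lee_fin.
rewrite -[in LHS](preimage_setT Y).
rewrite -(@ge0_integral_pushforward _ _ _ _ _ _ mY _ setT (EFin \o g))//; last first.
  by move=> y _; rewrite lee_fin.
have pE : (fine (P E))%:E = P E by rewrite fineK// fin_num_measure.
rewrite (eq_measure_integral (mscale (NngNum (fine_ge0 (measure_ge0 P E)))
    (pushforward P Y))); last first.
  by move=> A mA _; rewrite /= /mscale/= /pushforward pE /mrestr ind// muleC.
rewrite ge0_integral_mscale//; last by move=> x _; rewrite lee_fin.
rewrite /= pE; congr (_ * _)%E.
rewrite ge0_integral_pushforward// ?preimage_setT// => y _.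
by rewrite lee_fin.
Qed.

Import HBNNSimple.

(** The hypothesis on [nu] is the case of indicators; simple functions and monotone convergence
    extend it. *)
Lemma ge0_integral_density (nu mu : {measure set T -> \bar R}) (f h : T -> R) :
  measurable_fun setT f -> (forall x, 0 <= f x) ->
  (forall B, measurable B -> nu B = \int[mu]_(x in B) (f x)%:E)%E ->
  measurable_fun setT h -> (forall x, 0 <= h x) ->
  (\int[nu]_x (h x)%:E = \int[mu]_x (h x * f x)%:E)%E.
Proof.
move=> mf f0 nuE mh h0.
have mhE : measurable_fun setT (EFin \o h) by exact/measurable_EFinP.
pose h_ := nnsfun_approx measurableT mhE.
have hcvg x : (h_ n x)%:E @[n --> \oo] --> (h x)%:E.
  by apply: (cvg_nnsfun_approx measurableT mhE) => //= y _; rewrite lee_fin.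
transitivity (limn (fun n => \int[nu]_x (h_ n x)%:E))%E.
  rewrite -monotone_convergence//=.
  - by apply: eq_integral => x _; apply/esym/cvg_lim => //; exact: hcvg.
  - by move=> n; exact/measurable_EFinP.
  - by move=> n x _; rewrite lee_fin.
  - by move=> x _ a b ab; rewrite lee_fin; exact/lefP/nd_nnsfun_approx.
transitivity (limn (fun n => \int[mu]_x (h_ n x * f x)%:E))%E; last first.
  rewrite -monotone_convergence//=.
  - apply: eq_integral => x _; apply/cvg_lim => //; under eq_fun do rewrite EFinM.
    by rewrite EFinM; apply: cvgeMr => //; exact: hcvg.
  - by move=> n; apply/measurable_EFinP; exact: measurable_funM.
  - by move=> n x _; rewrite lee_fin mulr_ge0.
  - move=> x _ a b ab; rewrite lee_fin ler_wpM2r//; exact/lefP/nd_nnsfun_approx.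
apply: congr_lim; apply/funext => n.
transitivity (\sum_(r \in range (h_ n)) \int[nu]_x (r * \1_(h_ n @^-1` [set r]) x)%:E)%E.
  rewrite -ge0_integral_fsum//.
  - by apply: eq_integral => x _; rewrite fsumEFin// -fimfunE.
  - by move=> r; exact/measurable_EFinP/measurable_funM.
  - by move=> r x _; rewrite nnfun_muleindic_ge0.
transitivity (\sum_(r \in range (h_ n)) \int[mu]_x (r * \1_(h_ n @^-1` [set r]) x * f x)%:E)%E; last first.
  rewrite -ge0_integral_fsum//.
  - apply: eq_integral => x _.
    rewrite fsumEFin//; congr EFin.
    by rewrite fsbig_finite//= -mulr_suml -fsbig_finite//= -fimfunE.
  - by move=> r; apply/measurable_EFinP; apply: measurable_funM => //; exact: measurable_funM.
  - by move=> r x _; rewrite !EFinM mule_ge0 ?nnfun_muleindic_ge0// lee_fin.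
apply: eq_fsbigr => r; rewrite inE => -[x _ hx].
have r0 : 0 <= r by rewrite -hx.
have mpr : measurable (h_ n @^-1` [set r]) by [].
under eq_integral do rewrite EFinM.
rewrite ge0_integralZl//; last by apply/measurable_EFinP.
rewrite integral_indic// setIT nuE//.
under [RHS]eq_integral do rewrite -mulrA EFinM.
rewrite ge0_integralZl//; last 2 first.
- by apply/measurable_EFinP; exact: measurable_funM.
- by move=> y _; rewrite lee_fin mulr_ge0.
congr (_ * _)%E; rewrite integral_mkcond.
apply: eq_integral => y _; rewrite patchE indicE.
by case: (y \in _); rewrite ?mul1r ?mul0r.
Qed.

End integrals.

(** * Generating functions *)

Section geometric_weight.
Context {R : realType}.

(* A bounded continuous function on the line with value [u ^+ n] at [n]. *)
Definition geom_weight (u x : R) : R := expR (ln u * `|x|).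

Lemma geom_weight_nat u n : 0 < u -> geom_weight u n%:R = u ^+ n.
Proof.
by move=> u0; rewrite /geom_weight ger0_norm// mulrC expRM_natl lnK.
Qed.

Lemma geom_weight01 u x : 0 < u < 1 -> 0 <= geom_weight u x <= 1.
Proof.
move=> /andP[u0 u1]; rewrite expR_ge0 -[leRHS]expR0 ler_expR.
by rewrite mulr_le0_ge0// ln_le0// ltW.
Qed.

Lemma continuous_geom_weight u : continuous (geom_weight u).
Proof.
move=> x; apply: (@continuous_comp _ _ _ (fun y => ln u * `|y|) expR).
  by apply: cvgM; [exact: cvg_cst|exact: norm_continuous].
exact: continuous_expR.
Qed.

Lemma measurable_geom_weight u : measurable_fun setT (geom_weight u).
Proof. by apply: continuous_measurable_fun; exact: continuous_geom_weight. Qed.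

Lemma eseries_expR (x : R) : 0 <= x ->
  (\sum_(k <oo) (x ^+ k / k`!%:R)%:E = (expR x)%:E)%E.
Proof.
move=> x0; rewrite /expR -EFin_lim; last exact: is_cvg_series_exp_coeff.
apply/congr_lim/funext => n /=; rewrite /series/= -sumEFin//.
Qed.

(** Two natural numbers within 1 / 2 of the limit are equal, so the sequence is eventually
    constant. *)
Lemma cvg_natr (x : nat -> R) (l : R) : (forall n, exists k : nat, x n = k%:R) ->
  x n @[n --> \oo] --> l -> exists k : nat, l = k%:R.
Proof.
move=> xk xl.
have /cvgrPdist_lt /(_ (2^-1)) := xl.
rewrite invr_gt0 ltr0n => /(_ isT) [N _ Nx].
have [k kN] := xk N; exists k.
have xE n : (N <= n)%N -> x n = k%:R.
  move=> Nn; have [m mE] := xk n.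
  have h1 := Nx _ (leqnn N); have h2 := Nx _ Nn.
  have : `|x N - x n| < 1.
    have -> : x N - x n = (l - x n) - (l - x N) by ring.
    rewrite (le_lt_trans (ler_normB _ _))// [ltRHS](splitr 1) mul1r.
    by rewrite ltrD.
  rewrite kN mE ltr_norml => /andP[a b].
  have km : (k < m.+1)%N by rewrite -(ltr_nat R) -natr1; lra.
  have mk : (m < k.+1)%N by rewrite -(ltr_nat R) -natr1; lra.
  by congr (_%:R); apply/eqP; rewrite eqn_leq -ltnS mk -ltnS km.
have : x n @[n --> \oo] --> (k%:R : R).
  apply: cvg_near_cst; exists N => //= n Nn; exact/eqP/xE.
by move=> /(cvg_unique _ xl); apply; exact: Rhausdorff.
Qed.

End geometric_weight.

(** * Generating function and integrality of the Poisson process *)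

Section poisson_process.
Context {R : realType} {d : measure_display} {T : measurableType d}.
Variables (P : probability T R) (N : R -> T -> R).
Hypothesis hN : poisson_process P 1 N.

Let nat_at (t : R) := \bigcup_k (N t @^-1` [set k%:R]).

Let mN (t : R) : 0 <= t -> measurable_fun setT (N t).
Proof. by case: hN => -[mX _ _ _ _ _] _; exact: mX. Qed.

Let mNk (t : R) (k : nat) : 0 <= t -> measurable (N t @^-1` [set k%:R]).
Proof. by move=> t0; rewrite -[_ @^-1` _]setTI; apply: mN. Qed.

Let trivN (t : R) : trivIset setT (fun k : nat => N t @^-1` [set k%:R]).
Proof.
apply/trivIsetP => i j _ _ /eqP ij; rewrite -subset0 => w [/= -> /eqP].
by rewrite eqr_nat => /eqP.
Qed.

Let poisson_pmfE (t : R) k : 0 < t ->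
  poisson_pmf (1 * t) k = expR (- t) * (t ^+ k / k`!%:R).
Proof. by move=> t0; rewrite /poisson_pmf mul1r t0 mulrC. Qed.

Let PN (t : R) k : 0 < t ->
  P (N t @^-1` [set k%:R]) = (expR (- t) * (t ^+ k / k`!%:R))%:E.
Proof. by move=> t0; rewrite -poisson_pmfE//; case: hN => _; exact. Qed.

(** The definition of the process prescribes the probabilities of the natural values; they add up to
    1, so all other values are negligible. *)
Lemma poisson_process_nat (t : R) : 0 <= t -> P (nat_at t) = 1%E.
Proof.
rewrite le_eqVlt => /predU1P[<-|t0].
  rewrite (_ : nat_at 0 = setT) ?probability_setT//.
  by apply/seteqP; split=> // w _; exists 0%N => //=; case: hN => -[_ -> _ _ _ _] _.
rewrite /nat_at measure_bigcup//; last by move=> k _; apply: mNk; exact: ltW.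
rewrite (@eq_eseriesl _ _ xpredT); last by move=> k; rewrite in_setT.
rewrite (eq_eseriesr (g := fun k => ((expR (- t))%:E * (t ^+ k / k`!%:R)%:E)%E)); last first.
  by move=> k _; apply: etrans (PN k t0) _; rewrite EFinM.
rewrite nneseriesZl; last by move=> k _; rewrite lee_fin divr_ge0// exprn_ge0// ltW.
by rewrite eseries_expR ?ltW// -EFinM -expRD addNr expR0.
Qed.

Lemma measurable_poisson_nat (t : R) : 0 <= t -> measurable (nat_at t).
Proof. by move=> t0; apply: bigcup_measurable => k _; exact: mNk. Qed.

Lemma poisson_process_gf (u t : R) : 0 < u < 1 -> 0 <= t ->
  (\int[P]_w (geom_weight u (N t w))%:E = (expR (- ((1 - u) * t)))%:E)%E.
Proof.
move=> u01 t0; have /andP[u0 u1] := u01.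
have mg : measurable_fun setT (fun w => (geom_weight u (N t w))%:E).
  apply/measurable_EFinP; apply: measurableT_comp; last exact: mN.
  exact: measurable_geom_weight.
move: t0; rewrite le_eqVlt => /predU1P[<-|t0].
  rewrite mulr0 oppr0 expR0.
  transitivity (\int[P]_w 1%E)%E; last by rewrite integral_cst// mul1e; exact: probability_setT.
  apply: eq_integral => w _; case: hN => -[_ -> _ _ _ _] _.
  by rewrite (geom_weight_nat 0 u0).
have t0' := ltW t0.
have e : (\int[P]_w (geom_weight u (N t w))%:E =
    \int[P]_(w in nat_at t) (geom_weight u (N t w))%:E)%E.
  have mA := measurable_poisson_nat t0'.
  rewrite -(setUv (nat_at t)) ge0_integral_setU//=; last 4 first.
  - exact: measurableC.
  - by rewrite setUv.
  - by move=> w _; rewrite lee_fin; have /andP[] := geom_weight01 (N t w) u01.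
  - by apply/disj_setPS; rewrite setICr.
  rewrite [X in (_ + X)%E](_ : _ = 0%E) ?adde0//.
  apply: null_set_integral.
  - exact: measurableC.
  - exact: measurable_funTS.
  apply: etrans (probability_setC P mA) _.
  by rewrite poisson_process_nat// subee.
rewrite e ge0_integral_bigcup; last 4 first.
- by move=> k; exact: mNk.
- exact: measurable_funTS.
- by move=> w _; rewrite lee_fin; have /andP[] := geom_weight01 (N t w) u01.
- exact: trivN.
rewrite (eq_eseriesr (g := fun k => ((expR (- t))%:E * ((u * t) ^+ k / k`!%:R)%:E)%E)); last first.
  move=> k _; transitivity (\int[P]_(w in N t @^-1` [set k%:R]) (u ^+ k)%:E)%E.
    by apply: eq_integral => w; rewrite inE/= => ->; rewrite geom_weight_nat.
  rewrite integral_cst; last exact: mNk.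
  rewrite [X in (_ * X)%E](PN k t0) -!EFinM; congr EFin.
  by rewrite exprMn; ring.
rewrite nneseriesZl; last by move=> k _; rewrite lee_fin divr_ge0// exprn_ge0// mulr_ge0// ltW.
rewrite eseries_expR ?mulr_ge0 ?ltW// -EFinM -expRD; congr (expR _)%:E; ring.
Qed.

(** One null set has to serve all times, since the process will be read at random times. The grid
    times are countably many; at an arbitrary time the value is a limit from the right of values at
    grid times, hence natural. *)
Lemma poisson_paths_nat : exists Z, [/\ measurable Z, P Z = 0%E &
  forall w, ~ Z w -> forall t : R, 0 <= t -> exists k : nat, N t w = k%:R].
Proof.
have p0 n i : (0 : R) <= i.+1%:R / n.+1%:R by rewrite divr_ge0.
pose Z := \bigcup_n \bigcup_i ~` nat_at (i.+1%:R / n.+1%:R).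
have mA n i : measurable (~` nat_at (i.+1%:R / n.+1%:R)).
  by apply: measurableC; exact: measurable_poisson_nat.
have PA n i : P (~` nat_at (i.+1%:R / n.+1%:R)) = 0%E.
  by rewrite probability_setC ?poisson_process_nat ?subee//; exact: measurable_poisson_nat.
have mAn n : measurable (\bigcup_i ~` nat_at (i.+1%:R / n.+1%:R)).
  exact: bigcup_measurable.
exists Z; split.
- exact: bigcup_measurable.
- apply/negligibleP; first exact: bigcup_measurable.
  apply: negligible_bigcup => n; apply: negligible_bigcup => i.
  by apply/negligibleP => //; exact: PA.
- move=> w Zw t t0; apply: (@cvg_natr _ (fun n => N (upper_grid n t) w)).
    move=> n; apply: contrapT => h; apply: Zw; exists n => //.
    by exists (Num.truncn (n.+1%:R * t)) => // -[k _ /= hk]; apply: h; exists k.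
  apply: (@cvg_right_upper_grid _ (N ^~ w)) => //.
  by case: hN => -[_ _ _ _ rcX _] _; exact: rcX.
Qed.

End poisson_process.

(** * Affine changes of variable in Lebesgue integrals *)

Section affine_change_of_variable.
Context {R : realType}.
Local Notation mu := (@lebesgue_measure R).

Lemma measurable_affine (s a : R) : measurable_fun setT (fun x : R => s * x + a).
Proof. by apply: measurable_funD => //; exact: measurable_funM. Qed.

Lemma lebesgue_measure_affine (s a : R) (A : set R) : 0 < s -> measurable A ->
  (mu A = s%:E * pushforward mu (fun x : R => (s * x + a)%R : measurableTypeR R) A)%E.
Proof.
move=> s0 mA.
have mf : measurable_fun setT (fun x : R => s * x + a : measurableTypeR R) := measurable_affine s a.
have := @lebesgue_measure_unique R
  (mscale (NngNum (ltW s0)) (pushforward mu (fun x : R => s * x + a : measurableTypeR R))).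
apply => //= _ [[b c] /= bc <-].
rewrite /mscale/= /pushforward.
rewrite (_ : _ @^-1` _ = `](b - a) / s, (c - a) / s]%classic); last first.
  apply/seteqP; split=> x /=; rewrite !in_itv/= ltr_pdivrMr// ler_pdivlMr//.
    by rewrite ltrBlDr lerBrDr mulrC.
  by rewrite ltrBlDr lerBrDr mulrC.
rewrite !lebesgue_measure_itv/= !lte_fin ltr_pM2r ?invr_gt0// ltrD2r.
case: ifPn => _; last by rewrite mule0.
by rewrite -EFinB -EFinM; congr EFin; field; rewrite gt_eqF.
Qed.

Lemma ge0_integral_affine (s a : R) (f : R -> \bar R) (D : set R) : 0 < s ->
  measurable D -> measurable_fun D f -> (forall x, D x -> 0 <= f x)%E ->
  (\int[mu]_(x in D) f x =
   s%:E * \int[mu]_(x in [set x | D (s * x + a)%R]) f (s * x + a)%R)%E.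
Proof.
move=> s0 mD mf f0.
have mphi : measurable_fun setT (fun x : R => s * x + a : measurableTypeR R) := measurable_affine s a.
have := @ge0_integral_pushforward _ _ (measurableTypeR R) (measurableTypeR R) R
  (fun x : R => s * x + a) mphi mu D f mD mf.
rewrite /comp/= => <-; last by move=> y /[!inE]; exact: f0.
have := @ge0_integral_mscale _ _ _ (pushforward mu (fun x : R => s * x + a : measurableTypeR R)) D mD (NngNum (ltW s0)) f mf f0.
move=> /= <-.
apply: eq_measure_integral => A mA _.
exact: lebesgue_measure_affine.
Qed.

End affine_change_of_variable.

(** * Laplace transform of the inverse Gaussian law *)

Section inverse_gaussian_laplace.
Context {R : realType}.
Local Notation leb := (@lebesgue_measure R).
Variables (mu beta : R).
Hypotheses (mu0 : 0 < mu) (beta0 : 0 < beta).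
Local Notation f := (inverse_gaussian_density mu beta).

Lemma inverse_gaussian_density_ge0 (t x : R) : 0 <= t -> 0 <= f t x.
Proof.
move=> t0; rewrite /inverse_gaussian_density; case: ifP => // x0.
by rewrite mulr_ge0 ?expR_ge0// divr_ge0 ?sqrtr_ge0// mulr_ge0// ltW.
Qed.

Lemma measurable_inverse_gaussian_density (t : R) : measurable_fun setT (f t).
Proof.
(* Inverses and square roots become real powers, whose measurability is at hand. *)
have -> : f t = fun x => if 0 < x then
    mu * t * ((2 * pi * beta * x ^+ 3) `^ 2^-1) `^ (-1) *
    expR (- ((x - mu * t) ^+ 2 * (2 * beta * x) `^ (-1))) else 0.
  apply/funext => x; rewrite /inverse_gaussian_density; case: ifP => // x0.
  have h1 : 0 <= 2 * pi * beta * x ^+ 3.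
    by rewrite !mulr_ge0 ?exprn_ge0 ?pi_ge0// ltW.
  rewrite powR_inv1 ?powR_ge0// powR12_sqrt// powR_inv1//.
  by rewrite !mulr_ge0// ltW.
apply: measurable_fun_ifT => //; first exact: measurable_fun_ltr.
apply: measurable_funM.
  apply: measurable_funM => //.
  apply: (measurableT_comp (measurable_powR (-1))) => //.
  apply: (measurableT_comp (measurable_powR (2^-1))) => //.
  by apply: measurable_funM => //; exact: measurable_funX.
apply: measurableT_comp => //; apply: measurableT_comp => //.
apply: measurable_funM; first by apply: measurable_funX; exact: measurable_funB.
by apply: (measurableT_comp (measurable_powR (-1))).
Qed.

(* Exponential tilting of the time-[t] density gives, up to a scaling by [l ^+ 2],
   the time-[t * l] density. *)
Lemma inverse_gaussian_density_tilt (t theta x : R) : 0 < t -> 0 <= theta ->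
  let l := Num.sqrt (1 + 2 * beta * theta) in
  expR (- (theta * x)) * f t x =
  expR (- (mu / beta * (l - 1) * t)) * (l ^+ 2 * f (t * l) (l ^+ 2 * x)).
Proof.
move=> t0 th0 l.
have l20 : 0 < 1 + 2 * beta * theta by rewrite ltr_wpDr// !mulr_ge0// ltW.
have l0 : 0 < l by rewrite sqrtr_gt0.
have l2 : l ^+ 2 = 1 + 2 * beta * theta by rewrite sqr_sqrtr// ltW.
rewrite /inverse_gaussian_density pmulr_rgt0 ?exprn_gt0//.
case: ifP => x0; last by rewrite !mulr0.
have -> : 2 * pi * beta * (l ^+ 2 * x) ^+ 3 = (l ^+ 3) ^+ 2 * (2 * pi * beta * x ^+ 3) by ring.
rewrite [Num.sqrt ((l ^+ 3) ^+ 2 * _)]sqrtrM ?sqr_ge0// sqrtr_sqr gtr0_norm ?exprn_gt0//.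
set q := Num.sqrt (2 * pi * beta * x ^+ 3).
have q0 : 0 < q by rewrite sqrtr_gt0 !mulr_gt0 ?exprn_gt0 ?pi_gt0.
rewrite [LHS]mulrCA -expRD.
have -> : - (theta * x) + - ((x - mu * t) ^+ 2 / (2 * beta * x)) =
   - (mu / beta * (l - 1) * t) +
   - ((l ^+ 2 * x - mu * (t * l)) ^+ 2 / (2 * beta * (l ^+ 2 * x))).
  have -> : theta = (l ^+ 2 - 1) / (2 * beta).
    by rewrite l2; field; rewrite gt_eqF.
  by field; rewrite !gt_eqF.
rewrite expRD; field.
by rewrite !gt_eqF.
Qed.

Context {d : measure_display} {T : measurableType d} (P : probability T R).
Variable S : R -> T -> R.
Hypothesis hS : inverse_gaussian_subordinator P mu beta S.

(** No integral is computed: this is the density of [S t], whose law has total mass 1. *)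
Lemma inverse_gaussian_density_mass (t : R) : 0 < t ->
  (\int[leb]_x (f t x)%:E = 1)%E.
Proof.
move=> t0; have [_ h] := hS.
have <- : P (S t @^-1` setT) = 1%E by rewrite preimage_setT; exact: probability_setT.
by rewrite h.
Qed.

(** Tilting turns the integrand into a multiple of the density at time t l with its variable scaled
    by l^2; after the change of variable only the total mass of that density is left. *)
Lemma inverse_gaussian_laplace (t theta : R) : 0 <= t -> 0 <= theta ->
  (\int[P]_w (expR (- (theta * S t w)))%:E =
   (expR (- (ig_exponent (mu / beta) beta theta * t)))%:E)%E.
Proof.
move=> + th0; rewrite le_eqVlt => /predU1P[<-|t0].
  transitivity (\int[P]_w 1%E)%E.
    apply: eq_integral => w _; case: hS => -[[_ -> _ _ _ _] _] _.
    by rewrite mulr0 oppr0 expR0.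
  rewrite mulr0 oppr0 expR0 integral_cst// mul1e; exact: probability_setT.
have [[[mS _ _ _ _ _] _] law] := hS.
have mSt : measurable_fun setT (S t : T -> measurableTypeR R) := mS t (ltW t0).
have mexp : measurable_fun setT (fun x : R => expR (- (theta * x))).
  by apply: measurableT_comp => //; apply: measurableT_comp => //; exact: measurable_funM.
have := @ge0_integral_pushforward _ _ _ _ _ _ mSt P setT
  (fun x => (expR (- (theta * x)))%:E) measurableT.
rewrite preimage_setT /comp => <-; last 2 first.
- exact/measurable_EFinP.
- by move=> y _; rewrite lee_fin expR_ge0.
have e0 x : 0 <= expR (- (theta * x)) by exact: expR_ge0.
rewrite (ge0_integral_density (mu := leb) (measurable_inverse_gaussian_density t)
  (fun x => inverse_gaussian_density_ge0 x (ltW t0)) _ mexp e0); last first.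
  by move=> B mB; exact: law.
pose l := Num.sqrt (1 + 2 * beta * theta).
have l20 : 0 < 1 + 2 * beta * theta by rewrite ltr_wpDr// !mulr_ge0// ltW.
have l0 : 0 < l by rewrite sqrtr_gt0.
have ll0 : 0 < l ^+ 2 by rewrite exprn_gt0.
have tl0 : 0 < t * l by rewrite mulr_gt0.
under eq_integral do rewrite inverse_gaussian_density_tilt// EFinM.
rewrite ge0_integralZl//; last 2 first.
- apply/measurable_EFinP; apply: measurable_funM => //.
  apply: (measurableT_comp (measurable_inverse_gaussian_density _)).
  exact: measurable_funM.
- by move=> x _; rewrite lee_fin mulr_ge0 ?inverse_gaussian_density_ge0// ltW.
under eq_integral do rewrite EFinM.
rewrite ge0_integralZl//; last 2 first.
- apply/measurable_EFinP.
  apply: (measurableT_comp (measurable_inverse_gaussian_density _)).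
  exact: measurable_funM.
- by move=> x _; rewrite lee_fin inverse_gaussian_density_ge0// ltW.
have e : (1 = (l ^+ 2)%:E * \int[leb]_x (f (t * l) (l ^+ 2 * x))%:E)%E.
  rewrite -[LHS](inverse_gaussian_density_mass tl0).
  rewrite (@ge0_integral_affine _ (l ^+ 2) 0 (EFin \o f (t * l)) setT ll0 measurableT).
  - rewrite (_ : [set _ | _] = setT); last by apply/seteqP; split.
    by congr (_ * _)%E; apply: eq_integral => x _ /=; rewrite addr0.
  - by apply/measurable_EFinP; exact: measurable_inverse_gaussian_density.
  - by move=> x _; rewrite lee_fin inverse_gaussian_density_ge0// ltW.
by rewrite -e mule1.
Qed.

End inverse_gaussian_laplace.

(** As [Y] is nondecreasing, Y(s) approaches Y(t) from the right, where [X] converges; the case Y(s)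
    = Y(t), outside the punctured limit, is trivial. This prepares the inner processes for the next
    time change. *)
Lemma right_continuous_time_change {R : realType} (X Y : R -> R) :
  (forall t : R, 0 <= t -> X s @[s --> t^'+] --> X t) ->
  (forall t : R, 0 <= t -> Y s @[s --> t^'+] --> Y t) ->
  (forall s t : R, 0 <= s -> s <= t -> Y s <= Y t) -> (forall t, 0 <= t -> 0 <= Y t) ->
  forall t : R, 0 <= t -> X (Y s) @[s --> t^'+] --> X (Y t).
Proof.
move=> rX rY ndY Y0 t t0; apply/cvgrPdist_lt => e e0.
have /cvgrPdist_lt/(_ e e0)[r /= r0 Hr] := rX _ (Y0 _ t0).
have /cvgrPdist_lt/(_ r r0) HY := rY _ t0.
near=> s.
have ts : t < s by near: s; exact: nbhs_right_gt.
have := ndY _ _ t0 (ltW ts); rewrite le_eqVlt => /predU1P[->|Yts].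
  by rewrite subrr normr0.
by apply: Hr => //=; near: s.
Unshelve. all: by end_near. Qed.

(** * Point probabilities as coefficients of the generating function *)

Section pmf_expansion.
Context {R : realType} {d : measure_display} {T : measurableType d}.
Variables (P : probability T R) (Z : T -> R).
Hypothesis mZ : measurable_fun setT Z.
Hypothesis Znat : exists N, [/\ measurable N, P N = 0%E &
  forall w, ~ N w -> exists k : nat, Z w = k%:R].

(** For 0 < u < 1 and off a null set, u^Z lies between its truncation to Z < n and that truncation
    plus u^n. *)
Lemma expands_pmf : expands (fun u => fine (\int[P]_w (geom_weight u (Z w))%:E)%E)
  (fun k => fine (P (Z @^-1` [set k%:R]))).
Proof.
have [N [mN N0 ZN]] := Znat => n.
have mZk k : measurable (Z @^-1` [set (k%:R : R)]).
  by rewrite -[_ @^-1` _]setTI; apply: mZ.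
exists 1 => //; near=> u.
have u0 : 0 < u by near: u; exact: near0_gt0.
have u1 : u < 1 by near: u; exact: near0_lt1.
have u01 : 0 < u < 1 by rewrite u0 u1.
pose f w : R := \sum_(k < n) u ^+ k * \1_(Z @^-1` [set k%:R]) w.
have mf : measurable_fun setT f.
  by apply: measurable_sum => k; apply: measurable_funM => //; exact: measurable_indic.
have f0 w : 0 <= f w by apply: sumr_ge0 => k _; rewrite mulr_ge0// exprn_ge0// ltW.
have intf : (\int[P]_w (f w)%:E = (\sum_(k < n) fine (P (Z @^-1` [set k%:R])) * u ^+ k)%:E)%E.
  under eq_integral do rewrite -sumEFin.
  rewrite ge0_integral_sum//; last 2 first.
  - by move=> k; apply/measurable_EFinP; apply: measurable_funM => //; exact: measurable_indic.
  - by move=> k w _; rewrite lee_fin mulr_ge0// exprn_ge0// ltW.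
  rewrite -sumEFin; apply: eq_bigr => k _.
  under eq_integral do rewrite EFinM.
  rewrite ge0_integralZl//; last 2 first.
  - by apply/measurable_EFinP; exact: measurable_indic.
  - by rewrite lee_fin exprn_ge0// ltW.
  rewrite integral_indic// setIT muleC EFinM fineK// fin_num_measure//.
have mg : measurable_fun setT (fun w => (geom_weight u (Z w))%:E).
  by apply/measurable_EFinP; apply: measurableT_comp => //; exact: measurable_geom_weight.
have bounds w : ~ N w -> f w <= geom_weight u (Z w) <= f w + u ^+ n.
  move=> /ZN[k Zk].
  have fE : f w = if (k < n)%N then u ^+ k else 0.
    rewrite /f; case: ifPn => [kn|].
      rewrite (bigD1 (Ordinal kn))//= big1 ?addr0 ?indicE ?mem_set ?mulr1// => i ik.
      rewrite indicE memNset ?mulr0//= Zk => /eqP; rewrite eqr_nat => /eqP ki.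
      by move/eqP: ik; apply; apply/val_inj.
    rewrite -leqNgt => nk; rewrite big1// => i _.
    rewrite indicE memNset ?mulr0//= Zk => /eqP; rewrite eqr_nat => /eqP ki.
    by move: nk; rewrite leqNgt ki ltn_ord.
  rewrite fE Zk geom_weight_nat//; case: ifPn => [_|].
    by rewrite lexx lerDl exprn_ge0// ltW.
  rewrite -leqNgt add0r => nk; rewrite exprn_ge0 ?(ltW u0)//=.
  by rewrite ler_wiXn2l// ltW.
have g0 w : 0 <= geom_weight u (Z w) by have /andP[] := geom_weight01 (Z w) u01.
have ae_le (h k : T -> R) : measurable_fun setT h -> measurable_fun setT k ->
    (forall w, 0 <= h w) -> (forall w, 0 <= k w) ->
    (forall w, ~ N w -> h w <= k w) -> (\int[P]_w (h w)%:E <= \int[P]_w (k w)%:E)%E.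
  move=> mh mk h0 k0 hk; apply: ae_ge0_le_integral => //.
  - by move=> w _; rewrite lee_fin.
  - exact/measurable_EFinP.
  - by move=> w _; rewrite lee_fin.
  - exact/measurable_EFinP.
  - exists N; split => // w /= h1; apply: contrapT => Nw; apply: h1 => _.
    by rewrite lee_fin hk.
have mgr : measurable_fun setT (fun w => geom_weight u (Z w)) by exact/measurable_EFinP.
have un0 : 0 <= u ^+ n by rewrite exprn_ge0// ltW.
have lo : (\int[P]_w (f w)%:E <= \int[P]_w (geom_weight u (Z w))%:E)%E.
  by apply: ae_le => // w /bounds /andP[].
have hi : (\int[P]_w (geom_weight u (Z w))%:E <= \int[P]_w (f w)%:E + (u ^+ n)%:E)%E.
  have -> : ((u ^+ n)%:E = \int[P]_w (u ^+ n)%:E)%E.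
    by rewrite integral_cst// -[LHS]mule1; congr (_ * _)%E; apply/esym; exact: probability_setT.
  rewrite -ge0_integralD//; last 2 first.
  - by move=> w _; rewrite lee_fin.
  - exact/measurable_EFinP.
  apply: (ae_le _ (fun w => f w + u ^+ n)) => //.
  - exact: measurable_funD.
  - by move=> w; rewrite addr_ge0.
  - by move=> w /bounds /andP[].
move: lo hi; rewrite intf -EFinD; set I := (\int[P]_w _)%E => lo hi.
have If : I \is a fin_num by rewrite fin_numE -ltNye -ltey (lt_le_trans _ lo) ?ltNyr//= (le_lt_trans hi) ?ltry.
move: lo hi; rewrite -[I]fineK// !lee_fin => lo hi.
by rewrite mul1r ler_norml; apply/andP; split; lra.
Unshelve. all: by end_near. Qed.

End pmf_expansion.

Section independence.
Context {R : realType} {d : measure_display} {T : measurableType d}.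
Variable P : probability T R.
Implicit Types X Y Z : R -> T -> R.

Lemma process_sigma_preimage X (t : R) (B : set R) : 0 <= t -> measurable B ->
  process_sigma X (X t @^-1` B).
Proof.
move=> t0 mB; apply: sub_sigma_algebra; exists t => //.
by exists B => //; rewrite setTI.
Qed.

Lemma process_sigma_setT X : process_sigma X setT.
Proof.
by rewrite -(preimage_setT (X 0)); apply: process_sigma_preimage.
Qed.

Lemma independent_processes2 X Y A B : independent_processes P [tuple X; Y] ->
  process_sigma X A -> process_sigma Y B -> (P (A `&` B) = P A * P B)%E.
Proof.
move=> ind XA YB; have := ind (fun i => nth setT [:: A; B] i).
rewrite big_ord_recl big_ord1 /= => <-.
  congr (P _); apply/seteqP; split=> [w [Aw Bw] [[|[|//]] i] _//|w h].
  by split; [exact: (h ord0)|exact: (h (lift ord0 ord0))].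
by case=> [[|[|//]] i].
Qed.

(** The first process against the other two, and these two against each other: the factorizations
    that nested conditioning calls for. The second comes from the event [setT] for [X]. *)
Lemma independent_processes3 X Y Z A B C : independent_processes P [tuple X; Y; Z] ->
  process_sigma X A -> process_sigma Y B -> process_sigma Z C ->
  (P (A `&` (B `&` C)) = P A * P (B `&` C) /\ P (B `&` C) = P B * P C)%E.
Proof.
move=> ind XA YB ZC.
have h A' : process_sigma X A' -> (P (A' `&` (B `&` C)) = P A' * (P B * P C))%E.
  move=> XA'; have := ind (fun i => nth setT [:: A'; B; C] i).
  rewrite big_ord_recl big_ord_recl big_ord1 /= => <-.
    congr (P _); apply/seteqP; split=> [w [Aw [Bw Cw]] [[|[|[|//]]] i] _//|w k].
    split; first exact: (k ord0).
    by split; [exact: (k (lift ord0 ord0))|exact: (k (lift ord0 (lift ord0 ord0)))].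
  by case=> [[|[|[|//]]] i].
have e : (P (B `&` C) = P B * P C)%E.
  have := h _ (@process_sigma_setT X); rewrite setTI => ->.
  rewrite -[RHS]mul1e; congr (_ * _)%E; exact: probability_setT.
by split => //; rewrite h// e.
Qed.

End independence.

(** * Conditioning on the successive time changes *)

Section subordinated_poisson.
Context {R : realType} {d : measure_display} {T : measurableType d}.
Variable P : probability T R.

Lemma subordinator_ge0 (A : R -> T -> R) : subordinator P A ->
  forall w (t : R), 0 <= t -> 0 <= A t w.
Proof. by move=> [[_ A0 _ _ _ _] mA] w t t0; rewrite -(A0 w); exact: mA. Qed.

Lemma continuous_expRN (c : R) : continuous (fun x => expR (- (c * x))).
Proof.
move=> x; apply: (@continuous_comp _ _ _ (fun y => - (c * y)) expR).
  by apply: cvgN; apply: cvgM; [exact: cvg_cst|exact: cvg_id].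
exact: continuous_expR.
Qed.

Lemma expRN01 (c x : R) : 0 <= c -> 0 <= x -> 0 <= expR (- (c * x)) <= 1.
Proof.
by move=> c0 x0; rewrite expR_ge0 -[leRHS]expR0 ler_expR oppr_le0 mulr_ge0.
Qed.

Lemma measurable_expRN (c : R) (Y : T -> R) : measurable_fun setT Y ->
  measurable_fun setT (fun w => expR (- (c * Y w))).
Proof.
move=> mY; apply: (measurableT_comp (f := fun x => expR (- (c * x)))) => //.
by apply: continuous_measurable_fun; exact: continuous_expRN.
Qed.

Variables (eta mu beta : R) (N1 Aeta S L : R -> T -> R).
Hypotheses (heta : 0 < eta < 1) (hmu : 0 < mu) (hbeta : 0 < beta).
Hypotheses (hN1 : poisson_process P 1 N1) (hAeta : stable_subordinator P eta Aeta).
Hypothesis hN1Aeta : independent_processes P [tuple N1; Aeta].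
Hypothesis hS : inverse_gaussian_subordinator P mu beta S.
(** [L] stands for either outer time change, so it is assumed to have what a stable subordinator and
    its inverse share. *)
Hypothesis mL : forall t : R, 0 <= t -> measurable_fun setT (L t).
Hypothesis L0 : forall w (t : R), 0 <= t -> 0 <= L t w.
Hypothesis hind : independent_processes P [tuple time_changed N1 Aeta; S; L].

Local Notation M := (time_changed N1 Aeta).

Let sA : subordinator P Aeta. Proof. by case: hAeta. Qed.
Let sS : subordinator P S. Proof. by case: hS. Qed.
Let A0 w (t : R) : 0 <= t -> 0 <= Aeta t w. Proof. exact: subordinator_ge0. Qed.
Let S0 w (t : R) : 0 <= t -> 0 <= S t w. Proof. exact: subordinator_ge0. Qed.
Let mN1 (t : R) : 0 <= t -> measurable_fun setT (N1 t).
Proof. by case: hN1 => -[h _ _ _ _ _] _; exact: h. Qed.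
Let mA (t : R) : 0 <= t -> measurable_fun setT (Aeta t).
Proof. by case: sA => -[h _ _ _ _ _] _; exact: h. Qed.
Let mS (t : R) : 0 <= t -> measurable_fun setT (S t).
Proof. by case: sS => -[h _ _ _ _ _] _; exact: h. Qed.
Let rcN1 w (t : R) : 0 <= t -> N1 ^~ w @ t^'+ --> N1 t w.
Proof. by case: hN1 => -[_ _ _ _ h _] _; exact: h. Qed.
Let rcA w (t : R) : 0 <= t -> Aeta ^~ w @ t^'+ --> Aeta t w.
Proof. by case: sA => -[_ _ _ _ h _] _; exact: h. Qed.
Let rcS w (t : R) : 0 <= t -> S ^~ w @ t^'+ --> S t w.
Proof. by case: sS => -[_ _ _ _ h _] _; exact: h. Qed.
Let rcM w (t : R) : 0 <= t -> M ^~ w @ t^'+ --> M t w.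
Proof.
apply: (@right_continuous_time_change _ (N1 ^~ w) (Aeta ^~ w)) => //.
- exact: rcN1.
- exact: rcA.
- by move=> s r s0 sr; case: sA => _; exact.
- exact: A0.
Qed.
Let mM (t : R) : 0 <= t -> measurable_fun setT (M t).
Proof.
by move=> t0; apply: measurable_time_change => // [|w]; [exact: mA|exact: A0].
Qed.

Let gw0 (u x : R) : 0 < u < 1 -> 0 <= geom_weight u x.
Proof. by move=> u01; have /andP[] := geom_weight01 x u01. Qed.

(** The Poisson generating function exp(- (1 - u) t), read at the time [Aeta s], becomes the Laplace
    transform of [Aeta s] at 1 - u. *)
Lemma space_fractional_poisson_gf (u s : R) : 0 < u < 1 -> 0 <= s ->
  (\int[P]_w (geom_weight u (M s w))%:E = (expR (- ((1 - u) `^ eta * s)))%:E)%E.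
Proof.
move=> u01 s0; have /andP[u0 u1] := u01.
have u10 : 0 <= 1 - u by rewrite subr_ge0 ltW.
rewrite (@integral_time_change _ _ _ P N1 (Aeta s) _ _ _ _ setT (geom_weight u)
  (fun x => expR (- ((1 - u) * x)))) //.
- have [_ /(_ s (1 - u) s0 u10)] := hAeta.
  by rewrite unlock => ->.
- exact: mA.
- by move=> w; exact: A0.
- exact: continuous_geom_weight.
- by move=> x; exact: geom_weight01.
- exact: continuous_expRN.
- by move=> t t0; exact: expRN01.
move=> t I t0 mI; rewrite setIT integral_indep//.
- by rewrite poisson_process_gf// muleC.
- exact: mN1.
- by rewrite -[_ @^-1` _]setTI; apply: mA.
- move=> B mB; apply: (independent_processes2 hN1Aeta); exact: process_sigma_preimage.
- exact: measurable_geom_weight.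
- by move=> x; exact: gw0.
Qed.

Let MS := time_changed M S.

Let rcMS w (t : R) : 0 <= t -> MS ^~ w @ t^'+ --> MS t w.
Proof.
apply: (@right_continuous_time_change _ (M ^~ w) (S ^~ w)) => //.
- exact: rcM.
- exact: rcS.
- by move=> s r s0 sr; case: sS => _; exact.
- exact: S0.
Qed.
Let mMS (t : R) : 0 <= t -> measurable_fun setT (MS t).
Proof.
by move=> t0; apply: measurable_time_change => // [|w]; [exact: mS|exact: S0].
Qed.

Let psi (u : R) := ig_exponent (mu / beta) beta ((1 - u) `^ eta).

Lemma measurable_subordinated (t : R) : 0 <= t ->
  measurable_fun setT (time_changed MS L t).
Proof.
by move=> t0; apply: measurable_time_change => // [|w]; [exact: mL|exact: L0].
Qed.

(** [L t] is conditioned on first. Within each event L_t in J, conditioning on [S s] turns the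
    space-fractional generating function into the Laplace transform of [S s] at (1 - u)^eta, whose
    exponent is psi(u). *)
Lemma subordinated_gf (u t : R) : 0 < u < 1 -> 0 <= t ->
  (\int[P]_w (geom_weight u (time_changed MS L t w))%:E =
   \int[P]_w (expR (- (psi u * L t w)))%:E)%E.
Proof.
move=> u01 t0; have /andP[u0 u1] := u01.
have u10 : 0 < 1 - u by rewrite subr_gt0.
have th0 : 0 < (1 - u) `^ eta by rewrite powR_gt0.
have m0 : 0 < mu / beta by rewrite divr_gt0.
have psi0 : 0 < psi u by exact: ig_exponent_gt0.
have mLt (J : set R) : measurable J -> measurable (L t @^-1` J).
  by move=> mJ; rewrite -[_ @^-1` _]setTI; apply: mL.
rewrite (@integral_time_change _ _ _ P MS (L t) _ _ _ _ setT (geom_weight u)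
  (fun x => expR (- (psi u * x)))) //.
- exact: mL.
- by move=> w; exact: L0.
- exact: continuous_geom_weight.
- by move=> x; exact: geom_weight01.
- exact: continuous_expRN.
- by move=> x x0; apply: expRN01 => //; exact: ltW.
move=> s J s0 mJ; rewrite setIT.
(* The event L_t in J is carried along as the set [C] of the lemma. *)
rewrite (@integral_time_change _ _ _ P M (S s) _ _ _ _ (L t @^-1` J) (geom_weight u)
  (fun x => expR (- ((1 - u) `^ eta * x)))) //.
- rewrite (integral_indep (g := fun x => expR (- ((1 - u) `^ eta * x)))).
  + by rewrite (inverse_gaussian_laplace hmu hbeta hS s0 (ltW th0)) muleC.
  + exact: mS.
  + exact: mLt.
  + move=> B mB.
    have [_ h] := independent_processes3 hind (@process_sigma_setT _ _ _ M)
      (@process_sigma_preimage _ _ _ S s B s0 mB) (@process_sigma_preimage _ _ _ L t J t0 mJ).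
    exact: h.
  + by apply: continuous_measurable_fun; exact: continuous_expRN.
  + by move=> x; exact: expR_ge0.
- exact: mS.
- by move=> w; exact: S0.
- exact: mLt.
- exact: continuous_geom_weight.
- by move=> x; exact: geom_weight01.
- exact: continuous_expRN.
- by move=> x x0; apply: expRN01 => //; exact: ltW.
move=> r I r0 mI; rewrite integral_indep//.
- by rewrite space_fractional_poisson_gf// muleC.
- exact: mM.
- by apply: measurableI; [rewrite -[_ @^-1` _]setTI; apply: mS|exact: mLt].
- move=> B mB.
  have [h _] := independent_processes3 hind (@process_sigma_preimage _ _ _ M r B r0 mB)
      (@process_sigma_preimage _ _ _ S s I s0 mI) (@process_sigma_preimage _ _ _ L t J t0 mJ).
  exact: h.
- exact: measurable_geom_weight.
- by move=> x; exact: gw0.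
Qed.

(** From here on the subordinated process enters through the Laplace transform of [L t] alone. *)
Lemma expands_subordinated_pmf (t : R) : 0 <= t ->
  expands (fun u => fine (\int[P]_w (expR (- (psi u * L t w)))%:E)%E)
    (fun k => pmf_at P (time_changed MS L) k t).
Proof.
move=> t0.
have h := @expands_pmf _ _ _ P (time_changed MS L t) (measurable_subordinated t0).
apply: eq_expands (h _).
  near=> u; rewrite subordinated_gf//.
  by apply/andP; split; near: u; [exact: near0_gt0|exact: near0_lt1].
have [N [mN N0 HN]] := poisson_paths_nat hN1.
by exists N; split => // w Nw; apply: HN => //; apply: A0; apply: S0; exact: L0.
Unshelve. all: by end_near. Qed.

End subordinated_poisson.

(** * Gamma and Beta integrals *)

Section improper_FTC.
Context {R : realType}.
Local Notation leb := (@lebesgue_measure R).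
Variables (f F : R -> R) (F0 : R).
Hypothesis dF : forall x : R, 0 < x -> is_derive x (1 : R) F (f x).
Hypothesis cf : forall x : R, 0 < x -> {for x, continuous f}.
Hypothesis f0 : forall x : R, 0 < x -> 0 <= f x.
Hypothesis F_at0 : F x @[x --> 0^'+] --> F0.

Let cF (x : R) : 0 < x -> {for x, continuous F}.
Proof.
by move=> x0; apply: differentiable_continuous; apply/derivable1_diffP;
  apply: ex_derive; exact: dF.
Qed.

Lemma measurable_fun_pos (D : set R) : D `<=` `]0, +oo[ -> measurable D -> measurable_fun D f.
Proof.
move=> D0 mD; apply: measurable_funS D0 _ => //.
apply: open_continuous_measurable_fun => //.
by move=> x; rewrite inE/= in_itv/= andbT; exact: cf.
Qed.

Let cvg_inv (t : R) : 0 < t -> F (t / n.+2%:R) @[n --> \oo] --> F0.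
Proof.
move=> t0; have /cvg_at_rightP := F_at0; apply; split=> [n|].
  by rewrite divr_gt0.
rewrite -[X in _ --> X](mulr0 t); apply: cvgM; first exact: cvg_cst.
by have := @cvg_harmonic R; rewrite -(cvg_shiftS (@harmonic R)).
Qed.

Let shrink (t x : R) : 0 < x -> exists n : nat, t / n.+2%:R <= x.
Proof.
move=> x0; exists (Num.truncn (t / x)).
rewrite ler_pdivrMr// mulrC -ler_pdivrMr//.
have [tx|tx] := leP 0 (t / x); last by rewrite ltW// (lt_le_trans tx).
have /andP[_ /ltW] := truncn_itv tx => /le_trans; apply.
by rewrite ler_nat.
Qed.

(** The integrand may blow up at 0, where [F] has a limit. The interval is exhausted by the
    [t / (n + 2), t], with n + 2 to keep the left end strictly below t. *)
Lemma improper_FTC_itv (t : R) : 0 < t ->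
  (\int[leb]_(x in `]0%R, t]) (f x)%:E = (F t - F0)%:E)%E.
Proof.
move=> t0.
have tn n : 0 < t / n.+2%:R by rewrite divr_gt0.
have tnt n : t / n.+2%:R < t by rewrite ltr_pdivrMr// ltr_pMr// ltr1n.
have UE : \bigcup_n `[t / n.+2%:R, t]%classic = `]0, t]%classic.
  apply/seteqP; split=> [x [n _]|x] /=; rewrite !in_itv/= => /andP[x1 x2].
    by rewrite x2 (lt_le_trans (tn n)).
  by have [n nx] := shrink t x1; exists n; rewrite //= in_itv/= nx.
have := @ge0_nondecreasing_set_cvg_integral _ (measurableTypeR R) R (fun n => `[t / n.+2%:R, t]%classic) (EFin \o f) leb.
rewrite UE => h.
have {}h := h _ _ _ _.
have : (F t - F (t / n.+2%:R))%:E @[n --> \oo] --> (F t - F0)%:E.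
  apply: cvg_EFin; first exact: nearW.
  by apply: cvgB; [exact: cvg_cst|exact: cvg_inv].
rewrite (_ : (fun n => _) = fun n => (\int[leb]_(x in `[(t / n.+2%:R)%R, t]) (f x)%:E)%E); last first.
  apply/funext => n; rewrite (@continuous_FTC2 _ f F).
  - by rewrite EFinB.
  - exact: tnt.
  - apply: continuous_in_subspaceT => x; rewrite inE/= in_itv/= => /andP[x1 _].
    by apply: cf; exact: lt_le_trans (tn n) x1.
  - split.
    + move=> x; rewrite in_itv/= => /andP[x1 _].
      by apply: ex_derive; apply: dF; exact: lt_trans (tn n) x1.
    + by apply: cvg_at_right_filter; exact: cF.
    + by apply: cvg_at_left_filter; exact: cF.
  - move=> x; rewrite in_itv/= => /andP[x1 _].
    by rewrite derive1E; apply: derive_val; apply: dF; exact: lt_trans (tn n) x1.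
move=> h1; apply: (cvg_unique _ _ h1) => //; apply: h.
- apply/nondecreasing_seqP => n; rewrite subsetEset => x /=; rewrite !in_itv/= => /andP[x1 ->].
  rewrite andbT (le_trans _ x1)// ler_pM2l// lef_pV2 ?posrE//.
  by rewrite ler_nat.
- by move=> n; exact: measurable_itv.
- move=> n; apply/measurable_EFinP; apply: measurable_fun_pos => //.
  by move=> x /=; rewrite !in_itv/= andbT => /andP[x1 _]; exact: lt_le_trans (tn n) x1.
- move=> n x /=; rewrite in_itv/= => /andP[x1 _]; rewrite lee_fin f0//.
  exact: lt_le_trans (tn n) x1.
Qed.

Lemma improper_FTC_y (l : R) : F x @[x --> +oo] --> l ->
  (\int[leb]_(x in `]0%R, +oo[) (f x)%:E = (l - F0)%:E)%E.
Proof.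
move=> Fl.
have tn n : 0 < 1 / n.+2%:R :> R by rewrite divr_gt0.
have UE : \bigcup_n `[1 / n.+2%:R : R, +oo[%classic = `]0, +oo[%classic.
  apply/seteqP; split=> [x [n _]|x] /=; rewrite !in_itv/= !andbT => x1.
    by rewrite (lt_le_trans (tn n)).
  by have [n nx] := shrink 1 x1; exists n; rewrite //= in_itv/= andbT.
have := @ge0_nondecreasing_set_cvg_integral _ (measurableTypeR R) R (fun n => `[1 / n.+2%:R : R, +oo[%classic) (EFin \o f) leb.
rewrite UE => h.
have {}h := h _ _ _ _.
have : (l - F (1 / n.+2%:R))%:E @[n --> \oo] --> (l - F0)%:E.
  apply: cvg_EFin; first exact: nearW.
  by apply: cvgB; [exact: cvg_cst|exact: cvg_inv].
rewrite (_ : (fun n => _) = fun n => (\int[leb]_(x in `[(1 / n.+2%:R)%R : R, +oo[) (f x)%:E)%E); last first.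
  apply/funext => n; rewrite (@ge0_continuous_FTC2y _ f F _ l).
  - by rewrite EFinB.
  - by move=> x x1; apply: f0; exact: lt_le_trans (tn n) x1.
  - apply: continuous_in_subspaceT => x; rewrite inE/= in_itv/= andbT => x1.
    by apply: cf; exact: lt_le_trans (tn n) x1.
  - exact: Fl.
  - by move=> x x1; apply: ex_derive; apply: dF; exact: lt_trans (tn n) x1.
  - by apply: cvg_at_right_filter; exact: cF.
  - move=> x; rewrite in_itv/= andbT => x1.
    by rewrite derive1E; apply: derive_val; apply: dF; exact: lt_trans (tn n) x1.
move=> h1; apply: (cvg_unique _ _ h1) => //; apply: h.
- apply/nondecreasing_seqP => n; rewrite subsetEset => x /=; rewrite !in_itv/= !andbT => x1.
  rewrite (le_trans _ x1)// ler_pM2l// lef_pV2 ?posrE//.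
  by rewrite ler_nat.
- by move=> n; exact: measurable_itv.
- move=> n; apply/measurable_EFinP; apply: measurable_fun_pos => //.
  by move=> x /=; rewrite !in_itv/= !andbT => x1; exact: lt_le_trans (tn n) x1.
- move=> n x /=; rewrite in_itv/= andbT => x1; rewrite lee_fin f0//.
  exact: lt_le_trans (tn n) x1.
Qed.

End improper_FTC.

(** * Gamma integrals and stretched exponentials *)

Section gamma_integrals.
Context {R : realType}.
Local Notation leb := (@lebesgue_measure R).

Lemma expR_ge_coeff n (y : R) : 0 <= y -> y ^+ n / n`!%:R <= expR y.
Proof.
move=> y0; rewrite /expR.
apply: (@le_trans _ _ (series (exp_coeff y) n.+1)).
  rewrite /series/= big_nat_recr//= lerDr sumr_ge0// => i _.
  by rewrite divr_ge0// exprn_ge0.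
apply: nondecreasing_cvgn_le; last exact: is_cvg_series_exp_coeff.
apply/nondecreasing_seqP => k; rewrite /series/= big_nat_recr//= lerDl.
by rewrite divr_ge0// exprn_ge0.
Qed.

(** The upper incomplete Gamma function at n + 1, divided by n!; its derivative telescopes to a
    single term. *)
Definition gamma_tail (n : nat) (y : R) : R :=
  expR (- y) * \sum_(j < n.+1) (y ^+ j / j`!%:R).

Lemma is_derive_expRN (y : R) : is_derive y (1 : R) (fun y => expR (- y)) (- expR (- y)).
Proof.
have h := @is_derive1_comp R expR (@GRing.opp R) y _ _ (is_derive_expR (- y))
  (is_deriveN (is_derive_id y (1 : R))).
by apply: (is_derive_eq h); rewrite mulrN1.
Qed.

Lemma is_derive_gamma_tail n (y : R) :
  is_derive y (1 : R) (gamma_tail n) (- (expR (- y) * (y ^+ n / n`!%:R))).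
Proof.
elim: n => [|n IH].
  rewrite (_ : gamma_tail 0 = fun y => expR (- y)); last first.
    by apply/funext => x; rewrite /gamma_tail big_ord1 expr0 divr1 mulr1.
  by apply: (is_derive_eq (is_derive_expRN y)); rewrite expr0 divr1 mulr1.
rewrite (_ : gamma_tail n.+1 = gamma_tail n +
    ((fun y => expR (- y)) * (fun y => n.+1`!%:R^-1 * y ^+ n.+1))); last first.
  by apply/funext => x; rewrite /gamma_tail !fctE big_ord_recr/= mulrDr [_ / _]mulrC.
have h := is_deriveD IH (is_deriveM (is_derive_expRN y) (is_derive_monomial (n.+1`!%:R^-1) n y)).
apply: (is_derive_eq h).
rewrite /GRing.scale/= factS natrM; field.
by rewrite addrC natr1 !pnatr_eq0 -lt0n fact_gt0.
Qed.

Lemma cvg_expRN_X n : expR (- y) * (y ^+ n / n`!%:R) @[y --> +oo] --> (0 : R).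
Proof.
apply: (@squeeze_cvgr _ _ _ _ (cst 0) (fun y => n.+1%:R * y^-1)).
- near=> y; have y0 : 0 < y by near: y; exact: nbhs_pinfty_gt.
  rewrite /= mulr_ge0 ?expR_ge0 ?divr_ge0 ?exprn_ge0 ?(ltW y0)//=.
  rewrite expRN mulrC ler_pdivrMr ?expR_gt0//.
  have := expR_ge_coeff n.+1 (ltW y0).
  rewrite -(ler_pM2l (_ : 0 < n.+1%:R / y)) ?divr_gt0//; apply: le_trans.
  rewrite le_eqVlt; apply/orP; left; apply/eqP.
  rewrite factS natrM exprS; field.
  by rewrite addrC natr1 !pnatr_eq0 -lt0n fact_gt0/= gt_eqF.
- exact: cvg_cst.
- rewrite -[X in _ --> X](mulr0 n.+1%:R); apply: cvgM; first exact: cvg_cst.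
  by apply/gtr0_cvgV0; [near=> y; near: y; exact: nbhs_pinfty_gt|exact: cvg_id].
Unshelve. all: by end_near. Qed.

Lemma cvg_gamma_tail n : gamma_tail n y @[y --> +oo] --> (0 : R).
Proof.
elim: n => [|n IH].
  rewrite (_ : gamma_tail 0 = fun y => expR (- y) * (y ^+ 0 / 0`!%:R)); last first.
    by apply/funext => x; rewrite /gamma_tail big_ord1.
  exact: cvg_expRN_X.
rewrite (_ : gamma_tail n.+1 = fun y => gamma_tail n y + expR (- y) * (y ^+ n.+1 / n.+1`!%:R)); last first.
  by apply/funext => x; rewrite /gamma_tail big_ord_recr/= mulrDr.
by rewrite -[X in _ --> X]addr0; apply: cvgD => //; exact: cvg_expRN_X.
Qed.

Lemma cvg_powRy (a : R) : 0 < a -> x `^ a @[x --> +oo] --> +oo.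
Proof.
move=> a0; apply/cvgryPge => A; near=> x.
have x0 : 0 < x by near: x; exact: nbhs_pinfty_gt.
have Ax : `|A| `^ a^-1 <= x by near: x; exact: nbhs_pinfty_ge.
rewrite (le_trans (ler_norm A))//.
have -> : `|A| = (`|A| `^ a^-1) `^ a by rewrite -powRrM mulVf ?gt_eqF// powRr1.
by apply: ge0_ler_powR; rewrite ?nnegrE ?powR_ge0 ?ltW.
Unshelve. all: by end_near. Qed.

Lemma continuous_powR_pos (p x : R) : 0 < x -> {for x, continuous (@powR R ^~ p)}.
Proof.
move=> x0; apply: differentiable_continuous; apply/derivable1_diffP.
by apply: derivable_powR; rewrite in_itv/= andbT.
Qed.

Lemma continuous_stretched (p a x : R) : 0 < x ->
  {for x, continuous (fun x : R => x `^ p * expR (- (x `^ a)))}.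
Proof.
move=> x0; apply: cvgM; first exact: continuous_powR_pos.
apply: (@continuous_comp _ _ _ (fun x => - (x `^ a)) expR).
  by apply: cvgN; exact: continuous_powR_pos.
exact: continuous_expR.
Qed.

(** The antiderivative - (n! / a) [gamma_tail n] (x^a) encodes the substitution y = x^a. The formula
    serves to bound the Gamma integral and, with a = nu, to find negative moments of the stable
    law. *)
Lemma integral_stretched_exponential (a : R) n : 0 < a ->
  (\int[leb]_(x in `]0%R, +oo[) (x `^ (a * n.+1%:R - 1) * expR (- (x `^ a)))%:E =
   (n`!%:R / a)%:E)%E.
Proof.
move=> a0.
have fn0 : n`!%:R != 0 :> R by rewrite pnatr_eq0 -lt0n fact_gt0.
pose F (x : R) := - (n`!%:R / a) * gamma_tail n (x `^ a).
have dF (x : R) : 0 < x -> is_derive x (1 : R) F (x `^ (a * n.+1%:R - 1) * expR (- (x `^ a))).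
  move=> x0.
  have h := @is_derive1_comp R (gamma_tail n) (@powR R ^~ a) x _ _
    (is_derive_gamma_tail n (x `^ a)) (is_derive1_powR a x0).
  apply: (is_derive_eq (is_deriveZ (- (n`!%:R / a)) h)).
  have -> : x `^ (a * n.+1%:R - 1) = (x `^ a) ^+ n * x `^ (a - 1).
    rewrite -powR_mulrn ?powR_ge0// -powRrM -powRD; last by rewrite (gt_eqF x0) implybT.
    by congr (_ `^ _); rewrite -natr1; ring.
  rewrite /GRing.scale/=; field.
  by rewrite fn0 gt_eqF.
have gt0 : gamma_tail n 0 = 1.
  rewrite /gamma_tail oppr0 expR0 mul1r big_ord_recl/= big1 ?addr0 ?expr0 ?divr1// => i _.
  by rewrite exprS mul0r mul0r.
rewrite (@improper_FTC_y _ _ F (- (n`!%:R / a)) _ _ _ _ 0).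
- by rewrite sub0r opprK.
- by move=> x x0; exact: continuous_stretched.
- by move=> x x0; rewrite mulr_ge0 ?powR_ge0// expR_ge0.
- rewrite /F -[X in _ --> X]mulr1 -gt0; apply: cvgM; first exact: cvg_cst.
  apply: (@cvg_comp _ _ _ (@powR R ^~ a) (gamma_tail n) _ (nbhs (0 : R))).
    exact: powR_cvg0.
  apply: differentiable_continuous; apply/derivable1_diffP.
  by apply: ex_derive; exact: is_derive_gamma_tail.
- rewrite /F -[X in _ --> X](mulr0 (- (n`!%:R / a))); apply: cvgM; first exact: cvg_cst.
  apply: (@cvg_comp _ _ _ (@powR R ^~ a) (gamma_tail n)); last exact: cvg_gamma_tail.
  exact: cvg_powRy.
Qed.

Lemma gamma_integrand_ge0 (s x : R) : 0 <= x `^ (s - 1) * expR (- x).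
Proof. by rewrite mulr_ge0 ?powR_ge0 ?expR_ge0. Qed.

Lemma measurable_gamma_integrand (s c : R) (D : set R) :
  measurable_fun D (fun x : R => x `^ (s - 1) * expR (- (c * x))).
Proof.
apply: measurable_funTS; apply: measurable_funM; first exact: measurable_powR.
by apply: measurableT_comp => //; apply: measurableT_comp => //; exact: measurable_funM.
Qed.

(** For x <= 1 the integrand is at most e x^(s - 1) exp(- x^s), and for x > 1 at most x^n exp(- x)
    with n = floor(s); both majorants are stretched exponentials. *)
Lemma gamma_integral_lty (s : R) : 0 < s ->
  (\int[leb]_(x in `]0%R, +oo[) (x `^ (s - 1) * expR (- x))%:E < +oo)%E.
Proof.
move=> s0; pose n := Num.truncn s.
have sn : s < n.+1%:R by have /andP[] := truncn_itv (ltW s0).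
apply: (@le_lt_trans _ _ (\int[leb]_(x in `]0%R, +oo[)
   ((expR 1)%:E * (x `^ (s * 1%:R - 1) * expR (- (x `^ s)))%:E +
   (x `^ (1 * n.+1%:R - 1) * expR (- (x `^ 1)))%:E))%E).
  apply: ge0_le_integral => //.
  - by move=> x _; rewrite lee_fin gamma_integrand_ge0.
  - apply/measurable_EFinP.
    apply: eq_measurable_fun (measurable_gamma_integrand s 1 (D := `]0, +oo[)).
    by move=> x _; rewrite mul1r.
  - apply/measurable_EFinP; apply: measurable_funTS; apply: measurable_funD.
      apply: measurable_funM => //; apply: measurable_funM => //.
      by apply: measurableT_comp => //; apply: measurableT_comp.
    apply: measurable_funM => //.
    by apply: measurableT_comp => //; apply: measurableT_comp.
  move=> x /=; rewrite in_itv/= andbT => x0; rewrite -EFinM -EFinD lee_fin mulr1 mul1r powRr1 ?(ltW x0)//.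
  have [x1|x1] := leP x 1.
    rewrite (le_trans (_ : _ <= expR 1 * (x `^ (s - 1) * expR (- x `^ s))))//; last first.
      by rewrite lerDl mulr_ge0 ?powR_ge0 ?expR_ge0.
    rewrite mulrCA ler_wpM2l ?powR_ge0// -expRD ler_expR.
    have e1 : (1 : R) `^ s = 1 by rewrite powR1.
    have xs : x `^ s <= 1 by rewrite -[leRHS]e1 ge0_ler_powR ?nnegrE// ltW.
    by lra.
  rewrite (le_trans (_ : _ <= (x `^ (n.+1%:R - 1) * expR (- x))))//; last first.
    by rewrite lerDr !mulr_ge0 ?powR_ge0 ?expR_ge0.
  rewrite ler_wpM2r ?expR_ge0//; apply: ler_powR; first exact: ltW.
  by rewrite lerB// ltW.
have mst (p a : R) (D : set R) : measurable_fun D (fun x : R => (x `^ p * expR (- (x `^ a)))%:E).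
  apply/measurable_EFinP; apply: measurable_funTS; apply: measurable_funM => //.
  by apply: measurableT_comp => //; apply: measurableT_comp.
have st0 (p a x : R) : (0 <= (x `^ p * expR (- (x `^ a)))%:E)%E.
  by rewrite lee_fin mulr_ge0 ?powR_ge0 ?expR_ge0.
rewrite ge0_integralD//; last 3 first.
- by move=> x _; rewrite mule_ge0// lee_fin expR_ge0.
- by apply: emeasurable_funM => //; exact: mst.
- exact: mst.
rewrite ge0_integralZl//; last exact: mst.
by rewrite (integral_stretched_exponential 0 s0) integral_stretched_exponential// -EFinM -EFinD ltry.
Qed.

Lemma Gamma_integral (s : R) : 0 < s ->
  (\int[leb]_(x in `]0%R, +oo[) (x `^ (s - 1) * expR (- x))%:E = (Gamma s)%:E)%E.
Proof.
move=> s0; rewrite /Gamma /Rintegral fineK// ge0_fin_numE ?gamma_integral_lty//.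
by apply: integral_ge0 => x _; rewrite lee_fin gamma_integrand_ge0.
Qed.

Lemma preimage_scale_pos (c : R) : 0 < c ->
  [set x : R | `]0, +oo[%classic (c * x + 0)] = `]0, +oo[%classic.
Proof.
by move=> c0; apply/seteqP; split=> x /=; rewrite !in_itv/= !andbT addr0 pmulr_rgt0.
Qed.

Lemma Gamma_scaled (c s : R) : 0 < c -> 0 < s ->
  (\int[leb]_(x in `]0%R, +oo[) (x `^ (s - 1) * expR (- (c * x)))%:E =
   (c `^ (- s) * Gamma s)%:E)%E.
Proof.
move=> c0 s0; rewrite EFinM -Gamma_integral//.
have mg : measurable_fun (`]0, +oo[%classic : set R) (fun x : R => (x `^ (s - 1) * expR (- x))%:E).
  apply/measurable_EFinP.
  apply: eq_measurable_fun (measurable_gamma_integrand s 1 (D := `]0, +oo[)).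
  by move=> x _; rewrite mul1r.
rewrite (@ge0_integral_affine _ c 0 (fun x : R => (x `^ (s - 1) * expR (- x))%:E) _ c0)//; last first.
  by move=> x _; rewrite lee_fin gamma_integrand_ge0.
rewrite preimage_scale_pos// muleA -EFinM.
have -> : c `^ (- s) * c = c `^ (- (s - 1)).
  rewrite -{2}(powRr1 (ltW c0)) -powRD ?(gt_eqF c0) ?implybT//.
  by congr (_ `^ _); ring.
rewrite -ge0_integralZl//; last 3 first.
- apply/measurable_EFinP; apply: eq_measurable_fun (_ : measurable_fun _
    (fun x : R => c `^ (s - 1) * (x `^ (s - 1) * expR (- (c * x))))).
    move=> x; rewrite inE/= in_itv/= andbT => x0.
    by rewrite addr0 powRM ?ltW// mulrA.
  by apply: measurable_funM => //; exact: measurable_gamma_integrand.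
- by move=> x _; rewrite lee_fin gamma_integrand_ge0.
- by rewrite lee_fin powR_ge0.
apply: eq_integral => x; rewrite inE/= in_itv/= andbT => x0.
rewrite -EFinM; congr EFin; rewrite addr0 powRM ?ltW// powRN.
by field; rewrite gt_eqF// powR_gt0.
Qed.

End gamma_integrals.

(** * The Beta integral; growth and positivity of Gamma *)

Section beta_integral.
Context {R : realType}.
Local Notation leb := (@lebesgue_measure R).

Definition beta_integral (a b t : R) : \bar R :=
  (\int[leb]_(s in `]0%R, t[) ((t - s) `^ (a - 1) * s `^ (b - 1))%:E)%E.

Lemma beta_integrand_ge0 (a b t s : R) : 0 <= (t - s) `^ (a - 1) * s `^ (b - 1).
Proof. by rewrite mulr_ge0 ?powR_ge0. Qed.

Lemma measurable_beta_integrand (a b t : R) (D : set R) :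
  measurable_fun D (fun s : R => (t - s) `^ (a - 1) * s `^ (b - 1)).
Proof.
apply: measurable_funTS; apply: measurable_funM; last exact: measurable_powR.
by apply: (measurableT_comp (measurable_powR (a - 1))) => //; exact: measurable_funB.
Qed.

Lemma beta_integral_scale (a b t : R) : 0 < t ->
  beta_integral a b t = ((t `^ (a + b - 1))%:E * beta_integral a b 1)%E.
Proof.
move=> t0; rewrite /beta_integral.
pose f (s : R) := ((t - s) `^ (a - 1) * s `^ (b - 1))%:E.
have mf D : measurable_fun D f.
  by apply/measurable_EFinP; exact: measurable_beta_integrand.
have f0 s : (0 <= f s)%E by rewrite lee_fin beta_integrand_ge0.
rewrite -/f (@ge0_integral_affine _ t 0 f `]0, t[ t0 (measurable_itv _) (mf _) (fun s _ => f0 s)).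
rewrite (_ : [set x | _] = `]0, 1[%classic); last first.
  have tx x : (t * x < t) = (x < 1) by rewrite -[X in _ < X]mulr1 ltr_pM2l.
  by apply/seteqP; split=> x /=; rewrite !in_itv/= addr0 pmulr_rgt0// tx.
have -> : t `^ (a + b - 1) = t * (t `^ (a - 1) * t `^ (b - 1)).
  rewrite -{2}(powRr1 (ltW t0)) -!powRD ?(gt_eqF t0) ?implybT//.
  by congr (_ `^ _); ring.
rewrite [in RHS]EFinM -muleA; congr (_ * _)%E.
rewrite -ge0_integralZl//; last 3 first.
- by apply/measurable_EFinP; exact: measurable_beta_integrand.
- by move=> x _; rewrite lee_fin beta_integrand_ge0.
- by rewrite lee_fin mulr_ge0 ?powR_ge0.
apply: eq_integral => x; rewrite inE/= in_itv/= => /andP[x0 x1].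
rewrite -EFinM; congr EFin; rewrite addr0.
have -> : t - t * x = t * (1 - x) by ring.
rewrite !powRM ?ltW// ?subr_gt0//; ring.
Qed.

(** Tonelli on the region 0 < s < t: integrating over t first yields the product of Gammas, over s
    first a scaled Beta integral. It is stated as a product, not a quotient, because positivity of
    Gamma is deduced from it through [GammaS]. *)
Lemma Gamma_mul_beta (a b : R) : 0 < a -> 0 < b ->
  ((Gamma a * Gamma b)%:E = (Gamma (a + b))%:E * beta_integral a b 1)%E.
Proof.
move=> a0 b0.
pose f (p : R * R) : \bar R := if (0 < p.1) && (p.1 < p.2) then
  ((p.2 - p.1) `^ (a - 1) * p.1 `^ (b - 1) * expR (- p.2))%:E else 0%E.
have f0 p : (0 <= f p)%E.
  rewrite /f; case: ifP => // _.
  by rewrite lee_fin !mulr_ge0 ?powR_ge0 ?expR_ge0.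
have mf : measurable_fun setT f.
  apply: measurable_fun_ifT => //.
    apply: measurable_and; apply: measurable_fun_ltr => //.
  apply/measurable_EFinP; apply: measurable_funM.
    apply: measurable_funM.
      by apply: (measurableT_comp (measurable_powR (a - 1))) => //; exact: measurable_funB.
    exact: (measurableT_comp (measurable_powR (b - 1))).
  by apply: measurableT_comp => //; exact: measurableT_comp.
have := @fubini_tonelli _ _ (measurableTypeR R) (measurableTypeR R) R leb leb f mf f0.
have -> : (\int[leb]_x \int[leb]_y f (x, y) = (Gamma a * Gamma b)%:E)%E.
  rewrite EFinM -[in RHS](Gamma_integral b0) -ge0_integralZl//; last 3 first.
  - apply/measurable_EFinP.
    apply: eq_measurable_fun (measurable_gamma_integrand b 1 (D := _)).
    by move=> x _; rewrite mul1r.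
  - by move=> x _; rewrite lee_fin gamma_integrand_ge0.
  - by rewrite -Gamma_integral//; apply: integral_ge0 => x _; rewrite lee_fin gamma_integrand_ge0.
  rewrite [RHS]integral_mkcond; apply: eq_integral => s _; rewrite patchE.
  case: ifPn => [|]; last first.
    rewrite notin_setE/= in_itv/= andbT => /negP s0.
    by rewrite integral0_eq// => t _; rewrite /f/= (negbTE s0).
  rewrite inE/= in_itv/= andbT => s0.
  transitivity (\int[leb]_(t in `]s, +oo[)
     ((t - s) `^ (a - 1) * s `^ (b - 1) * expR (- t))%:E)%E.
    rewrite [RHS]integral_mkcond; apply: eq_integral => t _; rewrite patchE /f/= s0/=.
    case: ifPn => st; first by rewrite mem_set//= in_itv/= st.
    by rewrite memNset//= in_itv/= andbT; exact/negP.
  rewrite (@ge0_integral_affine _ 1 s (fun t : R =>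
    ((t - s) `^ (a - 1) * s `^ (b - 1) * expR (- t))%:E) _ ltr01)//; last 2 first.
  - apply/measurable_EFinP; apply: measurable_funTS; apply: measurable_funM.
      apply: measurable_funM => //.
      by apply: (measurableT_comp (measurable_powR (a - 1))) => //; exact: measurable_funB.
    by apply: measurableT_comp.
  - by move=> x _; rewrite lee_fin !mulr_ge0 ?powR_ge0 ?expR_ge0.
  rewrite mul1e (_ : [set x | _] = `]0, +oo[%classic); last first.
    by apply/seteqP; split=> x /=; rewrite !in_itv/= !andbT mul1r ltrDr.
  rewrite -[in RHS](Gamma_integral a0) -ge0_integralZr//; last 3 first.
  - apply/measurable_EFinP.
    apply: eq_measurable_fun (measurable_gamma_integrand a 1 (D := _)).
    by move=> x _; rewrite mul1r.
  - by move=> x _; rewrite lee_fin gamma_integrand_ge0.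
  - by rewrite lee_fin gamma_integrand_ge0.
  apply: eq_integral => x _; rewrite -EFinM; congr EFin.
  by rewrite mul1r addrK opprD expRD; ring.
move=> ->.
rewrite -Gamma_integral ?addr_gt0// -ge0_integralZr//; last 3 first.
- apply/measurable_EFinP.
  apply: eq_measurable_fun (measurable_gamma_integrand (a + b) 1 (D := _)).
  by move=> x _; rewrite mul1r.
- by move=> x _; rewrite lee_fin gamma_integrand_ge0.
- by apply: integral_ge0 => x _; rewrite lee_fin beta_integrand_ge0.
rewrite [RHS]integral_mkcond; apply: eq_integral => t _; rewrite patchE.
case: ifPn => [|]; last first.
  rewrite notin_setE/= in_itv/= andbT => /negP t0.
  rewrite integral0_eq// => s _; rewrite /f/=; case: ifP => // /andP[s0 st].
  by move: t0; rewrite (lt_trans s0 st).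
rewrite inE/= in_itv/= andbT => t0.
rewrite EFinM muleAC -beta_integral_scale// /beta_integral -ge0_integralZr//; last 2 first.
- by apply/measurable_EFinP; exact: measurable_beta_integrand.
- by move=> x _; rewrite lee_fin beta_integrand_ge0.
rewrite [RHS]integral_mkcond; apply: eq_integral => s _; rewrite patchE /f/=.
case: ifPn => st; first by rewrite mem_set//= in_itv/= st.
by rewrite memNset//= in_itv/=; exact/negP.
Qed.

Lemma Gamma1 : Gamma 1 = 1 :> R.
Proof.
have := @integral_stretched_exponential R 1 0 ltr01.
rewrite divr1 mulr1 => h; apply: EFin_inj; rewrite -(Gamma_integral ltr01) -[RHS]h.
by apply: eq_integral => x; rewrite inE/= in_itv/= andbT => x0; rewrite powRr1 ?ltW.
Qed.

Lemma beta_integral1 (b : R) : 0 < b -> beta_integral 1 b 1 = (b^-1)%:E.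
Proof.
move=> b0; rewrite /beta_integral integral_itv_bndo_bndc//; last first.
  by apply/measurable_EFinP; exact: measurable_beta_integrand.
pose F (x : R) := b^-1 * x `^ b.
transitivity (\int[leb]_(x in `]0%R, 1%R]) (x `^ (b - 1))%:E)%E.
  by apply: eq_integral => x _; rewrite subrr powRr0 mul1r.
have dF (x : R) : 0 < x -> is_derive x (1 : R) F (x `^ (b - 1)).
  move=> x0; apply: (is_derive_eq (is_deriveZ b^-1 (is_derive1_powR b x0))).
  by rewrite /GRing.scale/= mulKf ?gt_eqF.
have F0 : F x @[x --> 0^'+] --> (0 : R).
  rewrite /F -[X in _ --> X](mulr0 b^-1); apply: cvgM; first exact: cvg_cst.
  exact: powR_cvg0.
have := improper_FTC_itv dF (@continuous_powR_pos _ (b - 1)) _ F0 ltr01.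
move=> /(_ (fun x _ => powR_ge0 x (b - 1))) ->.
by rewrite /F powR1 mulr1 subr0.
Qed.

(** The integral is restricted to [M, 2 M]. Since M is free, Gamma outgrows every geometric
    sequence; M = 1 gives positivity. *)
Lemma Gamma_ge (s M : R) : 1 <= s -> 0 < M -> expR (- (2 * M)) * M `^ s <= Gamma s.
Proof.
move=> s1 M0; have s0 : 0 < s by rewrite (lt_le_trans ltr01).
rewrite -lee_fin -Gamma_integral//.
apply: (@le_trans _ _ (\int[leb]_(x in `[M, (2 * M)%R]) (expR (- (2 * M)) * M `^ (s - 1))%:E)%E).
  rewrite integral_cst//= lebesgue_measure_itv/= lte_fin.
  have -> : M < 2 * M by rewrite mulr_natl mulr2n ltrDl.
  rewrite -EFinB -EFinM lee_fin -mulrA ler_wpM2l ?expR_ge0//.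
  have -> : 2 * M - M = M `^ 1 by rewrite powRr1 ?ltW//; ring.
  by rewrite -powRD ?subrK// (gt_eqF M0) implybT.
apply: (@le_trans _ _ (\int[leb]_(x in `[M, (2 * M)%R]) (x `^ (s - 1) * expR (- x))%:E)%E).
  apply: ge0_le_integral => //.
  - by move=> x _; rewrite lee_fin mulr_ge0 ?powR_ge0 ?expR_ge0.
  - apply/measurable_EFinP.
    apply: eq_measurable_fun (measurable_gamma_integrand s 1 (D := _)).
    by move=> x _; rewrite mul1r.
  - move=> x /=; rewrite in_itv/= => /andP[Mx xM]; rewrite lee_fin mulrC.
    rewrite ler_pM ?powR_ge0 ?expR_ge0 ?ler_expR ?lerN2//.
    apply: ge0_ler_powR; rewrite ?nnegrE ?subr_ge0// ltW//.
    exact: lt_le_trans M0 Mx.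
apply: ge0_subset_integral => //.
- apply/measurable_EFinP.
  apply: eq_measurable_fun (measurable_gamma_integrand s 1 (D := _)).
  by move=> x _; rewrite mul1r.
- by move=> x _; rewrite lee_fin gamma_integrand_ge0.
- by move=> x /=; rewrite !in_itv/= andbT => /andP[Mx _]; exact: lt_le_trans M0 Mx.
Qed.

(** The Beta integral with first parameter 1 takes the place of an integration by parts. *)
Lemma GammaS (s : R) : 0 < s -> Gamma (s + 1) = s * Gamma s.
Proof.
move=> s0; have := Gamma_mul_beta ltr01 s0.
rewrite beta_integral1// -EFinM => -[]; rewrite Gamma1 mul1r addrC => ->.
by rewrite mulrCA mulfV ?mulr1// gt_eqF.
Qed.

Lemma Gamma_gt0 (s : R) : 0 < s -> 0 < Gamma s.
Proof.
move=> s0; rewrite -(pmulr_rgt0 _ s0) -GammaS//.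
have s1 : 1 <= s + 1 by rewrite lerDr ltW.
by apply: lt_le_trans (Gamma_ge s1 ltr01); rewrite mulr_gt0 ?expR_gt0 ?powR_gt0.
Qed.

Lemma beta_integralE (a b t : R) : 0 < a -> 0 < b -> 0 < t ->
  beta_integral a b t = (t `^ (a + b - 1) * (Gamma a * Gamma b / Gamma (a + b)))%:E.
Proof.
move=> a0 b0 t0; rewrite beta_integral_scale// EFinM; congr (_ * _)%E.
have G0 : 0 < Gamma (a + b) by rewrite Gamma_gt0// addr_gt0.
have := Gamma_mul_beta a0 b0; case: beta_integral => [r||].
- by rewrite -EFinM => -[->]; rewrite mulrC mulKf ?gt_eqF.
- by rewrite gt0_muley ?lte_fin.
- by rewrite gt0_muleNy ?lte_fin.
Qed.

Lemma Gamma_addn (s : R) n : 0 < s -> Gamma (s + n%:R) = Gamma s * \prod_(i < n) (s + i%:R).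
Proof.
move=> s0; elim: n => [|n IH]; first by rewrite big_ord0 mulr1 addr0.
rewrite big_ord_recr/= mulrA -IH -natr1 addrA GammaS ?ltr_wpDr//.
by rewrite mulrC.
Qed.

End beta_integral.

(** * Riemann-Liouville derivatives *)

Section binomial_coefficients.
Context {R : realType}.

Lemma binom_coefSr (s : R) j : binom_coef s j.+1 = (j%:R - s) / j.+1%:R * binom_coef s j.
Proof.
rewrite /binom_coef /gbinom big_ord_recr/= exprS factS natrM; set p := \prod_(i < j) _.
have f0 : j`!%:R != 0 :> R by rewrite pnatr_eq0 -lt0n fact_gt0.
by field; rewrite f0 /= addrC natr1 pnatr_eq0.
Qed.

(** On coefficients, (1 - u)^(s + 1) = (1 - u) (1 - u)^s. *)
Lemma binom_coef_pascal (s : R) j :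
  binom_coef (s + 1) j.+1 = binom_coef s j.+1 - binom_coef s j.
Proof.
rewrite binom_coefS addrK binom_coefSr -natr1; field.
by rewrite natr1 pnatr_eq0.
Qed.

Lemma binom_coefN (k : R) j : binom_coef (- k) j = (\prod_(i < j) (k + i%:R)) / j`!%:R.
Proof.
rewrite /binom_coef /gbinom mulrA; congr (_ / _).
elim: j => [|j IH]; first by rewrite !big_ord0 expr0 mulr1.
rewrite !big_ord_recr/= -IH exprS; ring.
Qed.

End binomial_coefficients.

(** * Fractional integrals and derivatives of exponential polynomials *)

Section exponential_polynomials.
Context {R : realType}.
Local Notation leb := (@lebesgue_measure R).
Variable gam : R.
Hypothesis gam0 : 0 < gam.

Definition exp_poly (j : nat) (t : R) : R := expR (- (gam * t)) * ((gam * t) ^+ j / j`!%:R).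

Lemma exp_poly_ge0 j t : 0 <= t -> 0 <= exp_poly j t.
Proof.
by move=> t0; rewrite mulr_ge0 ?expR_ge0// divr_ge0// exprn_ge0// mulr_ge0// ltW.
Qed.

Lemma measurable_exp_poly j : measurable_fun setT (exp_poly j).
Proof.
apply: measurable_funM.
  by apply: measurableT_comp => //; apply: measurableT_comp => //; exact: measurable_funM.
by apply: measurable_funM => //; apply: measurable_funX; exact: measurable_funM.
Qed.

Lemma expands_exp_poly (t : R) : 0 < t ->
  expands (fun y => expR (- (gam * t * (1 - y)))) (fun j => exp_poly j t).
Proof.
move=> t0; set z := gam * t; have z0 : 0 < z by rewrite mulr_gt0.
have dE (u : R) : u < 1 -> is_derive u (1 : R) (fun y => expR (z * y)) (z * expR (z * u)).
  move=> _.
  have h := @is_derive1_comp R expR (fun y => z * y) u _ _ (is_derive_expR (z * u))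
    (is_deriveZ z (is_derive_id u (1 : R))).
  by apply: (is_derive_eq h); rewrite /GRing.scale/= mulr1 mulrC.
have e : expands (fun y => expR (z * y)) (fun j => z ^+ j / j`!%:R).
  elim=> [|n IH].
    exists (expR z); first exact: expR_ge0.
    near=> u; rewrite big_ord0 subr0 mulr1 ger0_norm ?expR_ge0// ler_expR.
    rewrite ger_pMr//; apply/ltW; near: u; exact: near0_lt1.
  apply: eq_expands_upto (expands_upto_integrate dE (expands_uptoZ z IH)).
    exact: nearW.
  case=> [|k] _; first by rewrite mulr0 expR0 expr0 divr1.
  by rewrite factS natrM exprS invfM; ring.
apply: eq_expands (expandsZ (expR (- z)) e).
by apply: nearW => u; rewrite -expRD; congr expR; ring.
Unshelve. all: by end_near. Qed.

(** The convolution property of Poisson weights, by the binomial theorem. It separates x from t in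
    an integral over s = x + t. *)
Lemma exp_polyD j (s t : R) :
  exp_poly j (s + t) = \sum_(l < j.+1) exp_poly l s * exp_poly (j - l) t.
Proof.
rewrite /exp_poly mulrDr opprD expRD [gam * s + _]addrC exprDn mulr_suml mulr_sumr.
apply: eq_bigr => l _.
have h : (j`!%:R = 'C(j, l)%:R * (l`!%:R * (j - l)`!%:R) :> R).
  by rewrite -!natrM bin_fact// -ltnS.
have f0 n : n`!%:R != 0 :> R by rewrite pnatr_eq0 -lt0n fact_gt0.
have C0 : 'C(j, l)%:R != 0 :> R by rewrite pnatr_eq0 -lt0n bin_gt0 -ltnS.
rewrite h -mulr_natl; field.
by rewrite C0 !f0.
Qed.

Definition pred_exp_poly (j : nat) (t : R) : R := if j is j'.+1 then exp_poly j' t else 0.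

Lemma is_derive_exp_poly j (t : R) :
  is_derive t (1 : R) (exp_poly j)
    (- gam * (exp_poly j t - pred_exp_poly j t)).
Proof.
have dexp : is_derive t (1 : R) (fun t => expR (- (gam * t))) (- gam * expR (- (gam * t))).
  have h := @is_derive1_comp R (fun y => expR (- y)) (fun t => gam * t) t _ _
    (is_derive_expRN (gam * t)) (is_deriveZ gam (is_derive_id t (1 : R))).
  by apply: (is_derive_eq h); rewrite /GRing.scale/= mulr1; ring.
case: j => [|j].
  rewrite (_ : exp_poly 0 = fun t => expR (- (gam * t))); last first.
    by apply/funext => x; rewrite /exp_poly expr0 divr1 mulr1.
  by apply: (is_derive_eq dexp); rewrite subr0.
rewrite (_ : exp_poly j.+1 = (fun t => expR (- (gam * t))) *
    (fun t => gam ^+ j.+1 / j.+1`!%:R * t ^+ j.+1)); last first.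
  by apply/funext => x; rewrite /exp_poly !fctE exprMn; congr (_ * _); ring.
apply: (is_derive_eq (is_deriveM dexp (is_derive_monomial (gam ^+ j.+1 / j.+1`!%:R) j t))).
have f0 n : n`!%:R != 0 :> R by rewrite pnatr_eq0 -lt0n fact_gt0.
rewrite !fctE /GRing.scale/= /exp_poly !exprMn !exprS factS natrM; field.
by rewrite f0 /= addrC natr1 pnatr_eq0.
Qed.

(* The operator [(- d/dt) ^ s] acts on [exp_poly] as [gam ^ s (1 - shift) ^ s]; this
   is the series in powers of the shift, without the factor [gam ^ s]. *)
Definition exp_poly_power (N : nat) (a : nat -> R) (s t : R) : R :=
  \sum_(j < N) a j * shifted_sum (binom_coef s) exp_poly j t.

(** A derivative multiplies by - gam (1 - shift), and by Pascal's rule the factor 1 - shift raises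
    the exponent [s] by one. *)
Lemma is_derive_shifted_sum (s : R) j (t : R) :
  is_derive t (1 : R) (shifted_sum (binom_coef s) exp_poly j)
    (- gam * shifted_sum (binom_coef (s + 1)) exp_poly j t).
Proof.
rewrite (_ : shifted_sum _ _ j = \sum_(l < j.+1) (fun t => binom_coef s l * exp_poly (j - l)%N t)); last first.
  by apply/funext => x; rewrite fct_sumE.
have h (l : 'I_j.+1) : is_derive t (1 : R) (fun t => binom_coef s l * exp_poly (j - l)%N t) _ :=
  is_deriveZ (binom_coef s l) (is_derive_exp_poly (j - l) t).
apply: (is_derive_eq (is_derive_sum h)).
rewrite /shifted_sum [in RHS]big_ord_recl/= !binom_coef0 subn0.
under [in RHS]eq_bigr => i _ do rewrite /bump/= add1n binom_coef_pascal.
rewrite (eq_bigr (fun l : 'I_j.+1 => - gam * (binom_coef s l * exp_poly (j - l)%N t)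
  - (- gam) * (binom_coef s l * pred_exp_poly (j - l) t))); last first.
  move=> l _; rewrite /GRing.scale/=; ring.
rewrite sumrB -!mulr_sumr -mulrBr; congr (_ * _).
rewrite big_ord_recl/= binom_coef0 subn0 -addrA; congr (_ + _).
rewrite [X in _ - X]big_ord_recr/= subnn /pred_exp_poly mulr0 addr0 -sumrB.
apply: eq_bigr => i _; rewrite /bump/= add1n mulrBl; congr (_ - _ * _).
have : (0 < j - i)%N by rewrite subn_gt0.
by rewrite subnS; case: (j - i)%N.
Qed.

Lemma is_derive_exp_poly_power N a (s t : R) :
  is_derive t (1 : R) (exp_poly_power N a s) (- gam * exp_poly_power N a (s + 1) t).
Proof.
rewrite (_ : exp_poly_power N a s = \sum_(j < N) (fun t => a j * shifted_sum (binom_coef s) exp_poly j t)); last first.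
  by apply/funext => x; rewrite fct_sumE.
have h (j : 'I_N) : is_derive t (1 : R) (fun t => a j * shifted_sum (binom_coef s) exp_poly j t) _ :=
  is_deriveZ (a j) (is_derive_shifted_sum s j t).
apply: (is_derive_eq (is_derive_sum h)).
rewrite /exp_poly_power mulr_sumr; apply: eq_bigr => j _.
by rewrite /GRing.scale/= mulrCA.
Qed.

(** A Gamma integral at k + l, where Gamma(k + l) / l! is Gamma(k) times the coefficient of u^l in
    (1 - u)^(- k). *)
Lemma integral_exp_poly (k : R) l : 0 < k ->
  (\int[leb]_(x in `]0%R, +oo[) (exp_poly l x * x `^ (k - 1))%:E =
   (gam `^ (- k) * Gamma k * binom_coef (- k) l)%:E)%E.
Proof.
move=> k0.
have -> : (\int[leb]_(x in `]0%R, +oo[) (exp_poly l x * x `^ (k - 1))%:E =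
   \int[leb]_(x in `]0%R, +oo[) ((gam ^+ l / l`!%:R)%:E *
     (x `^ (k + l%:R - 1) * expR (- (gam * x)))%:E))%E.
  apply: eq_integral => x; rewrite inE/= in_itv/= andbT => x0.
  have -> : x `^ (k + l%:R - 1) = x `^ (k - 1) * x ^+ l.
    rewrite -powR_mulrn ?ltW// -powRD ?(gt_eqF x0) ?implybT//.
    by congr (_ `^ _); ring.
  by rewrite -EFinM; congr EFin; rewrite /exp_poly exprMn; ring.
rewrite ge0_integralZl//; last 3 first.
- by apply/measurable_EFinP; exact: measurable_gamma_integrand.
- by move=> x _; rewrite lee_fin mulr_ge0 ?powR_ge0 ?expR_ge0.
- by rewrite lee_fin divr_ge0// exprn_ge0// ltW.
rewrite Gamma_scaled//; last by rewrite ltr_wpDr.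
rewrite -EFinM Gamma_addn// binom_coefN; congr EFin.
rewrite opprD powRD ?(gt_eqF gam0) ?implybT// powRN [_ `^ (- _)]powRN powR_mulrn ?ltW//.
have f0 : l`!%:R != 0 :> R by rewrite pnatr_eq0 -lt0n fact_gt0.
by field; rewrite f0 expf_neq0 ?gt_eqF ?powR_gt0.
Qed.

(** Up to the factor Gamma(k), the right-sided fractional integral of order [k] acts as gam^(- k) (1
    - shift)^(- k). *)
Lemma integral_shifted_exp_poly (k : R) j (t : R) : 0 < k -> 0 < t ->
  (\int[leb]_(s in `]t, +oo[) (exp_poly j s * (s - t) `^ (k - 1))%:E =
   (gam `^ (- k) * Gamma k * shifted_sum (binom_coef (- k)) exp_poly j t)%:E)%E.
Proof.
move=> k0 t0.
rewrite (@ge0_integral_affine _ 1 t (fun s : R => (exp_poly j s * (s - t) `^ (k - 1))%:E) _ ltr01)//; last 2 first.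
- apply/measurable_EFinP; apply: measurable_funTS; apply: measurable_funM.
    exact: measurable_exp_poly.
  by apply: (measurableT_comp (measurable_powR (k - 1))) => //; exact: measurable_funB.
- move=> x /=; rewrite in_itv/= andbT => tx.
  by rewrite lee_fin mulr_ge0 ?powR_ge0// exp_poly_ge0// ltW// (lt_trans t0).
rewrite mul1e (_ : [set x | _] = `]0, +oo[%classic); last first.
  by apply/seteqP; split=> x /=; rewrite !in_itv/= !andbT mul1r ltrDr.
transitivity (\int[leb]_(x in `]0%R, +oo[) \sum_(l < j.+1)
    ((exp_poly (j - l) t)%:E * (exp_poly l x * x `^ (k - 1))%:E))%E.
  apply: eq_integral => x _; rewrite mul1r addrK exp_polyD mulr_suml -sumEFin.
  by apply: eq_bigr => l _; rewrite -EFinM; congr EFin; ring.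
have mm l : measurable_fun (`]0, +oo[%classic : set R) (fun x : R => (exp_poly l x * x `^ (k - 1))%:E).
  apply/measurable_EFinP; apply: measurable_funTS; apply: measurable_funM.
    exact: measurable_exp_poly.
  exact: measurable_powR.
have p0 l (x : R) : `]0, +oo[%classic x -> (0 <= (exp_poly l x * x `^ (k - 1))%:E)%E.
  rewrite /= in_itv/= andbT => x0; rewrite lee_fin mulr_ge0 ?powR_ge0//.
  by rewrite exp_poly_ge0// ltW.
rewrite ge0_integral_sum//; last 2 first.
- by move=> l; apply: emeasurable_funM; [exact: measurable_cst|exact: mm].
- by move=> l x x0; rewrite mule_ge0 ?p0// lee_fin exp_poly_ge0// ltW.
rewrite /shifted_sum mulr_sumr -sumEFin; apply: eq_bigr => l _.
rewrite ge0_integralZl//; last 3 first.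
- exact: mm.
- exact: p0.
- by rewrite lee_fin exp_poly_ge0// ltW.
by rewrite integral_exp_poly// -EFinM; congr EFin; ring.
Qed.

End exponential_polynomials.

Section riemann_liouville_exp_poly.
Context {R : realType}.
Local Notation leb := (@lebesgue_measure R).
Variables (gam nu : R).
Hypotheses (gam0 : 0 < gam) (nu0 : 0 <= nu).
Local Notation e := (exp_poly gam).
Local Notation m := (rl_order nu).
Let kap : R := m%:R - nu.

Let kap0 : 0 < kap.
Proof. by rewrite subr_gt0 /rl_order; have /andP[] := truncn_itv nu0. Qed.

Let ker (j : nat) (t s : R) : R := e j s * (s - t) `^ (kap - 1).

Lemma integrable_exp_poly_kernel j (t : R) : 0 < t ->
  leb.-integrable `]t, +oo[ (EFin \o ker j t).
Proof.
move=> t0; apply/integrableP; split.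
  apply/measurable_EFinP; apply: measurable_funTS; apply: measurable_funM.
    exact: measurable_exp_poly.
  by apply: (measurableT_comp (measurable_powR (kap - 1))) => //; exact: measurable_funB.
have -> : (\int[leb]_(x in `]t, +oo[) `|(EFin \o ker j t) x| =
    \int[leb]_(x in `]t, +oo[) (e j x * (x - t) `^ (kap - 1))%:E)%E.
  apply: eq_integral => s; rewrite inE/= in_itv/= andbT => ts.
  by rewrite ger0_norm// mulr_ge0 ?powR_ge0// exp_poly_ge0// ltW// (lt_trans t0).
by rewrite integral_shifted_exp_poly// ltry.
Qed.

Variables (N : nat) (a : nat -> R) (f : R -> R).
Hypothesis fE : forall t : R, 0 < t -> f t = \sum_(j < N) a j * e j t.

Let integrandE (t : R) : 0 < t -> {in `]t, +oo[%classic, forall s,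
  (rl_integrand nu f t s)%:E = (\sum_(j < N) (a j)%:E * (EFin \o ker j t) s)%E}.
Proof.
move=> t0 s; rewrite inE/= in_itv/= andbT => ts.
rewrite /rl_integrand fE; last exact: lt_trans ts.
have -> : nu - m%:R + 1 = - (kap - 1) by rewrite /kap; ring.
rewrite powRN invrK mulr_suml -sumEFin.
apply: eq_bigr => j _; rewrite /= /ker -EFinM; congr EFin; exact/esym/mulrA.
Qed.

Lemma integrable_rl_integrand (t : R) : 0 < t ->
  leb.-integrable `]t, +oo[ (EFin \o rl_integrand nu f t).
Proof.
move=> t0.
apply: (@eq_integrable _ _ _ leb `]t, +oo[%classic _
  (fun s => (\sum_(j < N) (a j)%:E * (EFin \o ker j t) s)%E)) => //.
  by move=> s ts; rewrite /= integrandE.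
apply: integrable_sum => // j _; apply: integrableZl => //.
exact: integrable_exp_poly_kernel.
Qed.

Lemma rl_integral_exp_poly (t : R) : 0 < t ->
  rl_integral nu f t = gam `^ (- kap) * Gamma kap * exp_poly_power gam N a (- kap) t.
Proof.
move=> t0; rewrite /rl_integral /Rintegral.
have -> : (\int[leb]_(s in `]t, +oo[) (rl_integrand nu f t s)%:E =
    \int[leb]_(s in `]t, +oo[) (\sum_(j < N) (a j)%:E * (EFin \o ker j t) s))%E.
  by apply: eq_integral => s ts; exact: integrandE.
rewrite integral_sum//; last first.
  by move=> j; apply: integrableZl => //; exact: integrable_exp_poly_kernel.
rewrite (eq_bigr (fun j : 'I_N => (a j * (gam `^ (- kap) * Gamma kap *
    shifted_sum (binom_coef (- kap)) e j t))%:E)); last first.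
  move=> j _; rewrite integralZl//; last exact: integrable_exp_poly_kernel.
  by rewrite integral_shifted_exp_poly.
by rewrite sumEFin/= /exp_poly_power mulr_sumr; apply: eq_bigr => j _; ring.
Qed.

(** The fractional integral has produced the exponent - kap, and each derivative adds one. The
    formulas hold for positive arguments, hence the passage through equality near the point. *)
Lemma derive1n_rl_integral i (t : R) : 0 < t ->
  derive1n i (rl_integral nu f) t =
  gam `^ (- kap) * Gamma kap * ((- gam) ^+ i * exp_poly_power gam N a (i%:R - kap) t) /\
  derivable (derive1n i (rl_integral nu f)) t 1.
Proof.
set K := gam `^ (- kap) * Gamma kap.
have dH s (x : R) : is_derive x (1 : R) (fun x => K * ((- gam) ^+ i * exp_poly_power gam N a s x))
    (K * ((- gam) ^+ i * (- gam * exp_poly_power gam N a (s + 1) x))).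
  exact: (is_deriveZ K (is_deriveZ ((- gam) ^+ i) (is_derive_exp_poly_power gam N a s x))).
have pos (x : R) : 0 < x -> \forall y \near x, 0 < y by exact: lt_nbhsr.
suff E (x : R) : 0 < x -> derive1n i (rl_integral nu f) x =
    K * ((- gam) ^+ i * exp_poly_power gam N a (i%:R - kap) x).
  move=> t0; split; first exact: E.
  apply: (@near_eq_derivable _ _ _ (fun x => K * ((- gam) ^+ i * exp_poly_power gam N a (i%:R - kap) x))).
    by near=> y; rewrite E//; near: y; exact: pos.
  by apply: ex_derive; exact: dH.
elim: i {dH} x => [|i IH] x x0.
  by rewrite /= expr0 mul1r sub0r rl_integral_exp_poly.
rewrite /= derive1E.
rewrite (@near_eq_derive _ _ _ _ (fun x => K * ((- gam) ^+ i * exp_poly_power gam N a (i%:R - kap) x))).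
  have h := is_deriveZ K (is_deriveZ ((- gam) ^+ i)
    (is_derive_exp_poly_power gam N a (i%:R - kap) x)).
  apply: etrans (@derive_val _ _ _ _ _ _ _ h) _.
  have -> : i.+1%:R - kap = i%:R - kap + 1 by rewrite -natr1; ring.
  by rewrite /GRing.scale/= exprSr; ring.
by near=> y; rewrite IH//; near: y; exact: pos.
Unshelve. all: by end_near. Qed.

(** After m derivatives the exponent is m - kap = nu; the sign (-1)^m cancels that of (- gam)^m, and
    gam^(m - kap) = gam^nu remains. *)
Lemma riemann_liouville_exp_poly :
  riemann_liouville_derivable nu f /\
  forall t : R, 0 < t -> riemann_liouville nu f t =
    \sum_(j < N) a j * shifted_sum (fun l => gam `^ nu * binom_coef nu l) e j t.
Proof.
split=> [t t0|t t0].
  by split=> [|i _]; [exact: integrable_rl_integrand|exact: (derive1n_rl_integral i t0).2].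
rewrite /riemann_liouville (derive1n_rl_integral _ t0).1 -/kap.
have -> : m%:R - kap = nu by rewrite /kap; ring.
have G0 : Gamma kap != 0 by rewrite gt_eqF// Gamma_gt0.
have -> : (Gamma kap)^-1 * ((-1) ^+ m * (gam `^ (- kap) * Gamma kap *
    ((- gam) ^+ m * exp_poly_power gam N a nu t))) =
    (gam `^ (- kap) * ((-1) ^+ m * (- gam) ^+ m)) * exp_poly_power gam N a nu t.
  by field.
rewrite -exprMn mulN1r opprK -powR_mulrn ?ltW// -powRD ?(gt_eqF gam0) ?implybT//.
have -> : - kap + m%:R = nu by rewrite /kap; ring.
rewrite /exp_poly_power mulr_sumr; apply: eq_bigr => j _.
rewrite mulrCA; congr (_ * _); rewrite /shifted_sum mulr_sumr.
by apply: eq_bigr => l _; rewrite mulrA.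
Qed.

End riemann_liouville_exp_poly.

(** * Caputo derivatives *)

Section entire_series.
Context {R : realType}.
Implicit Types (b : nat -> R) (x : R).

(** Equivalent to an infinite radius of convergence, in a form easily checked from Gamma bounds and
    stable under termwise differentiation. *)
Definition entire b := forall r : R, 0 < r -> exists C, forall n, `|b n| * r ^+ n <= C.

Lemma entire_normed_cvg b x : entire b -> cvgn [normed series (fun n => b n * x ^+ n)].
Proof.
(* Boundedness at more than twice the modulus of x dominates the terms at x by a geometric series of
   ratio 1 / 2. *)
move=> be; have r0 : 0 < 2 * (`|x| + 1) by rewrite mulr_gt0// ltr_wpDl.
have [C bC] := be _ r0.
apply: (@series_le_cvg _ _ (fun n => C * 2^-1 ^+ n)) => [n|n|n|].
- by rewrite /=.
- rewrite mulr_ge0 ?exprn_ge0//.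
  by rewrite (le_trans _ (bC 0%N))// mulr_ge0// expr0.
- rewrite /= normrM normrX exprVn ler_pdivlMr ?exprn_gt0//.
  apply: le_trans (bC n); rewrite -mulrA ler_wpM2l// exprMn mulrC ler_wpM2l ?exprn_ge0//.
  by rewrite lerXn2r ?nnegrE ?addr_ge0// lerDl.
- apply: is_cvg_geometric_series; rewrite ger0_norm ?invr_ge0//.
  by rewrite invf_lt1// ltr1n.
Qed.

Lemma entire_cvg b x : entire b -> cvgn (pseries b x).
Proof. by move=> be; apply: normed_cvg; exact: entire_normed_cvg. Qed.

Lemma entire_diffs b : entire b -> entire (pseries_diffs b).
Proof.
(* Doubling the radius absorbs the factor n + 1, which is at most 2^(n + 1). *)
move=> be r r0; have [|C bC] := be (2 * r); first by rewrite mulr_gt0.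
exists (C / r) => n; rewrite /pseries_diffs normrM normr_nat.
rewrite ler_pdivlMr//; apply: le_trans (bC n.+1).
have -> : n.+1%:R * `|b n.+1| * r ^+ n * r = `|b n.+1| * (n.+1%:R * r ^+ n.+1).
  by rewrite exprSr; ring.
rewrite ler_wpM2l// exprMn ler_wpM2r ?exprn_ge0 ?(ltW r0)//.
by rewrite -natrX ler_nat ltnW// ltn_expl.
Qed.

Lemma entire_abs b : entire b -> entire (fun n => `|b n|).
Proof. by move=> be r r0; have [C bC] := be r r0; exists C => n; rewrite normr_id. Qed.

Lemma is_derive_entire b x : entire b ->
  is_derive x (1 : R) (fun x => limn (pseries b x)) (limn (pseries (pseries_diffs b) x)).
Proof.
move=> be; apply: (@pseries_snd_diffs _ _ (`|x| + 1)).
- exact: entire_cvg.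
- exact/entire_cvg/entire_diffs.
- exact/entire_cvg/entire_diffs/entire_diffs.
- by rewrite [X in _ < X]ger0_norm ?addr_ge0// ltrDl.
Qed.

End entire_series.

(** * Power series in t^nu and their Caputo derivatives *)

Section fractional_series.
Context {R : realType}.
Local Notation leb := (@lebesgue_measure R).
Variable nu : R.
Hypothesis nu01 : 0 < nu < 1.
Implicit Types (al : nat -> R).

Let nu0 : 0 < nu. Proof. by case/andP: nu01. Qed.
Let nu1 : nu < 1. Proof. by case/andP: nu01. Qed.

(** A growth class closed under linear combinations and under dropping the first coefficient, hence
    under repeated Caputo derivatives. *)
Definition geometric_bounded al := exists C K, [/\ 0 <= C, 0 < K & forall n, `|al n| <= C * K ^+ n].

Definition ml_coef al (n : nat) : R := al n / Gamma (nu * n%:R + 1).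

(** For al_n = x^n this is the Mittag-Leffler function of index nu at x t^nu. *)
Definition frac_series al (t : R) : R := limn (pseries (ml_coef al) (t `^ nu)).

Lemma Gamma_arg_gt0 n : 0 < nu * n%:R + 1.
Proof. by rewrite ltr_wpDl// mulr_ge0// ltW. Qed.

Lemma entire_ml_coef al : geometric_bounded al -> entire (ml_coef al).
Proof.
move=> [C [K [C0 K0 alC]]] r r0.
(* Chosen so that M^nu = K r: the lower bound of [Gamma_ge] at nu n + 1 is then proportional to (K
   r)^n. *)
pose M := (K * r) `^ nu^-1; have M0 : 0 < M by rewrite powR_gt0// mulr_gt0.
have MK n : M `^ (nu * n%:R + 1) = (K * r) ^+ n * M.
  rewrite powRD ?(gt_eqF M0) ?implybT// powRr1 ?ltW//; congr (_ * _).
  rewrite /M -powRrM mulrA mulVf ?gt_eqF// mul1r powR_mulrn//.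
  by rewrite mulr_ge0// ltW.
exists (C * expR (2 * M) / M) => n.
have G1 : 1 <= nu * n%:R + 1 by rewrite lerDr mulr_ge0// ltW.
have := Gamma_ge G1 M0; rewrite MK => h.
have G0 : 0 < Gamma (nu * n%:R + 1) by rewrite Gamma_gt0// Gamma_arg_gt0.
rewrite /ml_coef normrM normfV (gtr0_norm G0) mulrAC ler_pdivrMr//.
apply: (@le_trans _ _ (C * K ^+ n * r ^+ n)).
  by rewrite ler_wpM2r ?alC// exprn_ge0// ltW.
apply: (@le_trans _ _ (C * expR (2 * M) / M * (expR (- (2 * M)) * ((K * r) ^+ n * M)))).
  rewrite expRN exprMn le_eqVlt; apply/orP; left; apply/eqP; field.
  by rewrite !gt_eqF ?expR_gt0.
by rewrite ler_wpM2l// divr_ge0 ?mulr_ge0 ?expR_ge0// ltW.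
Qed.

Lemma geometric_boundedS al : geometric_bounded al -> geometric_bounded (fun n => al n.+1).
Proof.
move=> [C [K [C0 K0 alC]]]; exists (C * K), K; split=> // [|n].
  by rewrite mulr_ge0// ltW.
by rewrite (le_trans (alC n.+1))// exprS mulrA.
Qed.

Lemma is_derive_frac_series al (t : R) : geometric_bounded al -> 0 < t ->
  is_derive t (1 : R) (frac_series al)
    (limn (pseries (pseries_diffs (ml_coef al)) (t `^ nu)) * (nu * t `^ (nu - 1))).
Proof.
move=> /entire_ml_coef be t0.
exact: (@is_derive1_comp R (fun x => limn (pseries (ml_coef al) x)) (@powR R ^~ nu) t _ _
  (is_derive_entire (t `^ nu) be) (is_derive1_powR nu t0)).
Qed.

Variables (al : nat -> R) (f : R -> R).
Hypothesis alb : geometric_bounded al.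
Hypothesis fE : forall t : R, 0 < t -> f t = frac_series al t.

Let b := pseries_diffs (ml_coef al).
Let be : entire b. Proof. exact/entire_diffs/entire_ml_coef. Qed.

Let derive1_f (s : R) : 0 < s -> derivable f s 1 /\
  derive1 f s = limn (pseries b (s `^ nu)) * (nu * s `^ (nu - 1)).
Proof.
move=> s0; have pos : \forall y \near s, 0 < y by exact: lt_nbhsr.
have ff : {near s, frac_series al =1 f}.
  by near=> y; rewrite fE//; near: y; exact: pos.
have h := is_derive_frac_series alb s0.
split.
  by apply: near_eq_derivable ff _; exact: ex_derive.
by rewrite derive1E -(@near_eq_derive _ _ _ (frac_series al) f s 1 ff); exact: derive_val.
Unshelve. all: by end_near. Qed.

Let g (t s : R) := (t - s) `^ (- nu) * s `^ (nu - 1).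
Let S n (s : R) := series (fun k => b k * (s `^ nu) ^+ k) n.

(** A Beta integral with parameters 1 - nu and nu (k + 1), which add up to nu k + 1. *)
Let beta_nu (t : R) k : 0 < t ->
  (\int[leb]_(s in `]0%R, t[) (g t s * (s `^ nu) ^+ k)%:E =
   (t `^ (nu * k%:R) * (Gamma (1 - nu) * Gamma (nu * k.+1%:R) / Gamma (nu * k%:R + 1)))%:E)%E.
Proof.
move=> t0.
have h := @beta_integralE R (1 - nu) (nu * k.+1%:R) t.
transitivity (beta_integral (1 - nu) (nu * k.+1%:R) t).
  apply: eq_integral => s; rewrite inE/= in_itv/= => /andP[s0 st]; congr EFin.
  rewrite /g -mulrA -powR_mulrn ?powR_ge0// -powRrM -powRD ?(gt_eqF s0) ?implybT//.
  by congr (_ `^ _ * _ `^ _); rewrite -?natr1; ring.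
have e : 1 - nu + nu * k.+1%:R = nu * k%:R + 1 by rewrite -natr1; ring.
have nk0 : 0 < nu * k.+1%:R by exact: mulr_gt0.
have n1 : 0 < 1 - nu by rewrite subr_gt0.
by rewrite (h n1 nk0 t0) e addrK.
Qed.

Let measurable_g (t : R) (k : nat) (D : set R) :
  measurable_fun D (fun s => g t s * (s `^ nu) ^+ k).
Proof.
apply: measurable_funTS; apply: measurable_funM.
  apply: measurable_funM => //.
  by apply: (measurableT_comp (measurable_powR (- nu))) => //; exact: measurable_funB.
by apply: measurable_funX; exact: measurable_powR.
Qed.

Let g0 (t s : R) k : 0 <= g t s * (s `^ nu) ^+ k.
Proof. by rewrite !mulr_ge0 ?exprn_ge0 ?powR_ge0. Qed.

Let integrable_g (t : R) k : 0 < t ->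
  leb.-integrable `]0, t[ (EFin \o (fun s => g t s * (s `^ nu) ^+ k)).
Proof.
move=> t0; apply/integrableP; split; first by apply/measurable_EFinP; exact: measurable_g.
apply: (@le_lt_trans _ _ (\int[leb]_(s in `]0%R, t[) (g t s * (s `^ nu) ^+ k)%:E)%E).
  by rewrite le_eqVlt; apply/orP; left; apply/eqP; apply: eq_integral => s _; rewrite /= ger0_norm.
by rewrite beta_nu// ltry.
Qed.

Let B (t : R) := limn (pseries (fun n => `|b n|) (t `^ nu)).

Let S_le (t s : R) n : 0 < s < t -> `|S n s| <= B t.
Proof.
move=> /andP[s0 st].
have st' : s `^ nu <= t `^ nu by apply: ge0_ler_powR; rewrite ?nnegrE// ltW// (lt_trans s0).
apply: (@le_trans _ _ (pseries (fun n => `|b n|) (t `^ nu) n)).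
  rewrite /S /pseries /series/= (le_trans (ler_norm_sum _ _ _))//.
  apply: ler_sum => k _; rewrite normrM ler_wpM2l// ger0_norm ?exprn_ge0 ?powR_ge0//.
  by rewrite lerXn2r ?nnegrE ?powR_ge0.
apply: nondecreasing_cvgn_le; last exact/entire_cvg/entire_abs.
apply/nondecreasing_seqP => k; rewrite /pseries /series/= big_nat_recr//= lerDl.
by rewrite mulr_ge0 ?exprn_ge0 ?powR_ge0.
Qed.

Let F_ (t : R) n (s : R) := nu * (g t s * S n s).

Let integrandE (t s : R) : 0 < s < t ->
  caputo_integrand nu f t s = nu * (g t s * limn (pseries b (s `^ nu))).
Proof.
move=> /andP[s0 st]; rewrite /caputo_integrand (derive1_f s0).2 /g; ring.
Qed.

Let F_cvg (t s : R) : 0 < s < t -> F_ t n s @[n --> \oo] --> caputo_integrand nu f t s.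
Proof.
move=> st; rewrite integrandE//; apply: cvgM; first exact: cvg_cst.
by apply: cvgM; [exact: cvg_cst|exact: entire_cvg].
Qed.

Let F_sum (t : R) n (s : R) : (F_ t n s)%:E =
  (\sum_(0 <= k < n) (nu * b k)%:E * (g t s * (s `^ nu) ^+ k)%:E)%E.
Proof.
rewrite /F_ /S /series/= mulr_sumr mulr_sumr -sumEFin.
by apply: eq_bigr => k _; rewrite -EFinM; congr EFin; ring.
Qed.

Let measurable_F (t : R) n (D : set R) : measurable_fun D (F_ t n).
Proof.
apply: measurable_funTS; apply: measurable_funM => //; apply: measurable_funM.
  apply: eq_measurable_fun (measurable_g t 0 (D := setT)) => s _.
  by rewrite expr0 mulr1.
rewrite /S /series/=; apply: measurable_sum => k; apply: measurable_funM => //.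
by apply: measurable_funX; exact: measurable_powR.
Qed.

(** Integral and series are exchanged by dominated convergence: on ]0, t[ the partial sums are
    bounded by [B t], and [g t] is integrable by the case k = 0 of [beta_nu]. *)
Let caputo_dct (t : R) : 0 < t ->
  leb.-integrable `]0, t[ (EFin \o caputo_integrand nu f t) /\
  (\int[leb]_(s in `]0%R, t[) (F_ t n s)%:E @[n --> \oo] -->
   \int[leb]_(s in `]0%R, t[) (caputo_integrand nu f t s)%:E)%E.
Proof.
move=> t0.
have cvgF s : `]0, t[%classic s -> (F_ t n s)%:E @[n --> \oo] --> (caputo_integrand nu f t s)%:E.
  rewrite /= in_itv/= => st; apply: cvg_EFin; first exact: nearW.
  exact: F_cvg.
have [] // := @dominated_convergence _ (measurableTypeR R) R leb `]0, t[%classic (measurable_itv _)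
    (fun n s => (F_ t n s)%:E) (EFin \o caputo_integrand nu f t)
    (fun s => ((nu * B t)%:E * (EFin \o (fun s => (g t s * (s `^ nu) ^+ 0)%R)) s)%E).
- by move=> n; apply/measurable_EFinP; exact: measurable_F.
- apply: (emeasurable_fun_cvg (fun n s => (F_ t n s)%:E)) => [n|s /cvgF//].
  by apply/measurable_EFinP; exact: measurable_F.
- exact: aeW.
- by apply: integrableZl => //; exact: integrable_g.
- apply: aeW => s n; rewrite /= in_itv/= => st; rewrite lee_fin /F_ expr0 mulr1.
  have gs : 0 <= g t s by have := g0 t s 0; rewrite expr0 mulr1.
  rewrite normrM (gtr0_norm nu0) normrM (ger0_norm gs) -[nu * B t * _]mulrA ler_wpM2l ?(ltW nu0)//.
  by rewrite mulrC ler_wpM2r// S_le.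
Qed.

(** The derivative kills the constant term, and the Beta integral turns t^(nu (k + 1)) / Gamma(nu (k
    + 1) + 1) into t^(nu k) / Gamma(nu k + 1): the Caputo derivative is the left shift of the
    coefficients. *)
Lemma caputo_frac_series :
  caputo_derivable nu f /\
  forall t : R, 0 < t -> caputo nu f t = frac_series (fun n => al n.+1) t.
Proof.
split=> t t0; first by split; [exact: (derive1_f t0).1|exact: (caputo_dct t0).1].
have G1 : 0 < Gamma (1 - nu) by rewrite Gamma_gt0// subr_gt0.
have := (caputo_dct t0).2.
have -> : (fun n => (\int[leb]_(s in `]0%R, t[) (F_ t n s)%:E)%E) = (fun n =>
    (Gamma (1 - nu) * pseries (ml_coef (fun n => al n.+1)) (t `^ nu) n)%:E).
  apply/funext => n; under eq_integral do rewrite F_sum.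
  rewrite integral_sum//; last by move=> k; apply: integrableZl => //; exact: integrable_g.
  rewrite /pseries /series/= mulr_sumr -sumEFin; apply: eq_bigr => k _.
  rewrite integralZl//; last exact: integrable_g.
  rewrite beta_nu// -EFinM; congr EFin.
  rewrite /b /pseries_diffs /ml_coef GammaS ?mulr_gt0//.
  have := Gamma_gt0 (mulr_gt0 nu0 (ltr0Sn R k)); have := Gamma_gt0 (Gamma_arg_gt0 k).
  rewrite -powR_mulrn ?powR_ge0// -powRrM.
  move: (Gamma (nu * k.+1%:R)) (Gamma (nu * k%:R + 1)) => x y y0 x0.
  by field; rewrite !gt_eqF.
move=> h1; rewrite /caputo /Rintegral.
have : (Gamma (1 - nu) * pseries (ml_coef (fun n => al n.+1)) (t `^ nu) n)%:E @[n --> \oo] -->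
    (Gamma (1 - nu) * frac_series (fun n => al n.+1) t)%:E.
  apply: cvg_EFin; first exact: nearW.
  apply: cvgM; first exact: cvg_cst.
  exact/entire_cvg/entire_ml_coef/geometric_boundedS.
move=> /(cvg_unique _ h1) -> //=.
by rewrite mulKf// gt_eqF.
Qed.

End fractional_series.

(** * The functions e_j of the Caputo case *)

Section fractional_series_algebra.
Context {R : realType}.
Variable nu : R.
Hypothesis nu01 : 0 < nu < 1.
Implicit Types (al be : nat -> R).
Local Notation fs := (frac_series nu).

Lemma frac_series_cvg al t : geometric_bounded al ->
  pseries (ml_coef nu al) (t `^ nu) n @[n --> \oo] --> fs al t.
Proof. by move=> ab; exact/entire_cvg/entire_ml_coef. Qed.

Lemma geometric_boundedD al be : geometric_bounded al -> geometric_bounded be ->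
  geometric_bounded (fun n => al n + be n).
Proof.
move=> [C [K [C0 K0 aC]]] [D [L [D0 L0 bD]]].
exists (C + D), (K + L); split=> [||n]; rewrite ?addr_ge0 ?addr_gt0//.
rewrite (le_trans (ler_normD _ _))// mulrDl lerD//.
  by rewrite (le_trans (aC n))// ler_wpM2l// lerXn2r ?nnegrE ?addr_ge0 ?lerDl// ltW.
by rewrite (le_trans (bD n))// ler_wpM2l// lerXn2r ?nnegrE ?addr_ge0 ?lerDr// ltW.
Qed.

Lemma geometric_boundedZ a al : geometric_bounded al -> geometric_bounded (fun n => a * al n).
Proof.
move=> [C [K [C0 K0 aC]]]; exists (`|a| * C), K; split=> // [|n].
  by rewrite mulr_ge0.
by rewrite normrM -mulrA ler_wpM2l.
Qed.

Lemma geometric_bounded0 : geometric_bounded (fun=> 0 : R).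
Proof. by exists 0, 1; split=> // n; rewrite normr0 mul0r. Qed.

Lemma geometric_bounded_sum N (a : nat -> R) (A : nat -> nat -> R) :
  (forall j, geometric_bounded (A j)) ->
  geometric_bounded (fun n => \sum_(j < N) a j * A j n).
Proof.
move=> Ab; elim: N => [|N IH].
  have [C [K [? ? h]]] := geometric_bounded0; exists C, K; split => // n.
  by rewrite big_ord0; exact: h.
have [C [K [? ? h]]] := geometric_boundedD IH (geometric_boundedZ (a N) (Ab N)).
by exists C, K; split => // n; rewrite big_ord_recr; exact: h.
Qed.

Lemma frac_seriesD al be t : geometric_bounded al -> geometric_bounded be ->
  fs (fun n => al n + be n) t = fs al t + fs be t.
Proof.
move=> ab bb; apply/cvg_lim => //.
rewrite (_ : pseries _ _ = pseries (ml_coef nu al) (t `^ nu) + pseries (ml_coef nu be) (t `^ nu)).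
  by apply: cvgD; exact: frac_series_cvg.
apply/funext => n; rewrite /pseries fctE /series/= -big_split/=.
by apply: eq_bigr => k _; rewrite /ml_coef; ring.
Qed.

Lemma frac_seriesZ a al t : geometric_bounded al ->
  fs (fun n => a * al n) t = a * fs al t.
Proof.
move=> ab; apply/cvg_lim => //.
rewrite (_ : pseries _ _ = fun n => a * pseries (ml_coef nu al) (t `^ nu) n).
  by apply: cvgM; [exact: cvg_cst|exact: frac_series_cvg].
apply/funext => n; rewrite /pseries /series/= mulr_sumr.
by apply: eq_bigr => k _; rewrite /ml_coef; ring.
Qed.

Lemma frac_series0 t : fs (fun=> 0) t = 0.
Proof.
have -> : (fun=> 0) = (fun n : nat => 0 * (fun=> 0 : R) n) by apply/funext => n; rewrite mul0r.
by rewrite frac_seriesZ ?mul0r//; exact: geometric_bounded0.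
Qed.

Lemma frac_series_sum N (a : nat -> R) (A : nat -> nat -> R) t :
  (forall j, geometric_bounded (A j)) ->
  fs (fun n => \sum_(j < N) a j * A j n) t = \sum_(j < N) a j * fs (A j) t.
Proof.
move=> Ab; elim: N => [|N IH].
  rewrite [RHS]big_ord0 -[RHS](frac_series0 t); congr (fs _ t); apply/funext => n.
  by rewrite big_ord0.
rewrite big_ord_recr/= -IH -frac_seriesZ// -frac_seriesD.
- by congr (fs _ t); apply/funext => n; rewrite big_ord_recr.
- exact: geometric_bounded_sum.
- exact: geometric_boundedZ.
Qed.

(** With D = u^m, a bound uniform in n on coefficients passes to an O(u^m) bound on the series, as
    an expansion at 0+ requires. *)
Lemma frac_series_norm_le al t D K : 0 <= D -> 0 < K ->
  (forall n, `|al n| <= D * K ^+ n) -> `|fs al t| <= D * fs (fun n => K ^+ n) t.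
Proof.
move=> D0 K0 aK.
have ab : geometric_bounded al by exists D, K.
have Kb : geometric_bounded (fun n => K ^+ n).
  by exists 1, K; split=> // n; rewrite mul1r ger0_norm// exprn_ge0// ltW.
have h1 := cvg_norm (@frac_series_cvg al t ab).
have h2 : D * pseries (ml_coef nu (fun n => K ^+ n)) (t `^ nu) n @[n --> \oo] -->
    D * fs (fun n => K ^+ n) t.
  by apply: cvgM; [exact: cvg_cst|exact: frac_series_cvg].
apply: (ler_cvg_to (h1 _) h2); apply: nearW => n.
rewrite /pseries /series/= mulr_sumr (le_trans (ler_norm_sum _ _ _))//.
apply: ler_sum => k _; rewrite normrM (ger0_norm (exprn_ge0 _ (powR_ge0 _ _))).
have G0 : 0 < Gamma (nu * k%:R + 1) by rewrite Gamma_gt0// Gamma_arg_gt0.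
rewrite mulrA ler_wpM2r ?exprn_ge0 ?powR_ge0// /ml_coef normrM normfV (gtr0_norm G0).
by rewrite mulrA ler_wpM2r ?invr_ge0 ?(ltW G0).
Qed.

Variable c : R.
Hypothesis c0 : 0 < c.

(** The coefficient of y^j in (- c (1 - y))^n; thus [ml_poly j t] is that of y^j in the
    Mittag-Leffler function at - c (1 - y) t^nu. *)
Definition ml_poly_coef (j n : nat) : R := (-1) ^+ (n + j) * 'C(n, j)%:R * c ^+ n.

Definition ml_poly (j : nat) (t : R) : R := fs (ml_poly_coef j) t.

Lemma bin_le_expn n j : ('C(n, j) <= 2 ^ n)%N.
Proof.
elim: n j => [|n IH] [|j]; rewrite ?bin0 ?expn_gt0 ?bin0n//.
by rewrite binS expnS mul2n -addnn leq_add.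
Qed.

Lemma ml_poly_coef_bound j n : `|ml_poly_coef j n| <= (2 * c) ^+ n.
Proof.
rewrite /ml_poly_coef !normrM normrX normrN1 expr1n mul1r normr_nat normrX (gtr0_norm c0).
by rewrite exprMn ler_wpM2r ?exprn_ge0 ?(ltW c0)// -natrX ler_nat bin_le_expn.
Qed.

Lemma geometric_bounded_ml_poly j : geometric_bounded (ml_poly_coef j).
Proof.
exists 1, (2 * c); split=> [//||n]; first by rewrite mulr_gt0.
by rewrite mul1r ml_poly_coef_bound.
Qed.

Lemma ml_poly_coefS j n : ml_poly_coef j n.+1 =
  - c * (ml_poly_coef j n - (if j is j'.+1 then ml_poly_coef j' n else 0)).
Proof.
rewrite /ml_poly_coef; case: j => [|j].
  by rewrite !bin0 !addn0 exprS [c ^+ n.+1]exprS; ring.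
rewrite binS natrD addSn addnS !exprS; ring.
Qed.

Lemma shifted_sum1 (E : nat -> R -> R) j t :
  shifted_sum (fun l => c * binom_coef 1 l) E j t =
  c * (E j t - (if j is j'.+1 then E j' t else 0)).
Proof.
rewrite /shifted_sum.
have b0 : binom_coef (1 : R) 0 = 1 by rewrite binom_coef0.
have b1 : binom_coef (1 : R) 1 = -1 by rewrite binom_coefSr binom_coef0 sub0r divr1 mulr1.
have b2 l : binom_coef (1 : R) l.+2 = 0.
  elim: l => [|l IH]; first by rewrite binom_coefSr subrr !mul0r.
  by rewrite binom_coefSr IH mulr0.
case: j => [|j]; first by rewrite big_ord1 b0 subn0; ring.
rewrite !big_ord_recl big1; last by move=> i _; rewrite b2 mulr0 mul0r.
by rewrite /= b0 b1 subn0 subn1/= addr0; ring.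
Qed.

(** Passing from n to n + 1 multiplies (- c (1 - y))^n by - c (1 - y); so the left shift, hence the
    Caputo derivative, acts as - c (1 - shift) on the index j. *)
Lemma caputo_ml_poly (N : nat) (a : nat -> R) (f g : R -> R) :
  (forall t : R, 0 < t -> f t = \sum_(j < N) a j * ml_poly j t) ->
  (forall t : R, 0 < t -> g t =
    \sum_(j < N) a j * shifted_sum (fun l => c * binom_coef 1 l) ml_poly j t) ->
  caputo_derivable nu f /\ forall t : R, 0 < t -> - caputo nu f t = g t.
Proof.
move=> fE gE.
have bA := geometric_bounded_ml_poly.
have [] := @caputo_frac_series R nu nu01 (fun n => \sum_(j < N) a j * ml_poly_coef j n) f.
- exact: geometric_bounded_sum.
- by move=> t t0; rewrite fE// frac_series_sum.
move=> h1 h2; split => // t t0; rewrite h2// gE//.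
rewrite (frac_series_sum N a (A := fun j n => ml_poly_coef j n.+1)); last first.
  by move=> j; exact: geometric_boundedS.
rewrite -sumrN; apply: eq_bigr => j _; rewrite shifted_sum1 -mulrN; congr (_ * _).
rewrite (_ : (fun n => ml_poly_coef j n.+1) = fun n => - c * (ml_poly_coef j n +
    -1 * (if j : nat is j'.+1 then ml_poly_coef j' n else 0))); last first.
  by apply/funext => n; rewrite ml_poly_coefS mulN1r.
have bp : geometric_bounded (fun n => if j : nat is j'.+1 then ml_poly_coef j' n else 0).
  by case: (j : nat) => [|j']; [exact: geometric_bounded0|exact: bA].
rewrite frac_seriesZ ?frac_seriesD ?frac_seriesZ//; last 2 first.
- exact: geometric_boundedZ.
- by apply: geometric_boundedD => //; exact: geometric_boundedZ.
rewrite mulNr opprK mulN1r; congr (_ * (_ - _)).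
by case: (j : nat) => [|j'] //; exact: frac_series0.
Qed.

Lemma signr_subn (i j : nat) : (j <= i)%N -> (-1) ^+ (i - j) = (-1) ^+ (i + j) :> R.
Proof.
move=> /subnK {2}<-.
by rewrite -addnA exprD [X in _ = _ * X]exprD -exprMn mulrNN mulr1 expr1n mulr1.
Qed.

(** For each n, the terms of degree at least m of (- c (1 - u))^n, as a polynomial in u, add up to
    at most u^m (2 c)^n for 0 < u < 1, since the binomial coefficients sum to 2^n. *)
Lemma expands_ml_poly (t : R) :
  expands (fun y => fs (fun n => (- (c * (1 - y))) ^+ n) t) (fun j => ml_poly j t).
Proof.
move=> m; exists (fs (fun n => (2 * c) ^+ n) t).
  have h : (forall n, `|(0 : R)| <= 1 * (2 * c) ^+ n).
    by move=> n; rewrite normr0 mul1r exprn_ge0// mulr_ge0// ltW.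
  have := frac_series_norm_le t ler01 (mulr_gt0 (ltr0n R 2) c0) h.
  by rewrite frac_series0 normr0 mul1r.
near=> u.
have u0 : 0 < u by near: u; exact: near0_gt0.
have u1 : u < 1 by near: u; exact: near0_lt1.
have bA := geometric_bounded_ml_poly.
have c20 : 0 < 2 * c by rewrite mulr_gt0.
have b1 : geometric_bounded (fun n => (- (c * (1 - u))) ^+ n).
  exists 1, (2 * c); split=> // n; rewrite mul1r normrX normrN normrM (gtr0_norm c0).
  have u1' : 0 <= 1 - u by rewrite subr_ge0 ltW.
  rewrite (ger0_norm u1') lerXn2r ?nnegrE ?mulr_ge0 ?(ltW c0)//.
  by rewrite mulrC ler_wpM2r ?(ltW c0)//; lra.
have -> : \sum_(k < m) ml_poly k t * u ^+ k =
    fs (fun n => \sum_(k < m) u ^+ k * ml_poly_coef k n) t.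
  by rewrite (frac_series_sum m (fun k => u ^+ k))//; apply: eq_bigr => k _; rewrite mulrC.
have b2 : geometric_bounded (fun n => \sum_(k < m) u ^+ k * ml_poly_coef k n).
  exact: (geometric_bounded_sum m (fun k => u ^+ k)).
rewrite -[- fs _ t]mulN1r -frac_seriesZ// -frac_seriesD//; last first.
  exact: geometric_boundedZ.
rewrite [leRHS]mulrC; apply: frac_series_norm_le => // [|n].
  by rewrite exprn_ge0// ltW.
have -> : (- (c * (1 - u))) ^+ n = \sum_(k < n.+1) u ^+ k * ml_poly_coef k n.
  have -> : - (c * (1 - u)) = c * (-1 + u) by ring.
  rewrite exprMn exprDn mulr_sumr; apply: eq_bigr => k _.
  have kn : (k <= n)%N by rewrite -ltnS.
  rewrite signr_subn//.
  by rewrite /ml_poly_coef -mulr_natr; ring.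
rewrite mulN1r -!(big_mkord xpredT (fun k => u ^+ k * ml_poly_coef k n)).
have Xn k : (n < k)%N -> u ^+ k * ml_poly_coef k n = 0.
  by move=> nk; rewrite /ml_poly_coef bin_small// mulr0 mul0r mulr0.
have [mn|nm] := leqP m n.+1.
  rewrite (big_cat_nat (leq0n m) mn)//= addrAC subrr add0r (le_trans (ler_norm_sum _ _ _))//.
  apply: (@le_trans _ _ (\sum_(m <= k < n.+1) u ^+ m * ('C(n, k)%:R * c ^+ n))).
    rewrite !big_nat; apply: ler_sum => k /andP[mk _].
    rewrite normrM (ger0_norm (exprn_ge0 _ (ltW u0))) /ml_poly_coef.
    rewrite !normrM normrX normrN1 expr1n mul1r normr_nat normrX (gtr0_norm c0).
    by rewrite ler_wpM2r ?mulr_ge0 ?exprn_ge0 ?(ltW c0)// ler_wiXn2l// ltW.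
  rewrite -mulr_sumr ler_wpM2l ?exprn_ge0 ?(ltW u0)//.
  rewrite -mulr_suml exprMn ler_wpM2r ?exprn_ge0 ?(ltW c0)//.
  rewrite -natrX -natr_sum ler_nat.
  have -> : (2 ^ n = \sum_(0 <= i < n.+1) 'C(n, i))%N.
    by rewrite big_mkord -(addn1 1) expnDn; apply: eq_bigr => i _; rewrite !exp1n !muln1.
  by rewrite [leqRHS](big_cat_nat (leq0n m) mn)/= leq_addl.
rewrite (big_cat_nat (leq0n n.+1) (ltnW nm))//= opprD addrA subrr add0r normrN.
rewrite big_nat big1 ?normr0 ?mulr_ge0 ?exprn_ge0 ?(ltW u0) ?(ltW c20)//.
by move=> k /andP[nk _]; exact: Xn.
Unshelve. all: by end_near. Qed.

End fractional_series_algebra.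

(** * The inverse stable subordinator *)

Section laplace_inversion.
Context {R : realType} {d : measure_display} {T : measurableType d}.
Variable P : probability T R.
Implicit Types X Y : T -> R.

(* With [r = exp (- th * X)] and [exp (- th * t) = 1 / 2], the cutoff tends to the
   indicator of [t < X], while its expectation is a combination of values of the
   Laplace transform of [X]. *)
Definition cutoff (r : R) (n : nat) : R := (1 - r ^+ n) ^+ (2 ^ n).

Lemma bernoulli_ineq (x : R) n : 0 <= x <= 1 -> 1 - n%:R * x <= (1 - x) ^+ n.
Proof.
move=> /andP[x0 x1]; elim: n => [|n IH]; first by rewrite mul0r subr0 expr0.
rewrite exprS (le_trans _ (ler_wpM2l _ IH)) ?subr_ge0// -natr1.
have -> : (1 - x) * (1 - n%:R * x) = 1 - (n%:R + 1) * x + n%:R * x ^+ 2 by ring.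
by rewrite lerDl mulr_ge0// sqr_ge0.
Qed.

Lemma bernoulli_ineq_ge (x : R) n : 0 <= x -> 1 + n%:R * x <= (1 + x) ^+ n.
Proof.
move=> x0; elim: n => [|n IH]; first by rewrite mul0r addr0 expr0.
rewrite exprS (le_trans _ (ler_wpM2l _ IH)) ?addr_ge0// -natr1.
have -> : (1 + x) * (1 + n%:R * x) = 1 + (n%:R + 1) * x + n%:R * x ^+ 2 by ring.
by rewrite lerDl mulr_ge0// sqr_ge0.
Qed.

Lemma cutoff01 (r : R) n : 0 <= r <= 1 -> 0 <= cutoff r n <= 1.
Proof.
move=> /andP[r0 r1]; have rn1 : r ^+ n <= 1 by rewrite exprn_ile1.
by rewrite /cutoff exprn_ge0 ?subr_ge0//= exprn_ile1 ?subr_ge0// lerBlDr lerDl exprn_ge0.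
Qed.

Lemma cutoff_cvg1 (r : R) : 0 <= r < 2^-1 -> cutoff r n @[n --> \oo] --> (1 : R).
Proof.
move=> /andP[r0 r2]; have r1 : r <= 1 by rewrite (le_trans (ltW r2))// invf_le1// ler1n.
apply: (@squeeze_cvgr _ _ _ _ (fun n => 1 - (2 * r) ^+ n) (cst 1)).
- have r01 : 0 <= r <= 1 by rewrite r0.
  apply: nearW => n; have /andP[_ ->] := cutoff01 n r01.
  rewrite andbT exprMn -natrX; apply: bernoulli_ineq.
  by rewrite exprn_ge0//= exprn_ile1.
- rewrite -[X in _ --> X]subr0; apply: cvgB; first exact: cvg_cst.
  apply: cvg_expr; rewrite ger0_norm ?mulr_ge0//.
  by rewrite -ltr_pdivlMl// mulr1.
- exact: cvg_cst.
Qed.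

(** (1 - r^n)^(2^n) <= exp(- (2 r)^n), and (2 r)^n grows at least linearly by Bernoulli's
    inequality. *)
Lemma cutoff_cvg0 (r : R) : 2^-1 < r <= 1 -> cutoff r n @[n --> \oo] --> (0 : R).
Proof.
move=> /andP[r2 r1]; have r0 : 0 < r by rewrite (lt_trans _ r2)// invr_gt0.
have d0 : 0 < 2 * r - 1 by rewrite subr_gt0 -ltr_pdivrMl// mulr1.
apply: (@squeeze_cvgr _ _ _ _ (cst 0) (fun n => (2 * r - 1)^-1 * n.+1%:R^-1)).
- have r01 : 0 <= r <= 1 by rewrite ltW.
  apply: nearW => n; have /andP[-> _] /= := cutoff01 n r01.
  have q0 : 0 <= 1 - r ^+ n by rewrite subr_ge0 exprn_ile1// ltW.
  apply: (@le_trans _ _ (expR (- (2 * r) ^+ n))).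
    rewrite exprMn -natrX -mulrN expRM_natl /cutoff.
    apply: lerXn2r; rewrite ?nnegrE ?expR_ge0//.
    exact: expR_ge1Dx.
  have h1 : (2 * r - 1) * n.+1%:R <= expR ((2 * r) ^+ n).
    apply: le_trans (expR_ge1Dx _).
    have e2 : 1 + (2 * r - 1) = 2 * r by ring.
    have := bernoulli_ineq_ge n (ltW d0); rewrite e2 => h.
    rewrite -[n.+1%:R]natr1 mulrDr mulr1 [_ * n%:R]mulrC.
    have d1 : 2 * r - 1 <= 1 by move: r1; lra.
    by move: h d1; set p := _ * _; set q := _ ^+ n; lra.
  by rewrite expRN -invfM lef_pV2 ?posrE ?expR_gt0// mulr_gt0.
- exact: cvg_cst.
- rewrite -[X in _ --> X](mulr0 ((2 * r - 1)^-1)); apply: cvgM; first exact: cvg_cst.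
  exact: cvg_harmonic.
Qed.

Lemma integrable_expRN (s : R) X : 0 <= s -> measurable_fun setT X -> (forall w, 0 <= X w) ->
  P.-integrable setT (EFin \o (fun w => expR (- (s * X w)))).
Proof.
move=> s0 mX X0; apply: measurable_bounded_integrable => //.
- by rewrite (le_lt_trans (probability_le1 P measurableT))// ltry.
- exact: measurable_expRN.
- exists 1; split=> // M M1 w _ /=.
  have /andP[h1 h2] := expRN01 s0 (X0 w).
  by rewrite ger0_norm// (le_trans h2)// ltW.
Qed.

(** Each factor 1 - exp(- th X) replaces a value at s by the difference of the values at s and s +
    th; hence the induction treats all s at once. *)
Lemma integral_cutoff_eq X Y (th : R) : 0 <= th ->
  measurable_fun setT X -> measurable_fun setT Y ->
  (forall w, 0 <= X w) -> (forall w, 0 <= Y w) ->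
  (forall s : R, 0 <= s ->
    (\int[P]_w (expR (- (s * X w)))%:E = \int[P]_w (expR (- (s * Y w)))%:E)%E) ->
  forall N (s : R), 0 <= s ->
  (\int[P]_w ((1 - expR (- (th * X w))) ^+ N * expR (- (s * X w)))%:E =
   \int[P]_w ((1 - expR (- (th * Y w))) ^+ N * expR (- (s * Y w)))%:E)%E.
Proof.
move=> th0 mX mY X0 Y0 XY.
have integ (Z : T -> R) N (s : R) : 0 <= s -> measurable_fun setT Z -> (forall w, 0 <= Z w) ->
    P.-integrable setT (EFin \o (fun w => (1 - expR (- (th * Z w))) ^+ N * expR (- (s * Z w)))).
  move=> s0 mZ Z0; apply: measurable_bounded_integrable => //.
  - by rewrite (le_lt_trans (probability_le1 P measurableT))// ltry.
  - apply: measurable_funM; last exact: measurable_expRN.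
    by apply: measurable_funX; apply: measurable_funB => //; exact: measurable_expRN.
  - exists 1; split=> // M M1 w _ /=.
    have /andP[h1 h2] := expRN01 s0 (Z0 w).
    have /andP[k1 k2] := expRN01 th0 (Z0 w).
    rewrite ger0_norm ?mulr_ge0 ?exprn_ge0 ?subr_ge0//.
    rewrite (le_trans _ (ltW M1))// mulr_ile1 ?exprn_ge0 ?subr_ge0//.
    by rewrite exprn_ile1 ?subr_ge0// gerBl.
have step (Z : T -> R) N (s : R) : 0 <= s -> measurable_fun setT Z -> (forall w, 0 <= Z w) ->
    (\int[P]_w ((1 - expR (- (th * Z w))) ^+ N.+1 * expR (- (s * Z w)))%:E =
     \int[P]_w ((1 - expR (- (th * Z w))) ^+ N * expR (- (s * Z w)))%:E -
     \int[P]_w ((1 - expR (- (th * Z w))) ^+ N * expR (- ((s + th) * Z w)))%:E)%E.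
  move=> s0 mZ Z0; rewrite -integralB_EFin//; last 2 first.
  - exact: integ.
  - by apply: integ => //; rewrite addr_ge0.
  apply: eq_integral => w _; congr EFin.
  by rewrite exprSr mulrDl opprD expRD; ring.
elim=> [|N IH] s s0.
  under eq_integral do rewrite expr0 mul1r.
  under [RHS]eq_integral do rewrite expr0 mul1r.
  exact: XY.
by rewrite (step X N s s0 mX X0) (step Y N s s0 mY Y0) (IH s s0) (IH _ (addr_ge0 s0 th0)).
Qed.

(** Where the variable equals t the cutoff tends to 1 / e, neither 0 nor 1; hence a strict
    inequality on one side and a weak one on the other. *)
Lemma laplace_tail_le X Y (t : R) : 0 < t ->
  measurable_fun setT X -> measurable_fun setT Y ->
  (forall w, 0 <= X w) -> (forall w, 0 <= Y w) ->
  (forall s : R, 0 <= s ->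
    (\int[P]_w (expR (- (s * X w)))%:E = \int[P]_w (expR (- (s * Y w)))%:E)%E) ->
  (P [set w | (t < X w)%R] <= P [set w | (t <= Y w)%R])%E.
Proof.
move=> t0 mX mY X0 Y0 XY.
pose th := ln 2 / t.
have th0 : 0 < th by apply: divr_gt0 => //; apply: ln_gt0; rewrite ltr1n.
pose q (Z : T -> R) w := expR (- (th * Z w)).
have q01 (Z : T -> R) w : (forall w, 0 <= Z w) -> 0 <= q Z w <= 1.
  by move=> Z0; apply: expRN01 => //; exact: ltW.
have half : expR (- (th * t)) = 2^-1 :> R.
  by rewrite /th divfK ?gt_eqF// expRN lnK// posrE.
have eqI n : (\int[P]_w (cutoff (q X w) n)%:E = \int[P]_w (cutoff (q Y w) n)%:E)%E.
  have nth0 : 0 <= n%:R * th by rewrite mulr_ge0// ltW.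
  have := integral_cutoff_eq nth0 mX mY X0 Y0 XY (2 ^ n) (lexx 0).
  have E (Z : T -> R) w : (1 - expR (- (n%:R * th * Z w))) ^+ (2 ^ n) * expR (- (0 * Z w)) = cutoff (q Z w) n.
    by rewrite mul0r oppr0 expR0 mulr1 /cutoff /q -mulrA -mulrN expRM_natl.
  by under eq_integral do rewrite E; under [X in _ = X -> _]eq_integral do rewrite E.
have mcut (Z : T -> R) n (D : set T) : measurable_fun setT Z -> measurable_fun D (fun w => (cutoff (q Z w) n)%:E).
  move=> mZ; apply/measurable_EFinP; apply: measurable_funTS; apply: measurable_funX.
  by apply: measurable_funB => //; apply: measurable_funX; exact: measurable_expRN.
have m1 : measurable [set w | (t < X w)%R].
  by rewrite -[X in measurable X]setTI; apply: (measurable_fun_ltr (measurable_cst t) mX) => //.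
have m2 : measurable [set w | (t <= Y w)%R].
  by rewrite -[X in measurable X]setTI; apply: (measurable_fun_ler (measurable_cst t) mY) => //.
have c0 (Z : T -> R) w n : (forall w, 0 <= Z w) -> (0 <= (cutoff (q Z w) n)%:E)%E.
  by move=> Z0; have /andP[] := cutoff01 n (q01 Z w Z0); rewrite lee_fin.
have dct (Z : T -> R) D (l : R) : measurable D -> measurable_fun setT Z -> (forall w, 0 <= Z w) ->
    (forall w, D w -> cutoff (q Z w) n @[n --> \oo] --> l) ->
    (\int[P]_(w in D) (cutoff (q Z w) n)%:E @[n --> \oo] --> \int[P]_(w in D) l%:E)%E.
  move=> mD mZ Z0 Zl.
  have [] // := @dominated_convergence _ _ _ P D mD (fun n w => (cutoff (q Z w) n)%:E)
    (fun w => l%:E) (cst 1%E).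
  - by move=> n; exact: mcut.
  - by apply: aeW => w Dw; apply: cvg_EFin; [exact: nearW|exact: Zl].
  - exact: finite_measure_integrable_cst.
  - apply: aeW => w n _; rewrite /= lee_fin.
    by have /andP[F0 F1] := cutoff01 n (q01 Z w Z0); rewrite ger0_norm.
have lim1 := @dct X [set w | (t < X w)%R] 1 m1 mX X0.
have {}lim1 : (\int[P]_(w in [set w | (t < X w)%R]) (cutoff (q X w) n)%:E @[n --> \oo] -->
    P [set w | (t < X w)%R])%E.
  rewrite -[X in _ --> X]mul1e -integral_cst//; apply: lim1 => w /= tX.
  apply: cutoff_cvg1; have /andP[-> _] /= := q01 X w X0.
  by rewrite -half ltr_expR ltrN2 ltr_pM2l.
have lim2 := @dct Y (~` [set w | (t <= Y w)%R]) 0 (measurableC m2) mY Y0.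
have {}lim2 : (\int[P]_(w in ~` [set w | (t <= Y w)%R]) (cutoff (q Y w) n)%:E @[n --> \oo] --> 0)%E.
  have -> : 0%E = (\int[P]_(w in ~` [set w | (t <= Y w)%R]) 0%:E)%E by rewrite integral0.
  apply: lim2 => w /= /negP; rewrite -ltNge => Yt.
  apply: cutoff_cvg0; have /andP[_ ->] /= := q01 Y w Y0.
  by rewrite andbT -half ltr_expR ltrN2 ltr_pM2l.
have lim3 : (P [set w | (t <= Y w)%R] + \int[P]_(w in ~` [set w | (t <= Y w)%R]) (cutoff (q Y w) n)%:E
    @[n --> \oo] --> P [set w | (t <= Y w)%R])%E.
  rewrite -[X in _ --> X]adde0; apply: cvgeD => //; last exact: cvg_cst.
  by rewrite fin_num_adde_defl// fin_num_measure.
apply: (lee_cvg_to lim1 lim3); apply: nearW => n.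
apply: (@le_trans _ _ (\int[P]_w (cutoff (q X w) n)%:E)%E).
  apply: ge0_subset_integral => //; first exact: mcut.
  by move=> w _; exact: c0.
rewrite eqI -{1}(setUv [set w | (t <= Y w)%R]) ge0_integral_setU//; last 4 first.
- exact: measurableC.
- exact: mcut.
- by move=> w _; exact: c0.
- by apply/disj_setPS; rewrite setICr.
apply: leeD2r.
rewrite -[leRHS]mul1e -integral_cst//; apply: ge0_le_integral => //.
- by move=> w _; exact: c0.
- exact: mcut.
- by move=> w _; rewrite lee_fin; have /andP[] := cutoff01 n (q01 Y w Y0).
Qed.

(** Raising the threshold to t + 1 / (n + 1) and letting n grow makes both inequalities strict;
    exchanging X and Y then gives equal tails. *)
Lemma laplace_tail_leq X Y (t : R) : 0 < t ->
  measurable_fun setT X -> measurable_fun setT Y ->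
  (forall w, 0 <= X w) -> (forall w, 0 <= Y w) ->
  (forall s : R, 0 <= s ->
    (\int[P]_w (expR (- (s * X w)))%:E = \int[P]_w (expR (- (s * Y w)))%:E)%E) ->
  (P [set w | (t < X w)%R] <= P [set w | (t < Y w)%R])%E.
Proof.
move=> t0 mX mY X0 Y0 XY.
pose F n := [set w | t + n.+1%:R^-1 < X w].
have mgt (Z : T -> R) (s : R) : measurable_fun setT Z -> measurable [set w | s < Z w].
  by move=> mZ; rewrite -[X in measurable X]setTI; apply: (measurable_fun_ltr (measurable_cst s) mZ).
have UF : \bigcup_n F n = [set w | (t < X w)%R].
  apply/seteqP; split=> [w [n _]|w] /=; rewrite /F/=.
    by apply: lt_trans; rewrite ltrDl invr_gt0.
  by move=> /ltr_add_invr[n h]; exists n.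
have h : P (F n) @[n --> \oo] --> P (\bigcup_n F n).
  apply: nondecreasing_cvg_mu.
  - by move=> n; exact: mgt.
  - by apply: bigcup_measurable => n _; exact: mgt.
  - apply/nondecreasing_seqP => n; rewrite subsetEset => w; rewrite /F/=.
    by apply: le_lt_trans; rewrite lerD2l lef_pV2 ?posrE// ler_nat.
rewrite -UF -(cvg_lim _ h)//; apply: lime_le; first by apply/cvg_ex; eexists; exact: h.
apply: nearW => n; have tn : 0 < t + n.+1%:R^-1 by rewrite addr_gt0.
apply: le_trans (laplace_tail_le tn mX mY X0 Y0 XY) _.
apply: le_measure; rewrite ?inE.
- by rewrite -[X in measurable X]setTI; apply: (measurable_fun_ler (measurable_cst _) mY).
- exact: mgt.
- by move=> w /=; apply: lt_le_trans; rewrite ltrDl.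
Qed.

End laplace_inversion.

(** * Comparison of laws through their distribution functions *)

Section law_of_inverse.
Context {R : realType} {d : measure_display} {T : measurableType d}.
Variable P : probability T R.
Implicit Types X Y : T -> R.

Lemma measurable_gt X (s : R) : measurable_fun setT X -> measurable [set w | s < X w].
Proof.
by move=> mX; rewrite -[X in measurable X]setTI; exact: (measurable_fun_ltr (measurable_cst s) mX).
Qed.

Lemma measurable_lt X (s : R) : measurable_fun setT X -> measurable [set w | X w < s].
Proof.
by move=> mX; rewrite -[X in measurable X]setTI; exact: (measurable_fun_ltr mX (measurable_cst s)).
Qed.

Lemma measurable_le X (s : R) : measurable_fun setT X -> measurable [set w | X w <= s].
Proof.
by move=> mX; rewrite -[X in measurable X]setTI; exact: (measurable_fun_ler mX (measurable_cst s)).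
Qed.

(** Layer-cake formula: E exp(- x Z) is the integral over r of P(exp(- x Z) > r), and for r > 0 this
    event is Z < - ln r / x. *)
Lemma ge0_integral_expRN_eq X Y (x : R) :
  measurable_fun setT X -> measurable_fun setT Y ->
  (forall w, 0 <= X w) -> (forall w, 0 <= Y w) ->
  (forall z : R, 0 < z -> P [set w | X w < z] = P [set w | Y w < z]) ->
  0 <= x ->
  (\int[P]_w (expR (- (x * X w)))%:E = \int[P]_w (expR (- (x * Y w)))%:E)%E.
Proof.
move=> mX mY X0 Y0 XY; rewrite le_eqVlt => /orP[/eqP <-|x0].
  by apply: eq_integral => w _; rewrite !mul0r.
have mE Z : measurable_fun setT Z -> measurable_fun setT (fun w : T => expR (- (x * Z w))).
  exact: measurable_expRN.
pose eX : {RV P >-> R} := mfun_Sub (mem_set (mE _ mX)).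
pose eY : {RV P >-> R} := mfun_Sub (mem_set (mE _ mY)).
have := @ge0_expectation_ccdf _ _ _ P eX (fun w => expR_ge0 _).
have := @ge0_expectation_ccdf _ _ _ P eY (fun w => expR_ge0 _).
rewrite unlock /= => -> ->; apply: eq_integral => r; rewrite inE/= in_itv/= andbT => r0.
rewrite /ccdf /distribution /pushforward /=.
(* The formula includes r = 0, where ln has no meaningful value; there both events are certain. *)
have [->|rn0] := eqVneq r 0.
  by congr (P _); apply/seteqP; split => w _ /=; rewrite in_itv/= andbT expR_gt0.
have {r0 rn0}r0 : 0 < r by rewrite lt_neqAle eq_sym rn0.
have E Z : (fun w => expR (- (x * Z w))) @^-1` `]r, +oo[ = [set w : T | Z w < - ln r / x].
  have h w : (r < expR (- (x * Z w))) = (Z w < - ln r / x).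
    have er : expR (ln r) = r by rewrite lnK.
    by rewrite -{1}er ltr_expR ltrNr ltr_pdivlMr// mulrC.
  by apply/seteqP; split => w /=; rewrite in_itv/= andbT h.
rewrite !E; have [z0|z0] := ltP 0 (- ln r / x); first by rewrite XY.
have e0 Z : (forall w, 0 <= Z w) -> [set w : T | Z w < - ln r / x] = set0.
  by move=> Z0; apply/seteqP; split => w //=; rewrite ltNge (le_trans z0).
by rewrite !e0.
Qed.

(** Applying the weak comparison at z - 1 / (n + 1) and letting n grow makes the right side
    strict. *)
Lemma probability_lt_le X Y :
  measurable_fun setT X -> measurable_fun setT Y ->
  (forall z : R, (P [set w | (X w < z)%R] <= P [set w | (Y w <= z)%R])%E) ->
  forall z : R, (P [set w | (X w < z)%R] <= P [set w | (Y w < z)%R])%E.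
Proof.
move=> mX mY XY z.
pose F n := [set w | X w < z - n.+1%:R^-1].
have UF : \bigcup_n F n = [set w | X w < z].
  apply/seteqP; split=> [w [n _]|w] /=; rewrite /F/=.
    by move=> /lt_trans; apply; rewrite ltrBlDr ltrDl invr_gt0.
  by move=> /ltr_add_invr[n h]; exists n => //=; rewrite ltrBrDr.
have h : P (F n) @[n --> \oo] --> P (\bigcup_n F n).
  apply: nondecreasing_cvg_mu.
  - by move=> n; exact: measurable_lt.
  - by apply: bigcup_measurable => n _; exact: measurable_lt.
  - apply/nondecreasing_seqP => n; rewrite subsetEset => w; rewrite /F/=.
    by move=> /lt_le_trans; apply; rewrite lerD2l lerN2 lef_pV2 ?posrE// ler_nat.
rewrite -UF; apply: cvge_le h; apply: nearW => n.
apply: le_trans (XY _) _; apply: le_measure; rewrite ?inE.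
- exact: measurable_le.
- exact: measurable_lt.
- by move=> w /= /le_lt_trans; apply; rewrite ltrBlDr ltrDl invr_gt0.
Qed.

Lemma le_expRN_eq0 (p : \bar R) (C : R) : (0 <= p)%E ->
  (forall n : nat, p <= (expR (C - n%:R))%:E)%E -> p = 0%E.
Proof.
move=> p0 h; apply/eqP; rewrite eq_le p0 andbT.
have l : (expR (C - n%:R))%:E @[n --> \oo] --> 0%:E.
  apply: cvg_EFin; first exact: nearW.
  rewrite (_ : fine \o _ = fun n => expR C * (expR (-1)) ^+ n); last first.
    by apply/funext => n /=; rewrite expRD -[in LHS](mulr1 n%:R) -mulrN expRM_natl.
  rewrite -[X in _ --> X](mulr0 (expR C)); apply: cvgM; first exact: cvg_cst.
  by apply: cvg_expr; rewrite ger0_norm ?expR_ge0// -[ltRHS]expR0 ltr_expR ltrN10.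
by apply: cvge_ge l; exact: nearW.
Qed.

End law_of_inverse.

(** * The stable subordinator and the law of its inverse *)

Section inverse_stable.
Context {R : realType} {d : measure_display} {T : measurableType d}.
Variables (P : probability T R) (nu : R) (A : R -> T -> R).
Hypotheses (nu01 : 0 < nu < 1) (hA : stable_subordinator P nu A).

Let nu0 : 0 < nu. Proof. by case/andP: nu01. Qed.

Let A0 := subordinator_ge0 hA.1.

Lemma measurable_stable (z : R) : 0 <= z -> measurable_fun setT (A z).
Proof. by move=> z0; case: hA => -[[+ _ _ _ _ _] _] _; exact. Qed.

Lemma stable_le (w : T) (s t : R) : 0 <= s -> s <= t -> A s w <= A t w.
Proof. by case: hA => -[_ + _]; exact. Qed.

Lemma stable_laplace (z theta : R) : 0 <= z -> 0 <= theta ->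
  (\int[P]_w (expR (- (theta * A z w)))%:E = (expR (- (theta `^ nu * z)))%:E)%E.
Proof. by move=> z0 th0; case: hA => _ /(_ z theta z0 th0); rewrite unlock. Qed.

(** Markov's inequality for exp(- theta A_z). *)
Lemma stable_chernoff (z theta t : R) : 0 <= z -> 0 <= theta ->
  (P [set w | (A z w <= t)%R] <= (expR (theta * t - theta `^ nu * z))%:E)%E.
Proof.
move=> z0 th0; have mAz := measurable_stable z0.
have mS : measurable [set w | A z w <= t] by exact: measurable_le.
rewrite expRD EFinM -(stable_laplace z0 th0).
have mE : measurable_fun setT (fun w => (expR (- (theta * A z w)))%:E).
  by apply/measurable_EFinP; exact: measurable_expRN.
rewrite -ge0_integralZl//.
rewrite -[leLHS]mul1e -integral_cst//.
apply: (@le_trans _ _ (\int[P]_(w in [set w | (A z w <= t)%R])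
   ((expR (theta * t))%:E * (expR (- (theta * A z w)))%:E))%E).
  apply: ge0_le_integral => //.
  - apply: measurable_funTS; apply/measurable_EFinP; apply: measurable_funM => //.
    exact: measurable_expRN.
  - move=> w /= At; rewrite -EFinM -expRD lee_fin -[leLHS]expR0 ler_expR subr_ge0.
    by rewrite ler_wpM2l.
apply: ge0_subset_integral => //.
by apply/measurable_EFinP; apply: measurable_funM => //; exact: measurable_expRN.
Qed.

(** For theta^nu = n / z the Chernoff bound at level 0 is exp(- n), for every n. *)
Lemma stable_gt0 (z : R) : 0 < z -> P [set w | A z w <= 0] = 0%E.
Proof.
move=> z0; apply: (@le_expRN_eq0 _ _ 0) => // n.
have nz0 : 0 <= n%:R / z by rewrite divr_ge0// ltW.
have := stable_chernoff 0 (ltW z0) (powR_ge0 (n%:R / z) nu^-1).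
by rewrite mulr0 -powRrM mulVf ?gt_eqF// powRr1// divfK ?gt_eqF.
Qed.

(** As paths are nondecreasing, the event that t is never exceeded, where the inverse takes the
    default value of [inf]; it is null by the Chernoff bound with theta = 1. *)
Definition stable_bounded (t : R) : set T := \bigcap_n [set w | A n%:R w <= t].

Lemma measurable_stable_bounded t : measurable (stable_bounded t).
Proof. by apply: bigcapT_measurable => n; apply/measurable_le/measurable_stable. Qed.

Lemma probability_stable_bounded t : P (stable_bounded t) = 0%E.
Proof.
apply: (@le_expRN_eq0 _ _ t) => // n.
have n0 : 0 <= n%:R :> R by [].
have := stable_chernoff t n0 ler01; rewrite powR1 !mul1r; apply: le_trans.
apply: le_measure; rewrite ?inE.
- exact: measurable_stable_bounded.
- by apply/measurable_le/measurable_stable.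
- by move=> w; apply.
Qed.

Local Notation L := (inverse_process A).

Lemma inverse_has_lbound t w : has_lbound [set z | 0 <= z /\ t < A z w].
Proof. by exists 0 => z []. Qed.

Lemma inverse_ge0 t w : 0 <= L t w.
Proof.
rewrite /inverse_process; have [->|/set0P ne] := eqVneq [set z | 0 <= z /\ t < A z w] set0.
  by rewrite inf0.
by apply: lb_le_inf => // z [].
Qed.

Lemma inverse_le t w z : 0 <= z -> t < A z w -> L t w <= z.
Proof. by move=> z0 tA; apply: ge_inf => //; exact: inverse_has_lbound. Qed.

Lemma inverse_lt t w z : L t w < z -> stable_bounded t w \/
  exists s, [/\ 0 <= s, s < z & t < A s w].
Proof.
have [e|/set0P ne] := eqVneq [set z | 0 <= z /\ t < A z w] set0.
  move=> _; left => n _ /=; rewrite leNgt; apply/negP => h.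
  by have : [set z | 0 <= z /\ t < A z w] n%:R by []; rewrite e.
move=> Lz; right.
have Lz0 : 0 < z - L t w by rewrite subr_gt0.
have [|s [s0 ts]] := inf_adherent Lz0 (_ : has_inf [set z | 0 <= z /\ t < A z w]).
  by split => //; exact: inverse_has_lbound.
by rewrite -/(inverse_process A t w) addrC subrK => sz; exists s.
Qed.

(** By monotonicity of paths, a passage above t before x is witnessed at a rational time, so
    countably many events suffice. *)
Lemma measurable_inverse t : measurable_fun setT (L t).
Proof.
move=> mT; apply: (measurability _ (RGenInftyO.measurableE R)) => //.
move=> _ [_ [x ->] <-]; rewrite setTI.
have [x0|x0] := leP x 0.
  rewrite (_ : _ @^-1` _ = set0)//; apply/seteqP; split=> w //=; rewrite in_itv/=.
  by rewrite ltNge (le_trans x0)// inverse_ge0.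
pose F (q : rat) : set T := if 0 <= (ratr q : R) < x then [set w : T | t < A (ratr q) w] else set0.
rewrite (_ : L t @^-1` `]-oo, x[%classic = stable_bounded t `|` \bigcup_q F q); last first.
  apply/seteqP; split=> w /=; rewrite in_itv/=.
    move=> /inverse_lt[|[s [s0 sx ts]]]; first by left.
    right; have [q] := rat_in_itvoo sx; rewrite in_itv/= => /andP[sq qx].
    exists q => //; rewrite /F qx (le_trans s0 (ltW sq))/=.
    by apply: lt_le_trans ts _; rewrite stable_le// ltW.
  case=> [h|[q _]].
    (* Without passage the inverse is 0 by default, which lies below x. *)
    rewrite /inverse_process (_ : [set z | _] = set0) ?inf0//.
    apply/seteqP; split=> z //= [z0]; apply/negP; rewrite -leNgt.
    apply: le_trans (h (Num.truncn z).+1 I) => /=; apply: stable_le => //.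
    by rewrite ltW// truncnS_gt.
  by rewrite /F; case: ifP => //= /andP[q0 qx] tA; rewrite (le_lt_trans _ qx)// inverse_le.
apply: measurableU; first exact: measurable_stable_bounded.
apply: bigcupT_measurable_rat => q; rewrite /F; case: ifP => // /andP[q0 _].
exact/measurable_gt/measurable_stable.
Qed.

(* A positive version of [A 1], almost surely equal to it. *)
Definition stable_pos (w : T) : R := if 0 < A 1 w then A 1 w else 1.

Lemma stable_pos_gt0 w : 0 < stable_pos w.
Proof. by rewrite /stable_pos; case: ifP. Qed.

Lemma measurable_stable_pos : measurable_fun setT stable_pos.
Proof.
have m1 := measurable_stable ler01.
apply: measurable_fun_ifT => //; exact: measurable_fun_ltr.
Qed.

Lemma stable_pos_laplace (theta : R) : 0 <= theta ->
  (\int[P]_w (expR (- (theta * stable_pos w)))%:E = (expR (- (theta `^ nu)))%:E)%E.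
Proof.
move=> th0; rewrite -[theta `^ nu]mulr1 -(stable_laplace ler01 th0).
apply: ge0_ae_eq_integral => //.
- by apply/measurable_EFinP/measurable_expRN; exact: measurable_stable_pos.
- by apply/measurable_EFinP/measurable_expRN; exact: measurable_stable.
exists [set w | A 1 w <= 0]; split.
- by apply/measurable_le/measurable_stable.
- exact: stable_gt0.
- move=> w /= h; rewrite leNgt; apply/negP => Aw; apply: h => _.
  by rewrite /stable_pos Aw.
Qed.

Lemma stable_scaling_laplace (z s : R) : 0 < z -> 0 <= s ->
  (\int[P]_w (expR (- (s * A z w)))%:E =
   \int[P]_w (expR (- (s * (z `^ nu^-1 * stable_pos w))))%:E)%E.
Proof.
move=> z0 s0; rewrite (stable_laplace (ltW z0) s0).
have E : s * z `^ nu^-1 >= 0 by rewrite mulr_ge0 ?powR_ge0.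
have F w : expR (- (s * (z `^ nu^-1 * stable_pos w))) =
  expR (- ((s * z `^ nu^-1) * stable_pos w)) by rewrite mulrA.
rewrite (eq_integral _ _ (fun w _ => congr1 EFin (F w))) (stable_pos_laplace E).
by rewrite powRM ?powR_ge0// -powRrM mulVf ?gt_eqF// powRr1// ltW.
Qed.

(** Self-similarity: the two variables have the same Laplace transform, and the tail comparison is
    applied in both directions. *)
Lemma stable_scaling (z t : R) : 0 < z -> 0 < t ->
  P [set w | t < A z w] = P [set w | t < z `^ nu^-1 * stable_pos w].
Proof.
move=> z0 t0; have mA := measurable_stable (ltW z0).
have mB : measurable_fun setT (fun w => z `^ nu^-1 * stable_pos w).
  by apply: measurable_funM => //; exact: measurable_stable_pos.
have B0 w : 0 <= z `^ nu^-1 * stable_pos w by rewrite mulr_ge0 ?powR_ge0// ltW// stable_pos_gt0.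
have Az0 w : 0 <= A z w by exact/A0/ltW.
have LE s (s0 : 0 <= s) := stable_scaling_laplace z0 s0.
have h1 := laplace_tail_leq t0 mA mB Az0 B0 LE.
have h2 := laplace_tail_leq t0 mB mA B0 Az0 (fun s s0 => esym (LE s s0)).
by apply: le_anti; rewrite h1 h2.
Qed.

(** The event (t / Z)^nu < z is t < z^(1 / nu) Z, with Z = [stable_pos], and has the probability of
    t < A_z. For the inverse, L_t < z forces t < A_z off a null set, whereas t < A_z yields L_t <=
    z; [probability_lt_le] closes this gap. *)
Lemma inverse_laplace (t x : R) : 0 < t -> 0 <= x ->
  (\int[P]_w (expR (- (x * L t w)))%:E =
   \int[P]_w (expR (- (x * (t / stable_pos w) `^ nu)))%:E)%E.
Proof.
move=> t0 x0.
have mY : measurable_fun setT (fun w => (t / stable_pos w) `^ nu).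
  rewrite (_ : (fun w => _) = fun w => (t * stable_pos w `^ (-1)) `^ nu); last first.
    by apply/funext => w; rewrite powRN powRr1// ltW// stable_pos_gt0.
  apply: (measurableT_comp (measurable_powR nu)); apply: measurable_funM => //.
  apply: (measurableT_comp (measurable_powR (-1))); exact: measurable_stable_pos.
have mL := measurable_inverse t.
have Y0 w : 0 <= (t / stable_pos w) `^ nu by exact: powR_ge0.
have YE z w : 0 < z -> ((t / stable_pos w) `^ nu < z) = (t < z `^ nu^-1 * stable_pos w).
  move=> z0; rewrite -ltr_pdivrMr ?stable_pos_gt0//.
  have q0 : 0 <= t / stable_pos w by rewrite divr_ge0// ltW// stable_pos_gt0.
  have -> : (t / stable_pos w) `^ nu < z = ((t / stable_pos w) `^ nu < (z `^ nu^-1) `^ nu).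
    by rewrite -powRrM mulVf ?gt_eqF// powRr1// ltW.
  apply/idP/idP => [h|h]; last by rewrite gt0_ltr_powR// nnegrE powR_ge0.
  rewrite ltNge; apply/negP => h'; move: h; rewrite ltNge => /negP; apply.
  by rewrite ge0_ler_powR// ?nnegrE ?powR_ge0// ltW.
have PY z : 0 < z -> P [set w | (t / stable_pos w) `^ nu < z] = P [set w | t < A z w].
  move=> z0; rewrite stable_scaling//; congr (P _).
  by apply/seteqP; split=> w /=; rewrite YE.
apply: ge0_integral_expRN_eq => //; first exact: inverse_ge0.
move=> z z0; apply/eqP; rewrite eq_le; apply/andP; split.
  rewrite PY//; have mA := measurable_gt t (measurable_stable (ltW z0)).
  apply: (@le_trans _ _ (P (stable_bounded t `|` [set w | t < A z w]))).
    apply: le_measure; rewrite ?inE.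
    - exact: measurable_lt.
    - by apply: measurableU => //; exact: measurable_stable_bounded.
    - move=> w /inverse_lt[|[s [s0 sz ts]]]; [by left|right => /=].
      by apply: lt_le_trans ts _; rewrite stable_le// ltW.
  apply: le_trans (measureU2 _ _ _) _ => //; first exact: measurable_stable_bounded.
  by rewrite -[leRHS]add0e -(probability_stable_bounded t).
apply: probability_lt_le => // y; have [y0|y0] := ltP 0 y; last first.
  rewrite (_ : [set w | _] = set0) ?measure0//.
  by apply/seteqP; split=> w //=; rewrite ltNge (le_trans y0).
rewrite PY//; apply: le_measure; rewrite ?inE.
- exact/measurable_gt/measurable_stable/ltW.
- exact: measurable_le.
- by move=> w /=; apply: inverse_le; exact: ltW.
Qed.

(** If L_0 > 0 then A is at most 0 at some time 1 / (n + 1), a null event. The initial condition in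
    (i) rests on this almost sure statement. *)
Lemma inverse_start : P [set w | 0 < L 0 w] = 0%E.
Proof.
have mS n : measurable [set w | A n.+1%:R^-1 w <= 0] by apply/measurable_le/measurable_stable.
have h : P (\bigcup_n [set w | A n.+1%:R^-1 w <= 0]) = 0%E.
  apply/negligibleP; first exact: bigcup_measurable.
  by apply: negligible_bigcup => n; apply/negligibleP => //; exact: stable_gt0.
apply: subset_measure0 h.
- exact/measurable_gt/measurable_inverse.
- exact: bigcup_measurable.
move=> w /= L0; have [n] := ltr_add_invr L0; rewrite add0r => nL.
exists n => //=; rewrite leNgt; apply/negP => An.
by move: nL; rewrite ltNge inverse_le.
Qed.

End inverse_stable.

(** * Laplace transforms from moments *)

Section exponential_moments.
Context {R : realType} {d : measure_display} {T : measurableType d}.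
Variable P : probability T R.
Variables (B : T -> R) (m : nat -> R).
Hypotheses (mB : measurable_fun setT B) (B0 : forall w, 0 <= B w).
Hypothesis BE : forall n, (\int[P]_w (B w ^+ n)%:E = (m n)%:E)%E.

Let term (y : R) n w := (y * B w) ^+ n / n`!%:R.

Let mterm y n : measurable_fun setT (term y n).
Proof. by apply: measurable_funM => //; apply: measurable_funX; exact: measurable_funM. Qed.

Let termE y n w : term y n w = y ^+ n / n`!%:R * B w ^+ n.
Proof. by rewrite /term exprMn mulrAC. Qed.

Let integrable_pow n : P.-integrable setT (EFin \o (fun w => B w ^+ n)).
Proof.
apply/integrableP; split; first by apply/measurable_EFinP; exact: measurable_funX.
under eq_integral do rewrite /= ger0_norm ?exprn_ge0//.
by rewrite BE ltry.
Qed.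

Let integrable_term y n : P.-integrable setT (EFin \o term y n).
Proof.
have := integrableZl measurableT (y ^+ n / n`!%:R) (integrable_pow n).
by apply: eq_integrable => // w _; rewrite /= termE EFinM.
Qed.

Let integral_term y n : (\int[P]_w (term y n w)%:E = (y ^+ n / n`!%:R * m n)%:E)%E.
Proof.
rewrite EFinM -BE -integralZl//; last exact: integrable_pow.
by apply: eq_integral => w _; rewrite termE EFinM.
Qed.

(** Convergence of the series with positive terms makes exp(y B) integrable, and this function
    dominates the partial sums of the alternating series. *)
Lemma exponential_moment_series (y : R) : 0 <= y ->
  cvgn (series (fun n => y ^+ n / n`!%:R * m n)) ->
  series (fun n => (- y) ^+ n / n`!%:R * m n) n @[n --> \oo] -->
    fine (\int[P]_w (expR (- (y * B w)))%:E)%E.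
Proof.
move=> y0 my.
have yB0 w : 0 <= y * B w by rewrite mulr_ge0.
have mexp (x : R) : measurable_fun setT (fun w => expR (x * B w)).
  by apply: measurableT_comp => //; exact: measurable_funM.
have iexp : P.-integrable setT (EFin \o (fun w => expR (y * B w))).
  apply/integrableP; split; first by apply/measurable_EFinP.
  have -> : (\int[P]_w `|(EFin \o (fun w => expR (y * B w))) w| =
             \sum_(n <oo) (y ^+ n / n`!%:R * m n)%:E)%E.
    under eq_integral do rewrite /= ger0_norm ?expR_ge0// -eseries_expR//.
    rewrite integral_nneseries//.
    - by apply: eq_eseriesr => n _; rewrite integral_term.
    - by move=> n; apply/measurable_EFinP; exact: mterm.
    - by move=> n w _; rewrite lee_fin divr_ge0// exprn_ge0.
  have h : (\sum_(n <oo) (y ^+ n / n`!%:R * m n)%:E = (limn (series (fun n => y ^+ n / n`!%:R * m n)))%:E)%E.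
    rewrite -EFin_lim//; apply/congr_lim/funext => n /=.
    by rewrite /series/= -sumEFin.
  by rewrite h ltry.
have sE n w : series (exp_coeff (- (y * B w))) n = \sum_(0 <= k < n) term (- y) k w.
  by apply: eq_bigr => k _; rewrite /exp_coeff/= /term mulNr.
have dct : (\int[P]_w (series (exp_coeff (- (y * B w))) n)%:E)%E @[n --> \oo] -->
    (\int[P]_w (expR (- (y * B w)))%:E)%E.
  have [] // := @dominated_convergence _ _ _ P setT measurableT
    (fun n w => (series (exp_coeff (- (y * B w))) n)%:E) (fun w => (expR (- (y * B w)))%:E)
    (fun w => (expR (y * B w))%:E).
  - move=> n; apply/measurable_EFinP.
    rewrite (_ : (fun w => _) = fun w => \sum_(0 <= k < n) term (- y) k w); last first.
      by apply/funext => w; rewrite sE.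
    by apply: measurable_sum => k; exact: mterm.
  - by apply/measurable_EFinP; exact: measurable_expRN.
  - by apply: aeW => w _; apply: cvg_EFin; [exact: nearW|exact: is_cvg_series_exp_coeff].
  - apply: aeW => w n _; rewrite /= lee_fin.
    apply: (@le_trans _ _ (series (exp_coeff (y * B w)) n)).
      rewrite /series/= (le_trans (ler_norm_sum _ _ _))// ler_sum// => k _.
      rewrite /exp_coeff/= normrM normrX normrN (ger0_norm (yB0 w)).
      by rewrite ger0_norm// invr_ge0.
    apply: nondecreasing_cvgn_le; last exact: is_cvg_series_exp_coeff.
    by apply: nondecreasing_series => k _ _; rewrite /exp_coeff/= divr_ge0// exprn_ge0.
have iE n : (\int[P]_w (series (exp_coeff (- (y * B w))) n)%:E =
    (series (fun n => (- y) ^+ n / n`!%:R * m n) n)%:E)%E.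
  under eq_integral do rewrite sE -sumEFin.
  rewrite integral_sum//; last by move=> k; exact: integrable_term.
  by rewrite /series/= -sumEFin; apply: eq_bigr => k _; rewrite integral_term.
have fi : (\int[P]_w (expR (- (y * B w)))%:E)%E \is a fin_num.
  exact: (integrable_fin_num measurableT (integrable_expRN P y0 mB B0)).
by move: dct; under eq_fun do rewrite iE; rewrite -(fineK fi) => /fine_cvg.
Qed.

End exponential_moments.

(** * Negative moments of the stable law and the Mittag-Leffler transform *)

Section inverse_stable_mittag_leffler.
Context {R : realType} {d : measure_display} {T : measurableType d}.
Variables (P : probability T R) (nu : R) (A : R -> T -> R).
Hypotheses (nu01 : 0 < nu < 1) (hA : stable_subordinator P nu A).
Local Notation leb := (@lebesgue_measure R).

Let nu0 : 0 < nu. Proof. by case/andP: nu01. Qed.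

Local Notation Z := (stable_pos A).

Let mZ := measurable_stable_pos hA.

Let Z0 := stable_pos_gt0 A.

(** Tonelli for x^(s - 1) exp(- x Z): the integral over x is Gamma(s) Z^(- s), and the expectation
    of exp(- x Z) is exp(- x^nu). *)
Lemma stable_negative_moment (s : R) : 0 < s ->
  ((Gamma s)%:E * \int[P]_w (Z w `^ (- s))%:E =
   \int[leb]_(x in `]0%R, +oo[) (x `^ (s - 1) * expR (- (x `^ nu)))%:E)%E.
Proof.
move=> s0.
pose f (p : T * R) : \bar R := if 0 < p.2 then
  (p.2 `^ (s - 1) * expR (- (p.2 * Z p.1)))%:E else 0%E.
have f0 p : (0 <= f p)%E.
  by rewrite /f; case: ifP => // _; rewrite lee_fin mulr_ge0 ?powR_ge0 ?expR_ge0.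
have mf : measurable_fun setT f.
  apply: measurable_fun_ifT => //; first exact: measurable_fun_ltr.
  apply/measurable_EFinP; apply: measurable_funM.
    exact: (measurableT_comp (measurable_powR (s - 1))).
  apply: measurableT_comp => //; apply: measurableT_comp => //; apply: measurable_funM => //.
  exact: measurableT_comp.
have := @fubini_tonelli _ _ T (measurableTypeR R) R P leb f mf f0.
have G0 : 0 < Gamma s by exact: Gamma_gt0.
have -> : (\int[P]_w \int[leb]_x f (w, x) = (Gamma s)%:E * \int[P]_w (Z w `^ (- s))%:E)%E.
  rewrite -ge0_integralZl//; last 3 first.
  - apply/measurable_EFinP; exact: (measurableT_comp (measurable_powR (- s))).
  - by move=> w _; rewrite lee_fin powR_ge0.
  - by rewrite lee_fin ltW.
  apply: eq_integral => w _; rewrite -EFinM mulrC -Gamma_scaled//.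
  rewrite [RHS]integral_mkcond; apply: eq_integral => x _; rewrite patchE /f/=.
  case: ifPn => x0; first by rewrite mem_set/= ?in_itv/= ?andbT ?x0// [x * Z w]mulrC.
  by rewrite memNset//= in_itv/= andbT; exact/negP.
move=> ->; rewrite [RHS]integral_mkcond; apply: eq_integral => x _; rewrite patchE /f/=.
case: ifPn => [|]; last first.
  rewrite notin_setE/= in_itv/= andbT => /negP/negbTE x0.
  by rewrite integral0_eq// => w _; rewrite x0.
rewrite inE/= in_itv/= andbT => x0; rewrite x0.
under eq_integral do rewrite EFinM.
have mE : measurable_fun setT (fun w => (expR (- (x * Z w)))%:E).
  by apply/measurable_EFinP; exact: measurable_expRN.
have p0 : (0 <= (x `^ (s - 1))%:E)%E by rewrite lee_fin powR_ge0.
rewrite (ge0_integralZl P measurableT mE _ p0)//.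
by rewrite (stable_pos_laplace nu01 hA (ltW x0)) EFinM.
Qed.

Lemma stable_pos_moment n :
  (\int[P]_w (((Z w) `^ (- nu)) ^+ n)%:E = (n`!%:R / Gamma (nu * n%:R + 1))%:E)%E.
Proof.
(* The formula for negative moments takes a positive exponent, so the zeroth moment is apart. *)
case: n => [|n].
  under eq_integral do rewrite expr0.
  by rewrite integral_cst//= probability_setT mul1e mulr0 add0r Gamma1 divr1.
have s0 : 0 < nu * n.+1%:R by rewrite mulr_gt0.
have G0 := Gamma_gt0 s0.
have := stable_negative_moment s0; rewrite integral_stretched_exponential// => h.
have E w : (Z w `^ (- nu)) ^+ n.+1 = Z w `^ (- (nu * n.+1%:R)).
  by rewrite -powR_mulrn ?powR_ge0// -powRrM mulNr.
under eq_integral do rewrite E.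
rewrite GammaS//.
move: h; set I := (\int[P]_w _)%E => h.
have -> : I = (((Gamma (nu * n.+1%:R))^-1)%:E * ((Gamma (nu * n.+1%:R))%:E * I))%E.
  by rewrite muleA -EFinM mulVf ?gt_eqF// mul1e.
rewrite h -EFinM factS natrM; congr EFin; field.
by rewrite !gt_eqF//= pnatr_eq0.
Qed.

Lemma inverse_stable_laplace (t x : R) : 0 < t -> 0 <= x ->
  (\int[P]_w (expR (- (x * inverse_process A t w)))%:E)%E =
  (frac_series nu (fun n => (- x) ^+ n) t)%:E.
Proof.
move=> t0 x0.
have tnu0 : 0 < t `^ nu by rewrite powR_gt0.
rewrite (inverse_laplace nu01 hA t0 x0).
pose B w := Z w `^ (- nu).
have mB : measurable_fun setT B by exact: (measurableT_comp (measurable_powR (- nu))).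
have B0 w : 0 <= B w by exact: powR_ge0.
have BE w : x * (t / Z w) `^ nu = (x * t `^ nu) * B w.
  by rewrite powRM ?invr_ge0 ?(ltW t0) ?(ltW (Z0 w))// -powR_inv1 ?(ltW (Z0 w))// -powRrM mulN1r mulrA.
under eq_integral do rewrite BE.
have gb (z : R) : geometric_bounded (fun n => z ^+ n).
  exists 1, (1 + `|z|); split=> // n.
  by rewrite mul1r normrX lerXn2r ?nnegrE ?addr_ge0// lerDr.
have serE (z : R) : series (fun n => (z * t `^ nu) ^+ n / n`!%:R * (n`!%:R / Gamma (nu * n%:R + 1))) =
    pseries (ml_coef nu (fun n => z ^+ n)) (t `^ nu).
  apply/funext => n; apply: eq_bigr => k _; rewrite /ml_coef exprMn.
  have k0 : k`!%:R != 0 :> R by rewrite pnatr_eq0 -lt0n fact_gt0.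
  by rewrite mulrA divfK// mulrAC.
have y0 : 0 <= x * t `^ nu by rewrite mulr_ge0// ltW.
have := exponential_moment_series mB B0 stable_pos_moment y0.
rewrite serE -mulNr serE => h.
have {}h := h (cvgP _ (frac_series_cvg nu01 (gb x))).
have fi : (\int[P]_w (expR (- (x * t `^ nu * B w)))%:E)%E \is a fin_num.
  exact: (integrable_fin_num measurableT (integrable_expRN P y0 mB B0)).
by rewrite -(fineK fi) (cvg_unique _ h (frac_series_cvg nu01 (gb (- x)))).
Qed.

End inverse_stable_mittag_leffler.

(** * The fractional difference-differential equations *)

Lemma frac_difference_nat {R : realType} (eta : R) (f : int -> R) (k : nat) :
  (forall n, f (Negz n) = 0) ->
  frac_difference eta f k = \sum_(j < k.+1) binom_coef eta j * f (k - j)%N.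
Proof.
move=> f0; rewrite /frac_difference.
pose u j := (-1) ^+ j * gbinom eta j * f (k%:Z - j%:Z).
have uE (j : nat) : (k < j)%N -> u j = 0.
  (* [Negz n] encodes - (n + 1), hence the predecessor. *)
  move=> kj; rewrite /u (_ : k%:Z - j%:Z = Negz (j - k).-1) ?f0 ?mulr0//.
  by rewrite NegzE prednK ?subn_gt0// -subzn ?(ltnW kj)// opprB.
have sE n : (k < n)%N -> series u n = \sum_(j < k.+1) binom_coef eta j * f (k - j)%N.
  move=> kn; rewrite /series/= (big_cat_nat (leq0n k.+1) kn)/=.
  rewrite [X in _ + X]big_nat [X in _ + X]big1 ?addr0; last first.
    by move=> j /andP[kj _]; exact: uE.
  rewrite big_mkord; apply: eq_bigr => j _.
  by rewrite /u /binom_coef subzn// -ltnS.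
apply/cvg_lim => //; apply: cvg_near_cst.
by exists k.+1 => // n /= kn; rewrite sE.
Qed.

Section subordinated_pmf.
Context {R : realType} {d : measure_display} {T : measurableType d}.
Variables (P : probability T R) (eta mu beta : R) (N1 Aeta S L : R -> T -> R).
Hypotheses (heta : 0 < eta < 1) (hmu : 0 < mu) (hbeta : 0 < beta).
Hypotheses (hN1 : poisson_process P 1 N1) (hAeta : stable_subordinator P eta Aeta).
Hypothesis hN1Aeta : independent_processes P [tuple N1; Aeta].
Hypothesis hS : inverse_gaussian_subordinator P mu beta S.
Hypothesis mL : forall t : R, 0 <= t -> measurable_fun setT (L t).
Hypothesis L0 : forall w (t : R), 0 <= t -> 0 <= L t w.
Hypothesis hind : independent_processes P [tuple time_changed N1 Aeta; S; L].

Local Notation p := (pmf_at P (time_changed (time_changed (time_changed N1 Aeta) S) L)).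
Local Notation psi u := (ig_exponent (mu / beta) beta ((1 - u) `^ eta)).
Local Notation c := (ig_exponent (mu / beta) beta 1).

Let pE (t : R) : 0 <= t -> expands (fun u => fine (\int[P]_w (expR (- (psi u * L t w)))%:E)%E)
    (fun k : nat => p k t).
Proof. exact: expands_subordinated_pmf. Qed.

Let m0 : 0 < mu / beta. Proof. exact: divr_gt0. Qed.

(** As [L 0] vanishes almost surely, the generating function at time 0 is the constant 1. *)
Lemma subordinated_pmf_start : P [set w | 0 < L 0 w] = 0%E ->
  p 0 0 = 1 /\ forall k : nat, (1 <= k)%N -> p k 0 = 0.
Proof.
move=> PL.
have h1 : expands (fun=> 1) (fun k : nat => p k 0).
  apply: eq_expands (pE (lexx 0)); apply: nearW => u.
  have -> : (\int[P]_w (expR (- (psi u * L 0 w)))%:E = \int[P]_w 1%:E)%E.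
    apply: ge0_ae_eq_integral => //.
      by apply/measurable_EFinP/measurable_expRN; exact: mL.
    exists [set w | 0 < L 0 w]; split => //; first by apply/measurable_gt/mL.
    move=> w /= h; rewrite lt_neqAle L0// andbT; apply/negP => /eqP Lw; apply: h => _.
    by rewrite -Lw mulr0 oppr0 expR0.
  by rewrite integral_cst//= probability_setT mul1e.
have h k := expands_upto_uniq (h1 k.+1) (expands_cst 1 k.+1) (ltnSn k).
by split=> [|[//|k] _]; rewrite h.
Qed.

(** [E t] is the generating function of the [e j t], read at w(u); the multiplier of
    [second_order_relation] is B(y) = c (1 - y)^(1 / rho). *)
Lemma subordinated_pmf_relation (rho : R) (E : R -> R -> R) (e : nat -> R -> R)
    (rel : (R -> R) -> (R -> R) -> Prop) : 0 < rho ->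
  (forall t u : R, 0 < t -> 0 < u < 1 ->
    (\int[P]_w (expR (- (psi u * L t w)))%:E)%E =
    (E t (ig_infinitesimal eta (mu / beta) beta rho u))%:E) ->
  (forall t : R, 0 < t -> expands (E t) (fun j => e j t)) ->
  (forall (N : nat) (a : nat -> R) (f g : R -> R),
    (forall t : R, 0 < t -> f t = \sum_(j < N) a j * e j t) ->
    (forall t : R, 0 < t -> g t = \sum_(j < N) a j *
      shifted_sum (fun l => c * binom_coef rho^-1 l) e j t) -> rel f g) ->
  forall k : nat, exists g1 g2, [/\ rel (p k) g1, rel g1 g2 &
    forall t : R, 0 < t -> g2 t + 2 * (mu / beta) * g1 t =
      2 * (mu ^+ 2 / beta) * frac_difference eta (fun j => p j t) k].
Proof.
move=> rho0 LE Ee rel_sum k.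
have /andP[eta0 _] := heta.
have [we w0 w01] := infinitesimal_ig eta0 m0 hbeta rho0.
set w := ig_infinitesimal _ _ _ _ in we w0 w01 LE.
have wpos : \forall u \near 0^'+, 0 < w u.
  by near=> u; have /andP[] : 0 < w u < 1 by near: u.
have Bbeta := expandsZ c (expands_onem_powR rho^-1).
have quad : \forall u \near 0^'+,
    (c * (1 - w u) `^ rho^-1) ^+ 2 + 2 * (mu / beta) * (c * (1 - w u) `^ rho^-1) =
    2 * (mu ^+ 2 / beta) * (1 - u) `^ eta.
  near=> u.
  have u1 : u < 1 by near: u; exact: near0_lt1.
  rewrite ig_infinitesimalK// ig_exponent_quadratic ?powR_ge0//.
  by field; rewrite gt_eqF.
have pw (j : nat) (t : R) : 0 < t -> p j t = wexpansion w e (fun=> 1) j t.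
  move=> t0.
  have h1 := expands_wexpansion we w0 wpos (Ee t t0).
  have h2 : expands (fun u => E t (w u)) (fun k : nat => p k t).
    apply: eq_expands (pE (ltW t0)); near=> u.
    rewrite LE//; apply/andP; split; near: u; [exact: near0_gt0|exact: near0_lt1].
  exact: (expands_upto_uniq (h2 j.+1) (h1 j.+1)).
have [g1 [g2 [r1 r2 g12]]] := second_order_relation we w0 wpos Bbeta rel_sum
  quad (expands_onem_powR eta) pw k.
exists g1, g2; split=> // t t0; rewrite g12//.
by rewrite frac_difference_nat.
Unshelve. all: by end_near. Qed.

End subordinated_pmf.

Theorem proposition5p3 (R : realType) (d : measure_display)
    (T : measurableType d) (P : probability T R)
    (eta mu beta : R) (N1 Aeta S : R -> T -> R)
    (heta : 0 < eta < 1) (hmu : 0 < mu) (hbeta : 0 < beta)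
    (hN1 : poisson_process P 1 N1)
    (hAeta : stable_subordinator P eta Aeta)
    (hN1Aeta : independent_processes P [tuple N1; Aeta])
    (hS : inverse_gaussian_subordinator P mu beta S) :
  (forall (nu : R) (A : R -> T -> R), 0 < nu < 1 ->
     stable_subordinator P nu A ->
     independent_processes P
       [tuple time_changed N1 Aeta; S; inverse_process A] ->
     let p := pmf_at P (time_changed (time_changed (time_changed N1 Aeta) S)
                                     (inverse_process A)) in
     (forall k : nat,
        caputo_derivable nu (p k) /\
        caputo_derivable nu (caputo nu (p k)) /\
        forall t : R, 0 < t ->
          caputo nu (caputo nu (p k)) t - 2 * (mu / beta) * caputo nu (p k) t
          = 2 * (mu ^+ 2 / beta) * frac_difference eta (fun j => p j t) k) /\
     p 0 0 = 1 /\
     (forall k : nat, (1 <= k)%N -> p k 0 = 0)) /\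
  (forall (nu : R) (A : R -> T -> R), 1 < nu ->
     stable_subordinator P nu^-1 A ->
     independent_processes P [tuple time_changed N1 Aeta; S; A] ->
     let p := pmf_at P (time_changed (time_changed (time_changed N1 Aeta) S)
                                     A) in
     (forall k : nat,
        riemann_liouville_derivable nu (p k) /\
        riemann_liouville_derivable nu (riemann_liouville nu (p k)) /\
        forall t : R, 0 < t ->
          riemann_liouville nu (riemann_liouville nu (p k)) t
          + 2 * (mu / beta) * riemann_liouville nu (p k) t
          = 2 * (mu ^+ 2 / beta) * frac_difference eta (fun j => p j t) k) /\
     p 0 0 = 1 /\
     (forall k : nat, (1 <= k)%N -> p k 0 = 0)).
Proof.
have m0 : 0 < mu / beta by exact: divr_gt0.
have c0 : 0 < ig_exponent (mu / beta) beta 1 by exact: ig_exponent_gt0.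
have psiK rho (rho0 : 0 < rho) := ig_infinitesimalK eta m0 hbeta rho0.
have psi0 u : 0 < u < 1 -> 0 <= ig_exponent (mu / beta) beta ((1 - u) `^ eta).
  by move=> /andP[_ u1]; rewrite ltW// ig_exponent_gt0// powR_gt0// subr_gt0.
have w1 rho u : 0 <= 1 - ig_infinitesimal eta (mu / beta) beta rho u.
  by rewrite /ig_infinitesimal subKr powR_ge0.
set c := ig_exponent _ _ 1 in c0 psiK *.
split=> nu A nu1 hA hind p; split.
- move=> k.
  (* The second application of the operator meets - g1 instead of g1, hence the scalar [s];
     quantifying over [f'] admits functions known for t > 0 only, such as [caputo nu (p k)]. *)
  pose rel f g := forall f' (s : R), (forall t, 0 < t -> f' t = s * f t) ->
    caputo_derivable nu f' /\ forall t, 0 < t -> - caputo nu f' t = s * g t.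
  have [|||||g1 [g2 [r1 r2 g12]]] := @subordinated_pmf_relation _ _ _ P eta mu beta N1 Aeta S
      (inverse_process A) heta hmu hbeta hN1 hAeta hN1Aeta hS _ _ hind 1
      (fun t y => frac_series nu (fun n => (- (c * (1 - y))) ^+ n) t) (ml_poly nu c) rel ltr01 _ _ _ k.
  + by move=> t _; exact: measurable_inverse hA t.
  + by move=> w t _; exact: inverse_ge0.
  + move=> t u t0 u01; rewrite (inverse_stable_laplace nu1 hA)//; last exact: psi0.
    have /andP[_ u1] := u01.
    by rewrite -(psiK 1 ltr01 u)// invr1 powRr1// w1.
  + by move=> t _; exact: expands_ml_poly.
  + move=> N a f g fE gE f' s f'E.
    have [] := @caputo_ml_poly _ nu nu1 c c0 N (fun j => s * a j) f' (fun t => s * g t).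
    * by move=> t t0; rewrite f'E// fE// mulr_sumr; apply: eq_bigr => j _; rewrite mulrA.
    * move=> t t0; rewrite gE// mulr_sumr; apply: eq_bigr => j _; rewrite mulrA.
      by rewrite invr1.
    by [].
  have [d1 e1] := r1 (p k) 1 (fun t _ => esym (mul1r _)).
  have e1' t : 0 < t -> caputo nu (p k) t = -1 * g1 t.
    by move=> t0; rewrite mulN1r -[g1 t]mul1r -e1// opprK.
  have [d2 e2] := r2 _ _ e1'.
  (* The signs cancel in the iterated derivative and survive in the first-order term, whence its
     minus sign. *)
  split=> //; split=> // t t0; rewrite -g12// e1'// -[X in X - _]opprK e2//; ring.
- apply: (subordinated_pmf_start hmu hbeta hN1 hAeta hN1Aeta hS _ _ hind).
  + by move=> t _; exact: measurable_inverse hA t.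
  + by move=> w t _; exact: inverse_ge0.
  + exact: inverse_start hA.
- have nu0 : 0 < nu by exact: lt_trans nu1.
  have nuV0 : 0 < nu^-1 by rewrite invr_gt0.
  (* So that gam^nu, the factor contributed by the Riemann-Liouville derivative, is c. *)
  pose gam := c `^ nu^-1.
  have gam0 : 0 < gam by rewrite powR_gt0.
  have gamE : gam `^ nu = c by rewrite -powRrM mulVf ?gt_eqF// powRr1// ltW.
  move=> k.
  (* Since [f'] has to agree with [f] for t > 0 only, the relation applies to
     [riemann_liouville nu (p k)] itself. *)
  pose rel f g := forall f', (forall t, 0 < t -> f' t = f t) ->
    riemann_liouville_derivable nu f' /\ forall t, 0 < t -> riemann_liouville nu f' t = g t.
  have [|||||g1 [g2 [r1 r2 g12]]] := @subordinated_pmf_relation _ _ _ P eta mu beta N1 Aeta S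
      A heta hmu hbeta hN1 hAeta hN1Aeta hS _ _ hind nu^-1
      (fun t y => expR (- (gam * t * (1 - y)))) (exp_poly gam) rel nuV0 _ _ _ k.
  + by move=> t t0; exact: measurable_stable hA t t0.
  + by move=> w t; exact: subordinator_ge0 hA.1 w t.
  + move=> t u t0 u01; rewrite (stable_laplace hA (ltW t0))//; last exact: psi0.
    have /andP[_ u1] := u01.
    rewrite -(psiK nu^-1 nuV0 u)// invrK powRM ?powR_ge0 ?(ltW c0)// -powRrM mulfV ?gt_eqF//.
    by rewrite powRr1// mulrAC.
  + by move=> t t0; exact: expands_exp_poly.
  + move=> N a f g fE gE f' f'E.
    have [] := @riemann_liouville_exp_poly _ gam nu gam0 (ltW nu0) N a f'.
      by move=> t t0; rewrite f'E// fE.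
    by move=> h1 h2; split=> // t t0; rewrite h2// gE// invrK gamE.
  have [d1 e1] := r1 (p k) (fun _ _ => erefl).
  have [d2 e2] := r2 _ e1.
  by split=> //; split=> // t t0; rewrite -g12// e1// e2.
- apply: (subordinated_pmf_start hmu hbeta hN1 hAeta hN1Aeta hS _ _ hind).
  + by move=> t t0; exact: measurable_stable hA t t0.
  + by move=> w t; exact: subordinator_ge0 hA.1 w t.
  (* Every path of [A] starts at 0, so here the event is empty. *)
  + rewrite (_ : [set w | _] = set0) ?measure0//; apply/seteqP; split=> w //=.
    by case: hA => -[[_ -> _ _ _ _] _] _; rewrite ltxx.
Qed.
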